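(* For $k=1,2,\dots$ let $H_k=-wY^kv=-\sum_{i\in I}w_iY^kv_{i+k}$, viewed as functions on the Calogero--Moser space $\mathcal C_{\alpha,\lambda}$. Consider the map $\mathcal C_{\alpha,\lambda}\to\mathcal P$ which sends $(X,Y,v,w)$ to $L=MyM^{-1}$, where $$M=1-\sum_{i,j\in I}\epsilon_i w_i (X-x1_V)^{-1}(Y-y1_V)^{-1}v_j\epsilon_j .$$ Under this map, the (pairwise commuting) Hamiltonian flows on $\mathcal C_{\alpha,\lambda}$ with Hamiltonians $H_k$, $k=1,2,\dots$, with times $t_k$, are identified with the flows of the hierarchy $$\frac{\partial L}{\partial t_k}=\big[(L^k)_+,L\big],\qquad k=1,2,\dots;$$ that is, when a point of $\mathcal C_{\alpha,\lambda}$ moves along the flow of $H_k$ with time $t_k$, its image $L$ satisfies the $k$-th equation of the hierarchy, for every $k\ge1$.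
   Context: **Ring $\mathcal P$.** Fix $m\ge1$, $I=\mathbb Z/m\mathbb Z=\{0,\dots,m-1\}$ (indices are taken mod $m$), the cyclic group $\Gamma=\{e,s,\dots,s^{m-1}\}$ and a primitive $m$-th root of unity $\mu$. $\Gamma$ acts on $\mathbb C(x)$ by $s(f)(x)=f(\mu^{-1}x)$; $\mathbb C(x)*\Gamma$ is the crossed product (elements $\sum_\gamma a_\gamma(x)\gamma$ with $\gamma a=\gamma(a)\gamma$). Put $\epsilon_i=\frac1m\sum_{r=0}^{m-1}\mu^{-ir}s^r$. Fix parameters $\tau\in\mathbb C\setminus\{0\}$, $\varkappa_0,\dots,\varkappa_{m-1}\in\mathbb C$, and let $c_\gamma$ be defined by $\sum_i m\varkappa_i\epsilon_i=\sum_{\gamma\in\Gamma}c_\gamma\gamma$. Let $\theta$ be the automorphism of $\mathbb C(x)*\Gamma$ with $\theta(x)=x$, $\theta(s)=\mu s$, and $D(f)=\tau\partial(f)-\sum_{\gamma\ne e}c_\gamma x^{-1}(\gamma f-f\gamma)$, where $\partial(\sum a_\gamma\gamma)=\sum \frac{da_\gamma}{dx}\gamma$. $\mathcal P$ is the associative ring of formal series $\sum_{j\ge0}f_jy^{N-j}$ ($N\in\mathbb Z$, $f_j\in\mathbb C(x)*\Gamma$), with multiplication extending that of $\mathbb C(x)*\Gamma$ and determined by $yf=\theta^{-1}(f)y+D(f)$, $y^{-1}f=\sum_{p\ge0}(-1)^p(\theta D)^p\theta(f)\,y^{-1-p}$ for $f\in\mathbb C(x)*\Gamma$. (Here $y$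 plays the role of the Dunkl operator $y=\tau\frac{d}{dx}-\frac1x\sum_i m\varkappa_i\epsilon_i$.) One has $xy-yx=\sum_i\lambda_i\epsilon_i$ with $\lambda_i=m(\varkappa_{i-1}-\varkappa_i)-\tau$. For $S=\sum_j f_jy^{N-j}\in\mathcal P$ (coefficients written on the left), $S_+$ is the part with non-negative powers of $y$. Time derivatives of elements of $\mathcal P$ are taken coefficientwise, and $[A,B]=AB-BA$. **Regularity.** With $|\lambda|=\sum_{i\in I}\lambda_i$, it is assumed that $\lambda=(\lambda_0,\dots,\lambda_{m-1})$ is regular: $|\lambda|\neq0$ and $\lambda_i+\dots+\lambda_{j-1}\ne n|\lambda|$ for all $n\in\mathbb Z$, $1\le i<j\le m$. **Calogero--Moser space.** For $\alpha\in\mathbb N_0^m$ let $V_i=\mathbb C^{\alpha_i}$, $V=\bigoplus_{i\in I}V_i$. Let $R$ be the vector space of collections of linear maps $X_i:V_i\to V_{i+1}$, $Y_i:V_{i+1}\to V_i$, $v_i:\mathbb C\to V_i$, $w_i:V_i\to\mathbb C$ ($i\in I$), with the symplectic form $\omega=\sum_{i}(\mathrm{tr}(\mathrm dY_i\wedge \mathrm dX_i)+\mathrm dw_i\wedge \mathrm dv_i)$ and Poisson bracket $\{(X_i)_{ab},(Y_j)_{cd}\}=\delta_{ij}\delta_{ad}\delta_{bc}$, $\{(v_i)_a,(w_j)_b\}=\delta_{ij}\delta_{ab}$ (others zero). All maps are extended by zero to $V$; $X=\sum_iX_i$, $Y=\sum_iY_i$, $v=\sum_iv_i$, $w=\sum_iw_i$.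 $\mathcal C_{\alpha,\lambda}$ is the quotient of the subvariety of $R$ given by $$Y_iX_i-X_{i-1}Y_{i-1}-v_iw_i=\lambda_i1_{V_i}\qquad(i\in I)$$ by $\mathrm{GL}(\alpha)=\prod_i\mathrm{GL}(\alpha_i,\mathbb C)$ acting by $(X,Y,v,w)\mapsto(gXg^{-1},gYg^{-1},gv,wg^{-1})$; it carries the symplectic structure obtained by Hamiltonian reduction from $(R,\omega)$ (for regular $\lambda$ the action is free). The functions $H_k$ and the element $M$ are $\mathrm{GL}(\alpha)$-invariant. The Hamiltonian flow of $H_k$ (convention $\dot f=\{f,H_k\}$) is induced by the flow on $R$: $\dot X=-\sum_{\ell\in I}\sum_{a=0}^{k-1}Y^av_\ell w_{\ell-k}Y^{k-a-1}$, $\dot Y=0$, $\dot v=-Y^kv$, $\dot w=wY^k$. **Interpretation of formulas.** Expressions are computed in $\mathcal P\otimes\mathrm{End}\,V$, where elements of $\mathcal P$ and of $\mathrm{End}\,V$ commute; $(X-x1_V)^{-1}\in\mathbb C(x)\otimes\mathrm{End}\,V$ and $(Y-y1_V)^{-1}:=-\sum_{k\ge0}Y^ky^{-k-1}$; $v_j,w_i$ are extended $\mathcal P$-linearly to maps $\mathcal P\to\mathcal P\otimes V$, $\mathcal P\otimes V\to\mathcal P$. E.g. $\epsilon_iw_i(X-x1_V)^{-1}(Y-y1_V)^{-1}v_j\epsilon_j=-\sum_{k\ge0}\epsilon_i\,\big(w_i(X-x1_V)^{-1}Y^kv_j\big)\,y^{-k-1}\epsilon_j\in\mathcal P$. The element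 $M$ lies in $1+\{\text{series with only negative powers of }y\}$, hence is invertible. *)

(* Defs.v *)
From HB Require Import structures.
From mathcomp Require Import all_boot all_order all_algebra.
From mathcomp Require Import generic_quotient fraction complex.
From mathcomp Require Import boolp classical_sets functions cardinality fsbigop.
From mathcomp Require Import reals topology normedtype derive.
From mathcomp Require Import ring zify.
Set Implicit Arguments.
Unset Strict Implicit.
Unset Printing Implicit Defensive.
Import Order.TTheory GRing.Theory Num.Theory.
Import numFieldNormedType.Exports.
Local Open Scope ring_scope.
Local Open Scope quotient_scope.

Section RationalFunctions.
Variable K : fieldType.
Implicit Types (f g : {fraction {poly K}}) (p q : {poly K}) (a c : K).

Local Notation polyF := (@FracField.tofrac {poly K}).

Definition xF : {fraction {poly K}} := polyF 'X.
Definition constF (c : K) : {fraction {poly K}} := polyF c%:P.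
HB.instance Definition _ := GRing.RMorphism.copy constF (polyF \o polyC).

Definition numF f : {poly K} := \n_(repr f).
Definition denF f : {poly K} := \d_(repr f).

(* The substitution [f(a x)]. *)
Definition scaleF a f :=
  polyF (numF f \Po (a *: 'X)) / polyF (denF f \Po (a *: 'X)).

Definition derivF f :=
  polyF ((numF f)^`() * denF f - numF f * (denF f)^`()) / polyF (denF f ^+ 2).

Lemma denF_neq0 f : denF f != 0.
Proof. exact: denom_ratioP. Qed.

Lemma tofrac_neq0 p : (polyF p != 0) = (p != 0).
Proof. by rewrite tofrac_eq0. Qed.

Lemma fracE (r : {ratio {poly K}}) :
  \pi_{fraction {poly K}} r = polyF \n_r / polyF \d_r.
Proof.
apply: (mulIf (_ : polyF \d_r != 0)); first by rewrite tofrac_neq0 denom_ratioP.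
rewrite mulfVK ?tofrac_neq0 ?denom_ratioP //.
rewrite /FracField.tofrac; unlock.
rewrite !piE.
apply/eqmodP; rewrite /= /FracField.equivf /FracField.mulf.
rewrite !numden_Ratio ?mulf_neq0 ?oner_eq0 ?denom_ratioP //.
by rewrite !mulr1 mulrC.
Qed.

Lemma ratfunE f : f = polyF (numF f) / polyF (denF f).
Proof. by rewrite -fracE reprK. Qed.

Lemma frac_eq p q p' q' : q != 0 -> q' != 0 ->
  (polyF p / polyF q == polyF p' / polyF q') = (p * q' == p' * q).
Proof.
move=> q0 q0'; rewrite eqr_div ?tofrac_neq0 //.
by rewrite -!rmorphM tofrac_eq.
Qed.

Lemma numdenF p q : q != 0 ->
  numF (polyF p / polyF q) * q = p * denF (polyF p / polyF q).
Proof.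
move=> q0; apply/eqP; rewrite -frac_eq ?denF_neq0 //.
by rewrite -ratfunE.
Qed.

Lemma comp_scale_neq0 a p : a != 0 -> p != 0 -> p \Po (a *: 'X) != 0.
Proof.
move=> a0; rewrite comp_poly_eq0 //.
by rewrite size_scale // size_polyX.
Qed.

Lemma scaleFE a p q : a != 0 -> q != 0 ->
  scaleF a (polyF p / polyF q)
  = polyF (p \Po (a *: 'X)) / polyF (q \Po (a *: 'X)).
Proof.
move=> a0 q0; apply/eqP; rewrite frac_eq ?comp_scale_neq0 ?denF_neq0 //.
by rewrite -!comp_polyM numdenF.
Qed.

Lemma derivFE p q : q != 0 ->
  derivF (polyF p / polyF q)
  = polyF (p^`() * q - p * q^`()) / polyF (q ^+ 2).
Proof.
move=> q0; set f := _ / _; apply/eqP.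
rewrite frac_eq ?expf_neq0 ?denF_neq0 //.
have e : numF f * q = p * denF f by apply: numdenF.
have e' : (numF f)^`() * q + numF f * q^`() = p^`() * denF f + p * (denF f)^`().
  by rewrite -!derivM e.
apply/eqP; move: (numF f) (denF f) e e' => n d e e'.
have -> : (n^`() * d - n * d^`()) * q ^+ 2 =
   d * q * (n^`() * q + n * q^`()) - (n * q) * (d * q^`() + d^`() * q) by ring.
by rewrite e' e; ring.
Qed.

Lemma fracP f : exists p q, q != 0 /\ f = polyF p / polyF q.
Proof. by exists (numF f), (denF f); rewrite denF_neq0 -ratfunE. Qed.

Lemma fracD p q p' q' : q != 0 -> q' != 0 ->
  polyF p / polyF q + polyF p' / polyF q'
  = polyF (p * q' + p' * q) / polyF (q * q').
Proof. by move=> ? ?; rewrite addf_div ?tofrac_neq0 // -!rmorphM -rmorphD. Qed.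

Lemma fracM p q p' q' :
  (polyF p / polyF q) * (polyF p' / polyF q') = polyF (p * p') / polyF (q * q').
Proof. by rewrite mulf_div -!rmorphM. Qed.

Lemma tofrac_div1 p : polyF p = polyF p / polyF 1.
Proof. by rewrite rmorph1 divr1. Qed.

Lemma scaleF_tofrac a p : a != 0 -> scaleF a (polyF p) = polyF (p \Po (a *: 'X)).
Proof.
move=> a0; rewrite {1}tofrac_div1 scaleFE ?oner_eq0 //.
by rewrite -polyC1 comp_polyC polyC1 rmorph1 divr1.
Qed.

Lemma scaleF_const a c : a != 0 -> scaleF a (constF c) = constF c.
Proof. by move=> a0; rewrite /constF scaleF_tofrac // comp_polyC. Qed.

Lemma scaleF_x a : a != 0 -> scaleF a xF = constF a * xF.
Proof. by move=> a0; rewrite /xF scaleF_tofrac // comp_polyX -mul_polyC rmorphM. Qed.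

Lemma scaleFD a f g : a != 0 -> scaleF a (f + g) = scaleF a f + scaleF a g.
Proof.
move=> a0; have [p [q [q0 ->]]] := fracP f; have [p' [q' [q0' ->]]] := fracP g.
rewrite fracD // !scaleFE ?mulf_neq0 // fracD ?comp_scale_neq0 //.
by rewrite comp_polyD !comp_polyM.
Qed.

Lemma scaleFM a f g : a != 0 -> scaleF a (f * g) = scaleF a f * scaleF a g.
Proof.
move=> a0; have [p [q [q0 ->]]] := fracP f; have [p' [q' [q0' ->]]] := fracP g.
by rewrite fracM !scaleFE ?mulf_neq0 // fracM !comp_polyM.
Qed.

Lemma scaleF0 a : a != 0 -> scaleF a 0 = 0.
Proof. by move=> a0; rewrite -(rmorph0 constF) scaleF_const. Qed.

Lemma scaleF1 a : a != 0 -> scaleF a 1 = 1.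
Proof. by move=> a0; rewrite -(rmorph1 constF) scaleF_const. Qed.

Lemma scaleF_id f : scaleF 1 f = f.
Proof. by rewrite /scaleF scale1r !comp_polyXr -ratfunE. Qed.

Lemma scaleF_comp a b f : a != 0 -> b != 0 ->
  scaleF a (scaleF b f) = scaleF (a * b) f.
Proof.
move=> a0 b0; have [p [q [q0 ->]]] := fracP f.
rewrite !scaleFE ?mulf_neq0 ?comp_scale_neq0 // -!comp_polyA.
by rewrite comp_polyZ comp_polyX scalerA (mulrC b).
Qed.

Lemma scaleF_sum a I (r : seq I) (P : pred I) (F : I -> {fraction {poly K}}) :
  a != 0 -> scaleF a (\sum_(i <- r | P i) F i) = \sum_(i <- r | P i) scaleF a (F i).
Proof.
move=> a0; exact: (big_morph (scaleF a) (fun f g => scaleFD f g a0) (scaleF0 a0)).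
Qed.

Lemma derivFD f g : derivF (f + g) = derivF f + derivF g.
Proof.
have [p [q [q0 ->]]] := fracP f; have [p' [q' [q0' ->]]] := fracP g.
rewrite fracD // !derivFE ?mulf_neq0 // fracD ?expf_neq0 //.
apply/eqP; rewrite frac_eq ?(mulf_neq0, expf_neq0) //.
by rewrite derivD !derivM; apply/eqP; ring.
Qed.

Lemma derivFM f g : derivF (f * g) = derivF f * g + f * derivF g.
Proof.
have [p [q [q0 ->]]] := fracP f; have [p' [q' [q0' ->]]] := fracP g.
rewrite fracM // !derivFE ?mulf_neq0 // !fracM fracD ?(mulf_neq0, expf_neq0) //.
apply/eqP; rewrite frac_eq ?(mulf_neq0, expf_neq0) //.
by rewrite !derivM; apply/eqP; ring.
Qed.

Lemma derivF_const c : derivF (constF c) = 0.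
Proof.
rewrite /constF tofrac_div1 derivFE ?oner_eq0 // derivC -polyC1 derivC.
by rewrite mulr0 mul0r subr0 rmorph0 mul0r.
Qed.

Lemma derivF_scaleF a f : a != 0 ->
  derivF (scaleF a f) = constF a * scaleF a (derivF f).
Proof.
move=> a0; have [p [q [q0 ->]]] := fracP f.
rewrite derivFE // !scaleFE ?expf_neq0 // derivFE ?comp_scale_neq0 //.
rewrite /constF [RHS]mulrA -rmorphM; congr (polyF _ / polyF _).
- rewrite !deriv_comp derivZ derivX -mul_polyC mulr1.
  by rewrite comp_polyB !comp_polyM; ring.
- by rewrite !expr2 comp_polyM.
Qed.
End RationalFunctions.
(* Data for a ring of formal series in [y^-1] over [A] with
   [y f = theta^-1(f) y + D(f)]; [thetaV] is the inverse of [theta]. *)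
Record ore_data (A : nzRingType) := OreData {
  theta : {rmorphism A -> A};
  thetaV : {rmorphism A -> A};
  oreD : {additive A -> A};
  thetaK : cancel theta thetaV;
  thetaVK : cancel thetaV theta;
  oreDM : forall f g, oreD (f * g) = thetaV f * oreD g + oreD f * g }.

(* The series [sum_n (coef n) y^n], coefficients on the left, whose degrees in
   [y] are bounded above. *)
Record series (A : nzRingType) (o : ore_data A) := Series {
  coef :> int -> A;
  coef_bounded : exists N : nat, forall n : int, N%:Z < n -> coef n = 0 }.

Section OreSeries.
Variables (A : nzRingType) (o : ore_data A).
Local Notation th := (theta o).
Local Notation thV := (thetaV o).
Local Notation D := (oreD o).
Implicit Types (F G H : int -> A) (S T : series o) (n j k : int) (N B : nat).

(* Left multiplication by [y], [y^-1] and [y^j] on coefficients: by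
   [y (f y^k) = theta^-1(f) y^(k+1) + D(f) y^k] and
   [y^-1 (f y^k) = sum_p (-1)^p (theta D)^p theta(f) y^(k-1-p)]. *)
Definition ymul F : int -> A := fun n => thV (F (n - 1)) + D (F n).

Definition yinv F : int -> A := fun n =>
  \sum_(p \in [set: nat])
     (-1) ^+ p * iter p (th \o D) (th (F (n + 1 + p%:Z))).

Definition ypow (j : int) F : int -> A :=
  match j with Posz k => iter k ymul F | Negz k => iter k.+1 yinv F end.

(* [(sum_j F_j y^j) G]; at each degree the sum has finite support. *)
Definition mul_coef F G : int -> A := fun n =>
  \sum_(j \in [set: int]) F j * ypow j G n.

Definition bnd N F := forall n, N%:Z < n -> F n = 0.

Definition window B : seq int := [seq i%:Z - B%:Z | i <- iota 0 B.*2.+1].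

Lemma window_uniq B : uniq (window B).
Proof. by rewrite map_inj_uniq ?iota_uniq // => i j; lia. Qed.

Lemma mem_window B n : (n \in window B) = (`|n| <= B)%N.
Proof.
apply/mapP/idP => [[k0 mk0 ->]|nB]; first by move: mk0; rewrite mem_iota; lia.
by exists (absz (n + B%:Z)); rewrite ?mem_iota; lia.
Qed.

Lemma sumZE B (f : int -> A) : (forall n, (B < `|n|)%N -> f n = 0) ->
  \sum_(j \in [set: int]) f j = \sum_(j <- window B) f j.
Proof.
move=> f0; rewrite (fsbigE (window B)) ?window_uniq //.
  by apply: eq_bigl => j; rewrite in_setT.
by move=> j _; rewrite mem_window -ltnNge => /f0.
Qed.

Lemma sumNE N (f : nat -> A) : (forall p, (N <= p)%N -> f p = 0) ->
  \sum_(p \in [set: nat]) f p = \sum_(p < N) f p.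
Proof.
move=> f0; rewrite fsbig_ord; apply/esym/fsbig_widen => // p /= [_ /negP].
by rewrite -leqNgt; exact: f0.
Qed.

Lemma iterD0 p : iter p (th \o D) 0 = 0.
Proof. by elim: p => //= p ->; rewrite !raddf0. Qed.

Lemma iterDD p a b :
  iter p (th \o D) (a + b) = iter p (th \o D) a + iter p (th \o D) b.
Proof. by elim: p => //= p ->; rewrite !raddfD. Qed.

Lemma yinvE M F n : bnd M F ->
  yinv F n = \sum_(p < (M + `|n|).+1) (-1) ^+ p * iter p (th \o D) (th (F (n + 1 + p%:Z))).
Proof.
move=> FM; rewrite /yinv (sumNE (N := (M + `|n|).+1)) // => p le_p.
by rewrite FM ?raddf0 ?iterD0 ?mulr0 //; lia.
Qed.

Lemma bnd_ymul N F : bnd N F -> bnd N.+1 (ymul F).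
Proof.
by move=> FN n lt_n; rewrite /ymul !FN ?raddf0 ?addr0 //; lia.
Qed.

Lemma bnd_yinv N F : bnd N F -> bnd N (yinv F).
Proof.
move=> FN n lt_n; rewrite (yinvE _ FN) big1 // => p _.
by rewrite FN ?raddf0 ?iterD0 ?mulr0 //; lia.
Qed.

Lemma yinv_rec N F n : bnd N F -> yinv F (n - 1) = th (F n - D (yinv F n)).
Proof.
move=> FN; pose K := (N + `|n| + 2)%N.
have E m : (`|m| <= `|n|.+1)%N -> forall K', (K <= K')%N ->
    yinv F m = \sum_(p < K') (-1) ^+ p * iter p (th \o D) (th (F (m + 1 + p%:Z))).
  move=> m_n K' leK; rewrite /yinv (sumNE (N := K')) // => p le_p.
  by rewrite FN ?raddf0 ?iterD0 ?mulr0 //; lia.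
rewrite (E (n - 1) _ K.+1) //; last by lia.
rewrite (E n _ K) //.
rewrite big_ord_recl /= expr0 mul1r raddfB /=; congr (_ + _).
  by congr (th (F _)); lia.
rewrite !raddf_sum /=; apply: eq_bigr => p _.
rewrite /bump /= add1n exprS mulN1r mulNr -(signr_odd _ p) !mulr_sign /=; congr (- _).
have -> : n - 1 + 1 + (p.+1)%:Z = n + 1 + p%:Z by lia.
by case: (odd p); rewrite /= ?raddfN.
Qed.

Lemma ymul_yinv N F : bnd N F -> ymul (yinv F) = F.
Proof.
move=> FN; apply: funext => n; rewrite /ymul (yinv_rec _ FN) thetaK subrK //.
Qed.

Lemma bnd0 N F : bnd N F -> ymul F = (fun=> 0) -> F = fun=> 0.
Proof.
move=> FN yF; apply: funext => n.
have [m] : exists m, (N%:Z - n < m%:Z) by exists (absz (N%:Z - n)).+1; lia.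
elim: m n => [|m IHm] n lt_m; first by rewrite FN //; lia.
have := congr1 (fun G => G (n + 1)) yF; rewrite /ymul addrK.
rewrite (IHm (n + 1)) ?raddf0 ?addr0; last by lia.
by move/(congr1 th); rewrite thetaVK raddf0.
Qed.

Lemma ymulB F G : ymul (fun n => F n - G n) = fun n => ymul F n - ymul G n.
Proof.
apply: funext => n; rewrite /ymul !raddfB /= opprD addrACA //.
Qed.

Lemma ymul_inj N F G : bnd N F -> bnd N G -> ymul F = ymul G -> F = G.
Proof.
move=> FN GN eFG; apply: funext => n; apply/eqP; rewrite -subr_eq0; apply/eqP.
have e : (fun n => F n - G n) = fun=> 0.
  apply: (@bnd0 N) => [k lt_k|]; first by rewrite FN // GN // subr0.
  by rewrite ymulB eFG; apply: funext => k; rewrite subrr.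
exact: (congr1 (fun H => H n) e).
Qed.

Lemma yinv_ymul N F : bnd N F -> yinv (ymul F) = F.
Proof.
move=> FN; have yFN := bnd_ymul FN.
apply: (@ymul_inj N.+1); first exact: bnd_yinv.
  by move=> n ?; apply: FN; lia.
exact: ymul_yinv yFN.
Qed.

Lemma bnd_ypow N F j : bnd N F -> bnd (N + `|j|) (ypow j F).
Proof.
move=> FN; case: j => k /=.
  elim: k => [|k IHk] /=; first by rewrite addn0.
  by rewrite addnS; exact: bnd_ymul.
have : bnd N (iter k.+1 yinv F) by elim: k.+1 => //= p; exact: bnd_yinv.
by move=> H n ?; apply: H; lia.
Qed.

Lemma ymulF_shift m F : (forall n, m < n -> F n = 0) ->
  forall n, m + 1 < n -> ymul F n = 0.
Proof.
by move=> FN n lt_n; rewrite /ymul !FN ?raddf0 ?addr0 //; lia.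
Qed.

Lemma yinvF_shift N m F : bnd N F -> (forall n, m < n -> F n = 0) ->
  forall n, m - 1 < n -> yinv F n = 0.
Proof.
move=> FN Fm n lt_n; rewrite (yinvE _ FN) big1 // => p _.
by rewrite Fm ?raddf0 ?iterD0 ?mulr0 //; lia.
Qed.

Lemma ypow_deg N F j n : bnd N F -> N%:Z + j < n -> ypow j F n = 0.
Proof.
move=> FN; case: j => k /=.
  elim: k n => [|k IHk] n; first by rewrite addr0; exact: FN.
  by move=> lt_n; apply: (ymulF_shift IHk); lia.
have bn p : bnd N (iter p yinv F) by elim: p => //= p; exact: bnd_yinv.
have dg p m : N%:Z - p%:Z < m -> iter p yinv F m = 0.
  elim: p m => [|p IHp] m; first by rewrite subr0; exact: FN.
  by move=> lt_m; apply: (yinvF_shift (bn p) IHp); lia.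
by move=> lt_n; apply: (dg k.+1); lia.
Qed.

Lemma ypowS N j F : bnd N F -> ypow (j + 1) F = ymul (ypow j F).
Proof.
move=> FN; have bn p : bnd N (iter p yinv F).
  by elim: p => //= p; exact: bnd_yinv.
case: j => [k|[|k]]; rewrite /ypow.
- by rewrite -PoszD addn1.
- by rewrite /= (ymul_yinv FN).
- have -> : Negz k.+1 + 1 = Negz k by lia.
  by rewrite /= (ymul_yinv (bn k.+1)).
Qed.

Lemma ypow_pred N j F : bnd N F -> ypow (j - 1) F = yinv (ypow j F).
Proof.
move=> FN; have := ypowS (j - 1) FN; rewrite subrK => ->.
by rewrite (yinv_ymul (bnd_ypow (j := j - 1) FN)).
Qed.

Lemma ymulD F G : ymul (fun n => F n + G n) = fun n => ymul F n + ymul G n.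
Proof. by apply: funext => n; rewrite /ymul !raddfD /= addrACA. Qed.

Lemma yinvD N F G : bnd N F -> bnd N G ->
  yinv (fun n => F n + G n) = fun n => yinv F n + yinv G n.
Proof.
move=> FN GN; apply: funext => n.
rewrite !(yinvE (M := N)) // => [|k lt_k]; last by rewrite FN // GN // addr0.
by rewrite -big_split; apply: eq_bigr => p _; rewrite raddfD /= iterDD mulrDr.
Qed.

Lemma ypowD N j F G : bnd N F -> bnd N G ->
  ypow j (fun n => F n + G n) = fun n => ypow j F n + ypow j G n.
Proof.
move=> FN GN; case: j => k; rewrite /ypow.
  by elim: k => //= k ->; rewrite ymulD.
have bn p E : bnd N E -> bnd N (iter p yinv E).
  by move=> EN; elim: p => //= p; exact: bnd_yinv.
by elim: k.+1 => //= p ->; rewrite (@yinvD N) //; apply: bn.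
Qed.

Definition delta (a : A) (j : int) : int -> A := fun n => if n == j then a else 0.

Lemma oreD1 : D 1 = 0.
Proof.
have := oreDM o 1 1; rewrite rmorph1 !mulr1 mul1r => e.
by apply: (addrI (D 1)); rewrite addr0 -e.
Qed.

Lemma bnd_delta a j : bnd `|j| (delta a j).
Proof. by move=> n lt_n; rewrite /delta; case: eqP => // e; lia. Qed.

Lemma ymul_delta1 j : ymul (delta 1 j) = delta 1 (j + 1).
Proof.
apply: funext => n; rewrite /ymul /delta subr_eq.
have -> : D (if n == j then 1 else 0) = 0 by case: ifP; rewrite ?oreD1 ?raddf0.
by rewrite addr0; case: ifP; rewrite ?rmorph1 ?rmorph0.
Qed.

Lemma yinv_delta1 j : yinv (delta 1 j) = delta 1 (j - 1).
Proof.
by rewrite -{1}(subrK 1 j) -ymul_delta1 (yinv_ymul (@bnd_delta 1 _)).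
Qed.

Lemma ypow_delta1 j : ypow j (delta 1 0) = delta 1 j.
Proof.
case: j => k; rewrite /ypow.
  by elim: k => //= k ->; rewrite ymul_delta1 -PoszD addn1.
rewrite NegzE; elim: k.+1 => //= p ->; rewrite yinv_delta1.
by congr delta; lia.
Qed.

(* Product of coefficient functions on any sufficiently large window. *)
Lemma mul_coefE NF NG B F G n : bnd NF F -> bnd NG G ->
  (NF + NG + `|n| <= B)%N ->
  mul_coef F G n = \sum_(j <- window B) F j * ypow j G n.
Proof.
move=> FN GN leB; apply: sumZE => j lt_j.
have [lt_Nj | le_jN] := ltP NF%:Z j; first by rewrite FN ?mul0r.
by rewrite (ypow_deg GN) ?mulr0 //; lia.
Qed.

Lemma bnd_mul NF NG F G : bnd NF F -> bnd NG G -> bnd (NF + NG) (mul_coef F G).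
Proof.
move=> FN GN n lt_n; rewrite (mul_coefE FN GN (leqnn _)) big1 // => j _.
have [lt_Nj | le_jN] := ltP NF%:Z j; first by rewrite FN ?mul0r.
by rewrite (ypow_deg GN) ?mulr0 //; lia.
Qed.

Lemma bndW N N' F : (N <= N')%N -> bnd N F -> bnd N' F.
Proof. by move=> le_N FN n lt_n; apply: FN; lia. Qed.

Lemma sumZ_split (f g : int -> A) B :
  (forall n, (B < `|n|)%N -> f n = 0) -> (forall n, (B < `|n|)%N -> g n = 0) ->
  \sum_(j \in [set: int]) (f j + g j) =
  \sum_(j \in [set: int]) f j + \sum_(j \in [set: int]) g j.
Proof.
move=> f0 g0; rewrite !(sumZE (B := B)) ?big_split // => n lt_n.
by rewrite f0 // g0 // addr0.
Qed.

Lemma sumZ_shift (f : int -> A) :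
  \sum_(j \in [set: int]) f j = \sum_(j \in [set: int]) f (j + 1).
Proof.
apply: (reindex_fsbigT (fun j => j + 1)).
by exists (fun j => j - 1) => j; rewrite ?addrK ?subrK.
Qed.

Lemma ymul_mul NG NH G H : bnd NG G -> bnd NH H ->
  ymul (mul_coef G H) = mul_coef (ymul G) H.
Proof.
move=> GN HN; apply: funext => n.
pose B := (NG + NH + `|n| + 3)%N.
rewrite {1}/ymul !(mul_coefE (B := B) GN HN); [|by lia..].
rewrite !raddf_sum /= -big_split /=.
under eq_bigr => j _ do rewrite rmorphM oreDM addrA -mulrDr -/(ymul _ n) -(ypowS _ HN).
rewrite -(sumZE (f := fun j => thV (G j) * ypow (j + 1) H n + D (G j) * ypow j H n)).
  rewrite (@sumZ_split _ _ B) => [|j lt_j|j lt_j].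
  - rewrite (sumZ_shift (fun j => D (G j) * ypow j H n)).
    rewrite /mul_coef (sumZ_shift (fun j => ymul G j * _)).
    rewrite /ymul -(@sumZ_split _ _ B.+1).
    + by apply: eq_fsbigr => j _; rewrite addrK mulrDl.
    + move=> j lt_j.
      have [lt_Nj | le_jN] := ltP NG%:Z j; first by rewrite GN ?raddf0 ?mul0r.
      by rewrite (ypow_deg HN) ?mulr0 //; lia.
    + move=> j lt_j.
      have [lt_Nj | le_jN] := ltP NG%:Z (j + 1); first by rewrite GN ?raddf0 ?mul0r.
      by rewrite (ypow_deg HN) ?mulr0 //; lia.
  - have [lt_Nj | le_jN] := ltP NG%:Z j; first by rewrite GN ?raddf0 ?mul0r.
    by rewrite (ypow_deg HN) ?mulr0 //; lia.
  - have [lt_Nj | le_jN] := ltP NG%:Z j; first by rewrite GN ?raddf0 ?mul0r.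
    by rewrite (ypow_deg HN) ?mulr0 //; lia.
move=> j lt_j.
have [lt_Nj | le_jN] := ltP NG%:Z j; first by rewrite GN ?raddf0 ?mul0r ?add0r.
by rewrite !(ypow_deg HN) ?mulr0 ?addr0 //; lia.
Qed.

Lemma yinv_mul NG NH G H : bnd NG G -> bnd NH H ->
  yinv (mul_coef G H) = mul_coef (yinv G) H.
Proof.
move=> GN HN; have yGN := bnd_yinv GN; have GHN := bnd_mul GN HN.
apply: (ymul_inj (bnd_yinv GHN) (bnd_mul yGN HN)).
by rewrite (ymul_yinv GHN) (ymul_mul yGN HN) (ymul_yinv GN).
Qed.

Lemma ypow_mul NG NH j G H : bnd NG G -> bnd NH H ->
  ypow j (mul_coef G H) = mul_coef (ypow j G) H.
Proof.
move=> GN HN; case: j => k.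
  elim: k => [//|k IHk]; rewrite /= in IHk *; rewrite IHk.
  by rewrite (ymul_mul (bnd_ypow (j := Posz k) GN) HN).
rewrite /ypow; have bn p : bnd NG (iter p yinv G).
  by elim: p => //= p; exact: bnd_yinv.
by elim: k.+1 => //= p ->; rewrite (yinv_mul (bn p) HN).
Qed.

Lemma mul_coefA NF NG NH F G H : bnd NF F -> bnd NG G -> bnd NH H ->
  mul_coef F (mul_coef G H) = mul_coef (mul_coef F G) H.
Proof.
move=> FN GN HN; apply: funext => n.
pose B := (NF + NG + NH + `|n|)%N; pose B' := (B + NF + NG)%N.
have FGN := bnd_mul FN GN; have GHN := bnd_mul GN HN.
rewrite (mul_coefE (B := B) FN GHN) ?(mul_coefE (B := B) FGN HN); [|by lia..].
transitivity (\sum_(k <- window B) \sum_(j <- window B')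
    F j * ypow j G k * ypow k H n); last first.
  rewrite big_seq [RHS]big_seq; apply: eq_bigr => k; rewrite mem_window => le_k.
  by rewrite -mulr_suml (mul_coefE (B := B') FN GN) //; lia.
rewrite exchange_big /=.
rewrite -(sumZE (B := B)); last first.
  move=> j lt_j; have [?|?] := ltP NF%:Z j; first by rewrite FN ?mul0r.
  by rewrite (ypow_deg GHN) ?mulr0 //; lia.
rewrite (sumZE (B := B')); last first.
  move=> j lt_j; have [?|?] := ltP NF%:Z j; first by rewrite FN ?mul0r.
  by rewrite (ypow_deg GHN) ?mulr0 //; lia.
apply: eq_bigr => j _; under [RHS]eq_bigr => k _ do rewrite -mulrA.
rewrite -mulr_sumr; have [lt_j|le_j] := ltP NF%:Z j; first by rewrite FN ?mul0r.
congr (_ * _); rewrite (ypow_mul _ GN HN); apply: sumZE => k lt_k.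
have [lt_Nk|le_k] := ltP (NG%:Z + j) k; first by rewrite (ypow_deg GN) ?mul0r.
by rewrite (ypow_deg HN) ?mulr0 //; lia.
Qed.

Lemma mul_coef1l F : mul_coef (delta 1 0) F = F.
Proof.
apply: funext => n; rewrite /mul_coef (sumZE (B := 0)) => [|j lt_j].
  by rewrite /window /= big_seq1 subrr /delta eqxx mul1r.
by rewrite /delta; case: eqP => [e|_]; rewrite ?mul0r //; lia.
Qed.

Lemma mul_coef1r F : mul_coef F (delta 1 0) = F.
Proof.
apply: funext => n; rewrite /mul_coef (sumZE (B := `|n|)) => [|j lt_j].
  rewrite (bigD1_seq n) ?window_uniq ?mem_window //= big1 => [|j /negPf nj].
    by rewrite addr0 ypow_delta1 /delta eqxx mulr1.
  by rewrite ypow_delta1 /delta eq_sym nj mulr0.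
by rewrite ypow_delta1 /delta; case: eqP => [e|_]; rewrite ?mulr0 //; lia.
Qed.

Lemma mul_coefDl NF NG NH F G H : bnd NF F -> bnd NG G -> bnd NH H ->
  mul_coef (fun n => F n + G n) H = fun n => mul_coef F H n + mul_coef G H n.
Proof.
move=> FN GN HN; apply: funext => n.
pose N := (NF + NG)%N; pose B := (N + NH + `|n|)%N.
have FN' : bnd N F by apply: bndW FN; rewrite leq_addr.
have GN' : bnd N G by apply: bndW GN; rewrite leq_addl.
have FGN : bnd N (fun n => F n + G n).
  by move=> k lt_k; rewrite FN' // GN' // addr0.
rewrite !(mul_coefE (B := B) (NF := N) (NG := NH)) //.
by rewrite -big_split; apply: eq_bigr => j _; rewrite mulrDl.
Qed.

Lemma mul_coefDr NF NG NH F G H : bnd NF F -> bnd NG G -> bnd NH H ->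
  mul_coef F (fun n => G n + H n) = fun n => mul_coef F G n + mul_coef F H n.
Proof.
move=> FN GN HN; apply: funext => n.
pose N := (NG + NH)%N; pose B := (NF + N + `|n|)%N.
have GN' : bnd N G by apply: bndW GN; rewrite leq_addr.
have HN' : bnd N H by apply: bndW HN; rewrite leq_addl.
have GHN : bnd N (fun n => G n + H n).
  by move=> k lt_k; rewrite GN' // HN' // addr0.
rewrite !(mul_coefE (B := B) (NF := NF) (NG := N)) //.
by rewrite -big_split; apply: eq_bigr => j _; rewrite (ypowD _ GN' HN') mulrDr.
Qed.

HB.instance Definition _ := gen_eqMixin (series o).
HB.instance Definition _ := gen_choiceMixin (series o).

Lemma seriesP S T : coef S = coef T -> S = T.
Proof.
by case: S T => [F bF] [G bG] /= e; rewrite e in bF *; congr Series; exact: Prop_irrelevance.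
Qed.

Lemma zero_bounded : exists N : nat, bnd N (fun=> 0).
Proof. by exists 0. Qed.
Definition series0 : series o := Series o zero_bounded.

Lemma add_bounded S T : exists N : nat, bnd N (fun n => S n + T n).
Proof.
have [[M SM] [N TN]] := (coef_bounded S, coef_bounded T).
by exists (M + N)%N => n lt_n; rewrite SM ?TN ?addr0 //; lia.
Qed.
Definition series_add S T : series o := Series o (add_bounded S T).

Lemma opp_bounded S : exists N : nat, bnd N (fun n => - S n).
Proof.
by have [M SM] := coef_bounded S; exists M => n lt_n; rewrite SM ?oppr0.
Qed.
Definition series_opp S : series o := Series o (opp_bounded S).

Lemma mul_bounded S T : exists N : nat, bnd N (mul_coef S T).
Proof.
have [[M SM] [N TN]] := (coef_bounded S, coef_bounded T).
by exists (M + N)%N; exact: bnd_mul.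
Qed.
Definition series_mul S T : series o := Series o (mul_bounded S T).

Lemma delta_bounded (a : A) j : exists N : nat, bnd N (delta a j).
Proof. by exists `|j|%N; exact: bnd_delta. Qed.

(* The monomial [a y^j]. *)
Definition monom (a : A) (j : int) : series o := Series o (delta_bounded a j).

Fact series_addA : associative series_add.
Proof. by move=> S T U; apply: seriesP; apply: funext => n /=; rewrite addrA. Qed.
Fact series_addC : commutative series_add.
Proof. by move=> S T; apply: seriesP; apply: funext => n /=; rewrite addrC. Qed.
Fact series_add0 : left_id series0 series_add.
Proof. by move=> S; apply: seriesP; apply: funext => n /=; rewrite add0r. Qed.
Fact series_addN : left_inverse series0 series_opp series_add.
Proof. by move=> S; apply: seriesP; apply: funext => n /=; rewrite addNr. Qed.
HB.instance Definition _ := GRing.isZmodule.Build (series o)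
  series_addA series_addC series_add0 series_addN.

Fact series_mulA : associative series_mul.
Proof.
move=> S T U; apply: seriesP => /=.
have [[[M SM] [N TN]] [K UK]] := (coef_bounded S, coef_bounded T, coef_bounded U).
exact: mul_coefA SM TN UK.
Qed.
Fact series_mul1l : left_id (monom 1 0) series_mul.
Proof. by move=> S; apply: seriesP => /=; exact: mul_coef1l. Qed.
Fact series_mul1r : right_id (monom 1 0) series_mul.
Proof. by move=> S; apply: seriesP => /=; exact: mul_coef1r. Qed.
Fact series_mulDl : left_distributive series_mul series_add.
Proof.
move=> S T U; apply: seriesP => /=.
have [[[M SM] [N TN]] [K UK]] := (coef_bounded S, coef_bounded T, coef_bounded U).
exact: mul_coefDl SM TN UK.
Qed.
Fact series_mulDr : right_distributive series_mul series_add.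
Proof.
move=> S T U; apply: seriesP => /=.
have [[[M SM] [N TN]] [K UK]] := (coef_bounded S, coef_bounded T, coef_bounded U).
exact: mul_coefDr SM TN UK.
Qed.
Fact series_neq0 : monom 1 0 != 0 :> series o.
Proof.
apply/eqP => /(congr1 (fun S => coef S 0)) /=; rewrite /delta eqxx.
by move/eqP; rewrite oner_eq0.
Qed.
HB.instance Definition _ := GRing.Zmodule_isNzRing.Build (series o)
  series_mulA series_mul1l series_mul1r series_mulDl series_mulDr series_neq0.

(* A (classically chosen) two-sided inverse when there is one. *)
Definition series_unit : pred (series o) :=
  fun S => `[< exists T, T * S = 1 /\ S * T = 1 >].
Definition series_inv S : series o :=
  if pselect (exists T, T * S = 1 /\ S * T = 1) is left e then sval (cid e) else S.

Fact series_mulVr : {in series_unit, left_inverse 1 series_inv *%R}.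
Proof.
move=> S /asboolP uS; rewrite /series_inv; case: pselect => // e.
by case: (cid e) => T [].
Qed.
Fact series_mulrV : {in series_unit, right_inverse 1 series_inv *%R}.
Proof.
move=> S /asboolP uS; rewrite /series_inv; case: pselect => // e.
by case: (cid e) => T [].
Qed.
Fact series_unitP S T : T * S = 1 /\ S * T = 1 -> series_unit S.
Proof. by move=> e; apply/asboolP; exists T. Qed.
Fact series_inv_out : {in [predC series_unit], series_inv =1 id}.
Proof.
move=> S /negP nS; rewrite /series_inv; case: pselect => // e.
by case: nS; apply/asboolP.
Qed.
HB.instance Definition _ := GRing.NzRing_hasMulInverse.Build (series o)
  series_mulVr series_mulrV series_unitP series_inv_out.

Lemma nonneg_bounded S : exists N : nat, bnd N (fun n => if 0 <= n then S n else 0).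
Proof. by have [N SN] := coef_bounded S; exists N => n /SN ->; rewrite if_same. Qed.
Definition nonneg_part S : series o := Series o (nonneg_bounded S).

Lemma neg_bounded (a : nat -> A) :
  exists N : nat, bnd N (fun n => if n is Negz k then a k else 0).
Proof. by exists 0%N => -[]. Qed.
(* [sum_(k >= 0) a_k y^(-k-1)]; note [Negz k] is [-(k+1)]. *)
Definition neg_series (a : nat -> A) : series o := Series o (neg_bounded a).

Lemma coef_monom a j n : monom a j n = if n == j then a else 0.
Proof. by []. Qed.

Lemma coefD S T n : (S + T) n = S n + T n. Proof. by []. Qed.
Lemma coefN S n : (- S) n = - S n. Proof. by []. Qed.
Lemma coefM S T n : (S * T) n = mul_coef S T n. Proof. by []. Qed.

Lemma coef_monomM a j S n : (monom a j * S) n = a * ypow j S n.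
Proof.
rewrite coefM /mul_coef (sumZE (B := `|j|)) => [|k lt_k].
  rewrite (bigD1_seq j) ?window_uniq ?mem_window //= big1 => [|k /negPf nk].
    by rewrite addr0 /delta eqxx.
  by rewrite /delta nk mul0r.
by rewrite /= /delta; case: eqP => [e|_]; rewrite ?mul0r //; lia.
Qed.

Lemma monomM0 a b j : monom a 0 * monom b j = monom (a * b) j.
Proof.
apply: seriesP; apply: funext => n; rewrite coef_monomM !coef_monom.
by rewrite [ypow _ _ _]/(delta b j n) /delta; case: ifP; rewrite ?mulr0.
Qed.

Lemma monom_ypow a j : monom a 0 * monom 1 j = monom a j.
Proof. by rewrite monomM0 mulr1. Qed.

(* The relations that determine the product of [series]. *)
Lemma y_mul f : monom 1 1 * monom f 0 = monom (thV f) 1 + monom (D f) 0.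
Proof.
apply: seriesP; apply: funext => n; rewrite coefD coef_monomM mul1r.
rewrite /ypow /= /ymul /delta subr_eq add0r.
by congr (_ + _); case: ifP; rewrite ?raddf0.
Qed.

Lemma yV_mul f : monom 1 (- 1) * monom f 0
  = neg_series (fun p => (-1) ^+ p * iter p (th \o D) (th f)).
Proof.
apply: seriesP; apply: funext => n; rewrite coef_monomM mul1r.
have -> : ypow (- 1) (monom f 0) n = yinv (delta f 0) n by [].
rewrite (yinvE _ (@bnd_delta f 0)) /delta /=.
case: n => k.
  by rewrite big1 // => p _; case: eqP => [e|_]; rewrite ?raddf0 ?iterD0 ?mulr0 //; lia.
have lt_k : (k < (0 + `|Negz k|).+1)%N by lia.
rewrite (bigD1 (Ordinal lt_k)) //= big1 => [|p np].
  by rewrite addr0; case: eqP => // ne; exfalso; apply: ne; lia.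
case: eqP => [e|_]; last by rewrite raddf0 iterD0 mulr0.
by case/eqP: np; apply: val_inj => /=; lia.
Qed.
End OreSeries.
(* [C(x) * Gamma]: the value at [r] is the coefficient of [s ^ r]. *)
Definition crossed (K : numFieldType) (n : nat) (mu : K)
  (mu_prim : n.+1.-primitive_root mu) := {ffun 'I_n.+1 -> {fraction {poly K}}}.

Section CrossedProduct.
Variables (K : numFieldType) (n : nat) (mu : K).
Hypothesis mu_prim : n.+1.-primitive_root mu.
Local Notation I := 'I_n.+1.
Local Notation F := {fraction {poly K}}.
Local Notation A := (crossed mu_prim).
Implicit Types (p q r : I) (a b f g h : A) (c : K).

HB.instance Definition _ := GRing.Zmodule.copy A {ffun I -> F}.

(* The action of [s ^ r], [s(f)(x) = f(mu^-1 x)]. *)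
Definition act (r : I) (u : F) : F := scaleF (mu ^- r) u.

Definition crossed_one : A := [ffun r => if r == 0 then 1 else 0].
Definition crossed_mul a b : A := [ffun r => \sum_p a p * act p (b (r - p))].

Lemma mu_neq0 : mu != 0.
Proof.
apply/eqP => mu0; have := prim_expr_order mu_prim.
by rewrite mu0 expr0n /= => /eqP; rewrite eq_sym oner_eq0.
Qed.

Lemma muV_neq0 k : mu ^- k != 0.
Proof. by rewrite invr_eq0 expf_neq0 // mu_neq0. Qed.

Lemma mu_expD p q : mu ^+ (p + q)%R = mu ^+ p * mu ^+ q.
Proof.
by rewrite -exprD -[RHS](prim_expr_mod mu_prim).
Qed.

Lemma muV_expD p q : mu ^- (p + q)%R = mu ^- p * mu ^- q.
Proof. by rewrite mu_expD invfM. Qed.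

Lemma act_comp p q u : act p (act q u) = act (p + q) u.
Proof. by rewrite /act scaleF_comp ?muV_neq0 // muV_expD. Qed.

Lemma act0 u : act 0 u = u.
Proof. by rewrite /act expr0 invr1 scaleF_id. Qed.

Lemma actM p u v : act p (u * v) = act p u * act p v.
Proof. by rewrite /act scaleFM ?muV_neq0. Qed.
Lemma actD p u v : act p (u + v) = act p u + act p v.
Proof. by rewrite /act scaleFD ?muV_neq0. Qed.
Lemma act00 p : act p 0 = 0.
Proof. by rewrite /act scaleF0 ?muV_neq0. Qed.
Lemma act1 p : act p 1 = 1.
Proof. by rewrite /act scaleF1 ?muV_neq0. Qed.
Lemma act_sum p J (s : seq J) (P : pred J) (G : J -> F) :
  act p (\sum_(i <- s | P i) G i) = \sum_(i <- s | P i) act p (G i).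
Proof. by rewrite /act scaleF_sum ?muV_neq0. Qed.
Lemma act_const p c : act p (constF c) = constF c.
Proof. by rewrite /act scaleF_const ?muV_neq0. Qed.

Fact crossed_mulA : associative crossed_mul.
Proof.
move=> a b c; apply/ffunP => r; rewrite !ffunE.
transitivity (\sum_p \sum_q a p * act p (b (q - p)) * act q (c (r - q))).
  apply: eq_bigr => p _; rewrite ffunE act_sum mulr_sumr.
  rewrite (reindex_inj (addIr (- p))) /=; apply: eq_bigr => q _.
  have -> : r - p - (q - p) = r - q by rewrite opprB addrA subrK.
  by rewrite actM act_comp mulrA [p + _]addrC subrK.
rewrite exchange_big; apply: eq_bigr => q _ /=.
by rewrite ffunE mulr_suml.
Qed.
Fact crossed_mul1l : left_id crossed_one crossed_mul.
Proof.
move=> a; apply/ffunP => r; rewrite ffunE (bigD1 0) //= big1 => [|p /negPf np].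
  by rewrite ffunE eqxx mul1r act0 subr0 addr0.
by rewrite ffunE np mul0r.
Qed.
Fact crossed_mul1r : right_id crossed_one crossed_mul.
Proof.
move=> a; apply/ffunP => r; rewrite ffunE (bigD1 r) //= big1 => [|p np].
  by rewrite ffunE subrr eqxx act1 mulr1 addr0.
by rewrite ffunE subr_eq0 eq_sym (negPf np) act00 mulr0.
Qed.
Fact crossed_mulDl : left_distributive crossed_mul +%R.
Proof.
move=> a b c; apply/ffunP => r; rewrite !ffunE -big_split.
by apply: eq_bigr => p _; rewrite ffunE mulrDl.
Qed.
Fact crossed_mulDr : right_distributive crossed_mul +%R.
Proof.
move=> a b c; apply/ffunP => r; rewrite !ffunE -big_split.
by apply: eq_bigr => p _; rewrite ffunE actD mulrDr.
Qed.
Fact crossed_neq0 : crossed_one != 0 :> A.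
Proof.
by apply/eqP => /ffunP/(_ 0) /eqP; rewrite !ffunE eqxx oner_eq0.
Qed.
HB.instance Definition _ := GRing.Zmodule_isNzRing.Build A
  crossed_mulA crossed_mul1l crossed_mul1r crossed_mulDl crossed_mulDr
  crossed_neq0.

Definition crossedF (u : F) : A := [ffun r => if r == 0 then u else 0].
Definition crossedC (c : K) : A := crossedF (constF c).
Definition gam (q : I) : A := [ffun r => (r == q)%:R].

Fact crossedF_is_zmod : zmod_morphism crossedF.
Proof.
by move=> u v; apply/ffunP => r; rewrite !ffunE; case: ifP; rewrite ?subr0.
Qed.
Lemma crossedF_mull u a r : (crossedF u * a) r = u * a r.
Proof.
rewrite ffunE (bigD1 0) //= big1 => [|p /negPf np].
  by rewrite ffunE eqxx act0 subr0 addr0.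
by rewrite ffunE np mul0r.
Qed.
Lemma crossedF_mulr u a r : (a * crossedF u) r = a r * act r u.
Proof.
rewrite ffunE (bigD1 r) //= big1 => [|p np].
  by rewrite ffunE subrr eqxx addr0.
by rewrite ffunE subr_eq0 eq_sym (negPf np) act00 mulr0.
Qed.
Fact crossedF_is_monoid : monoid_morphism crossedF.
Proof.
split=> [|u v]; first by apply/ffunP => r; rewrite !ffunE.
apply/ffunP => r; rewrite crossedF_mull !ffunE.
by case: ifP; rewrite ?mulr0.
Qed.
HB.instance Definition _ := GRing.isZmodMorphism.Build F A crossedF crossedF_is_zmod.
HB.instance Definition _ := GRing.isMonoidMorphism.Build F A crossedF crossedF_is_monoid.
HB.instance Definition _ := GRing.RMorphism.copy crossedC (crossedF \o @constF K).

Lemma crossedC_central c a : crossedC c * a = a * crossedC c.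
Proof. by apply/ffunP => r; rewrite crossedF_mull crossedF_mulr act_const mulrC. Qed.

Definition eps (i : I) : A :=
  crossedC (n.+1%:R^-1) * \sum_(r : I) crossedC (mu ^- (i * r)) * gam r.

Variables (tau : K) (kappa : I -> K).

(* The coefficients [c_(s^r)] of [sum_i m kappa_i eps_i]; see [sum_kappa_eps]. *)
Definition cgam (r : I) : K := \sum_i kappa i * mu ^- (i * r).

Lemma sum_kappa_eps :
  \sum_i crossedC (n.+1%:R * kappa i) * eps i = \sum_r crossedC (cgam r) * gam r.
Proof.
under eq_bigr => i _ do rewrite mulrA -rmorphM mulrAC mulfV ?pnatr_eq0 // mul1r mulr_sumr.
rewrite exchange_big /=; apply: eq_bigr => r _.
rewrite rmorph_sum mulr_suml; apply: eq_bigr => i _.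
by rewrite mulrA -rmorphM.
Qed.

(* The automorphism fixing [C(x)] and mapping [s] to [k s]. *)
Definition twist (k : K) f : A := [ffun r : I => constF (k ^+ r) * f r].

Fact twist_is_zmod k : zmod_morphism (twist k).
Proof. by move=> f g; apply/ffunP => r; rewrite !ffunE mulrBr. Qed.
HB.instance Definition _ k := GRing.isZmodMorphism.Build A A (twist k) (twist_is_zmod k).

Definition thetaC : A -> A := twist mu.
Definition thetaVC : A -> A := twist mu^-1.

Fact thetaC_is_monoid : monoid_morphism thetaC.
Proof.
split=> [|f g]; apply/ffunP => r; rewrite !ffunE.
  by case: eqP => [->|]; rewrite ?mulr0 // expr0 rmorph1 mulr1.
rewrite mulr_sumr; apply: eq_bigr => p _; rewrite !ffunE actM act_const.
rewrite -{1}[r](subrK p) mu_expD rmorphM /=; ring.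
Qed.
Fact thetaVC_is_monoid : monoid_morphism thetaVC.
Proof.
split=> [|f g]; apply/ffunP => r; rewrite !ffunE.
  by case: eqP => [->|]; rewrite ?mulr0 // expr0 rmorph1 mulr1.
rewrite mulr_sumr; apply: eq_bigr => p _; rewrite !ffunE actM act_const.
rewrite !exprVn -{1}[r](subrK p) muV_expD rmorphM /=; ring.
Qed.
HB.instance Definition _ := GRing.Additive.copy thetaC (twist mu).
HB.instance Definition _ := GRing.Additive.copy thetaVC (twist mu^-1).
HB.instance Definition _ := GRing.isMonoidMorphism.Build A A thetaC thetaC_is_monoid.
HB.instance Definition _ := GRing.isMonoidMorphism.Build A A thetaVC thetaVC_is_monoid.

Lemma thetaCK : cancel thetaC thetaVC.
Proof.
move=> f; apply/ffunP => r; rewrite !ffunE mulrA -rmorphM /= exprVn mulVf.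
  by rewrite rmorph1 mul1r.
by rewrite expf_neq0 // mu_neq0.
Qed.
Lemma thetaVCK : cancel thetaVC thetaC.
Proof.
move=> f; apply/ffunP => r; rewrite !ffunE mulrA -rmorphM /= exprVn mulfV.
  by rewrite rmorph1 mul1r.
by rewrite expf_neq0 // mu_neq0.
Qed.

Definition derivC f : A := [ffun r => derivF (f r)].

Definition dunkl_D f : A :=
  crossedC tau * derivC f
  - \sum_(r | r != 0) crossedC (cgam r) * crossedF (xF K)^-1 * (gam r * f - f * gam r).

Lemma derivF0 : derivF (0 : F) = 0.
Proof. by rewrite -(rmorph0 (@constF K)) derivF_const. Qed.
Lemma derivF_sum J (s : seq J) (P : pred J) (G : J -> F) :
  derivF (\sum_(i <- s | P i) G i) = \sum_(i <- s | P i) derivF (G i).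
Proof. exact: (big_morph (@derivF K) (@derivFD K) derivF0). Qed.

Lemma derivCD f g : derivC (f + g) = derivC f + derivC g.
Proof. by apply/ffunP => r; rewrite !ffunE derivFD. Qed.

Lemma derivCM f g : derivC (f * g) = thetaVC f * derivC g + derivC f * g.
Proof.
apply/ffunP => r; rewrite !ffunE derivF_sum -big_split /=.
apply: eq_bigr => p _; rewrite !ffunE derivFM derivF_scaleF ?muV_neq0 //.
by rewrite exprVn /act; ring.
Qed.

Lemma xV_theta f : crossedF (xF K)^-1 * f = thetaVC f * crossedF (xF K)^-1.
Proof.
apply/ffunP => r; rewrite crossedF_mull crossedF_mulr ffunE exprVn.
have x0 : xF K != 0 by rewrite tofrac_neq0 polyX_eq0.
have c0 : constF (mu ^- r) != 0 by rewrite fmorph_eq0 muV_neq0.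
have -> : act r (xF K)^-1 = (constF (mu ^- r))^-1 * (xF K)^-1.
  have e : act r (xF K) * act r (xF K)^-1 = 1.
    rewrite -actM.
    rewrite (mulfV x0).
    exact: act1.
  have e' : act r (xF K) = constF (mu ^- r) * xF K by exact: scaleF_x (muV_neq0 r).
  rewrite e' in e.
  rewrite -[LHS]mul1r.
  rewrite -(mulVf (mulf_neq0 c0 x0)).
  rewrite -[LHS]mulrA e mulr1.
  by rewrite invfM.
by rewrite mulrACA mulfV // mul1r mulrC.
Qed.

Fact dunkl_D_is_zmod : zmod_morphism dunkl_D.
Proof.
have DD f g : dunkl_D (f + g) = dunkl_D f + dunkl_D g.
  rewrite /dunkl_D derivCD mulrDr [RHS]addrACA -opprD -big_split /=.
  congr (_ - _); apply: eq_bigr => r _.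
  by rewrite -[RHS]mulrDr; congr (_ * _); rewrite mulrDr mulrDl opprD addrACA.
have D0 : dunkl_D 0 = 0 by apply: (addIr (dunkl_D 0)); rewrite -DD !add0r.
move=> f g; apply/eqP; rewrite eq_sym subr_eq -DD subrK //.
Qed.
HB.instance Definition _ := GRing.isZmodMorphism.Build A A dunkl_D dunkl_D_is_zmod.

Lemma dunkl_DM f g : dunkl_D (f * g) = thetaVC f * dunkl_D g + dunkl_D f * g.
Proof.
rewrite /dunkl_D derivCM mulrBr mulrBl addrACA -opprD.
congr (_ - _).
  by rewrite mulrDr !mulrA crossedC_central.
rewrite mulr_sumr mulr_suml -big_split /=; apply: eq_bigr => r _.
have -> : gam r * (f * g) - f * g * gam r
   = f * (gam r * g - g * gam r) + (gam r * f - f * gam r) * g.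
  by rewrite mulrBr mulrBl !mulrA [RHS]addrC addrA subrK.
rewrite mulrDr !mulrA; congr (_ + _).
rewrite -[crossedC _ * _ * f]mulrA xV_theta !mulrA crossedC_central.
by [].
Qed.

Definition P_data : ore_data A :=
  OreData thetaCK thetaVCK dunkl_DM.
End CrossedProduct.

Notation Pring mu_prim tau kappa := (series (P_data mu_prim tau kappa)).

Section TimeDerivative.
Variable K : numFieldType.
Local Notation polyF := (@FracField.tofrac {poly K}).

(* Derivative at [t] of a curve of rational functions: near [t] the curve is a
   quotient of polynomials of bounded degree whose coefficients are
   differentiable functions of the time. *)
Definition ratfun_is_derive (f : K -> {fraction {poly K}}) (t : K)
    (f' : {fraction {poly K}}) : Prop :=
  exists (d : nat) (p q : K -> {poly K}) (p' q' : {poly K}),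
    [/\ \forall s \near t, [/\ (size (p s) <= d)%N, (size (q s) <= d)%N,
          q s != 0 & f s = polyF (p s) / polyF (q s)],
        forall i : nat, is_derive t 1 (fun s => (p s)`_i) p'`_i,
        forall i : nat, is_derive t 1 (fun s => (q s)`_i) q'`_i
      & f' = polyF (p' * q t - p t * q') / polyF (q t ^+ 2)].

Definition series_is_derive (n : nat) (mu : K)
    (mu_prim : n.+1.-primitive_root mu) (tau : K) (kappa : 'I_n.+1 -> K)
    (S : K -> Pring mu_prim tau kappa) (t : K)
    (S' : Pring mu_prim tau kappa) : Prop :=
  forall (j : int) (r : 'I_n.+1),
    ratfun_is_derive (fun s => (S s j : {ffun _ -> _}) r) t
                     ((S' j : {ffun _ -> _}) r).
End TimeDerivative.

Section Levels.
Variables (K : numFieldType) (n : nat).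

Definition cm_lambda (tau : K) (kappa : 'I_n.+1 -> K) (i : 'I_n.+1) : K :=
  n.+1%:R * (kappa (ord_pred i) - kappa i) - tau.

Definition cm_regular (lam : 'I_n.+1 -> K) : Prop :=
  \sum_i lam i != 0 /\
  forall (z : int) (i j : nat), (1 <= i)%N -> (i < j)%N -> (j <= n.+1)%N ->
    \sum_(i <= l < j) lam (inord l) != (\sum_i lam i) *~ z.
End Levels.

Section CalogeroMoser.
Variables (K : numFieldType) (n : nat) (alpha : 'I_n.+1 -> nat).
Local Notation I := 'I_n.+1.

Record cm_rep := CMRep {
  repX : forall i : I, 'M[K]_(alpha (ordS i), alpha i);
  repY : forall i : I, 'M[K]_(alpha i, alpha (ordS i));
  repv : forall i : I, 'cV[K]_(alpha i);
  repw : forall i : I, 'rV[K]_(alpha i) }.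
Implicit Types r : cm_rep.

Local Notation N := (\sum_i alpha i)%N.

(* The inclusion of [V_i] in [V], and its transpose the projection; the maps
   of [cm_rep] are extended by zero to [V] by composing with them. *)
Definition inclV (i : I) : 'M[K]_(N, alpha i) :=
  \matrix_(a, b) (a == tagnat.Rank i b)%:R.
Definition projV (i : I) : 'M[K]_(alpha i, N) := (inclV i)^T.

Definition totX r : 'M[K]_N := \sum_i inclV (ordS i) *m repX r i *m projV i.
Definition totY r : 'M[K]_N := \sum_i inclV i *m repY r i *m projV (ordS i).
Definition extv r (i : I) : 'cV[K]_N := inclV i *m repv r i.
Definition extw r (i : I) : 'rV[K]_N := repw r i *m projV i.
Definition totv r : 'cV[K]_N := \sum_i extv r i.
Definition totw r : 'rV[K]_N := \sum_i extw r i.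

Definition cm_ham (k : nat) r : K := - (totw r *m totY r ^+ k *m totv r) 0 0.

Definition setX r (i : I) (M : 'M[K]_(alpha (ordS i), alpha i)) : cm_rep :=
  CMRep (dfwith (T := fun i => 'M_(alpha (ordS i), alpha i)) (repX r) M)
        (repY r) (repv r) (repw r).
Definition setY r (i : I) (M : 'M[K]_(alpha i, alpha (ordS i))) : cm_rep :=
  CMRep (repX r) (dfwith (T := fun i => 'M_(alpha i, alpha (ordS i))) (repY r) M)
        (repv r) (repw r).
Definition setv r (i : I) (u : 'cV[K]_(alpha i)) : cm_rep :=
  CMRep (repX r) (repY r) (dfwith (T := fun i => 'cV_(alpha i)) (repv r) u)
        (repw r).
Definition setw r (i : I) (u : 'rV[K]_(alpha i)) : cm_rep :=
  CMRep (repX r) (repY r) (repv r)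
        (dfwith (T := fun i => 'rV_(alpha i)) (repw r) u).

Implicit Type f : cm_rep -> K.

Definition partialX f (i : I) a b r : K :=
  derive1 (fun h : K => f (setX r (repX r i + h *: delta_mx a b))) 0.
Definition partialY f (i : I) a b r : K :=
  derive1 (fun h : K => f (setY r (repY r i + h *: delta_mx a b))) 0.
Definition partialv f (i : I) a r : K :=
  derive1 (fun h : K => f (setv r (repv r i + h *: delta_mx a 0))) 0.
Definition partialw f (i : I) a r : K :=
  derive1 (fun h : K => f (setw r (repw r i + h *: delta_mx 0 a))) 0.

Arguments partialX : clear implicits.
Arguments partialY : clear implicits.
Arguments partialv : clear implicits.
Arguments partialw : clear implicits.

Definition poisson (f g : cm_rep -> K) r : K :=
  \sum_i (\sum_(a < alpha (ordS i)) \sum_(b < alpha i) (partialX f i a b r * partialY g i b a r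
                         - partialY f i b a r * partialX g i a b r)
          + \sum_(a < alpha i) (partialv f i a r * partialw g i a r
                    - partialw f i a r * partialv g i a r)).

(* [f' = {f, H}] for the coordinate functions [f] along the curve [c]. *)
Definition ham_flow_at (H : cm_rep -> K) (c : K -> cm_rep) (t : K) : Prop :=
  [/\ forall (i : I) a b,
        is_derive t 1 (fun s => repX (c s) i a b)
                  (poisson (fun r => repX r i a b) H (c t)),
      forall (i : I) a b,
        is_derive t 1 (fun s => repY (c s) i a b)
                  (poisson (fun r => repY r i a b) H (c t)),
      forall (i : I) a,
        is_derive t 1 (fun s => repv (c s) i a 0)
                  (poisson (fun r => repv r i a 0) H (c t))
    & forall (i : I) a,
        is_derive t 1 (fun s => repw (c s) i 0 a)
                  (poisson (fun r => repw r i 0 a) H (c t))].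

Variable lam : I -> K.

(* The equation at the vertex [i] is stated for [i = ordS j], so that both
   [Y_i X_i] and [X_(i-1) Y_(i-1)] are literally endomorphisms of [V_i]. *)
Definition cm_moment r : Prop := forall j : I,
  repY r (ordS j) *m repX r (ordS j) - repX r j *m repY r j
  - repv r (ordS j) *m repw r (ordS j) = (lam (ordS j))%:M.

Definition gl_elt (g : forall i : I, 'M[K]_(alpha i)) : Prop :=
  forall i, g i \in unitmx.
Definition gl_act (g : forall i : I, 'M[K]_(alpha i)) r : cm_rep :=
  CMRep (fun i => g (ordS i) *m repX r i *m invmx (g i))
        (fun i => g i *m repY r i *m invmx (g (ordS i)))
        (fun i => g i *m repv r i)
        (fun i => repw r i *m invmx (g i)).

Definition cm_fiber := {r : cm_rep | cm_moment r}.
HB.instance Definition _ := gen_eqMixin cm_fiber.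
HB.instance Definition _ := gen_choiceMixin cm_fiber.

Definition same_orbit (x y : cm_fiber) : bool :=
  `[< exists g, gl_elt g /\ sval y = gl_act g (sval x) >].

Lemma cm_repP r r' : (forall i, repX r i = repX r' i) ->
  (forall i, repY r i = repY r' i) -> (forall i, repv r i = repv r' i) ->
  (forall i, repw r i = repw r' i) -> r = r'.
Proof.
case: r r' => [X Y v w] [X' Y' v' w'] /= eX eY ev ew.
by congr CMRep; apply: functional_extensionality_dep.
Qed.

Lemma gl_act1 r : gl_act (fun=> 1%:M) r = r.
Proof. by apply: cm_repP => i /=; rewrite ?invmx1 ?mul1mx ?mulmx1. Qed.

Lemma gl_actM g h r : gl_elt g -> gl_elt h ->
  gl_act g (gl_act h r) = gl_act (fun i => g i *m h i) r.
Proof.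
move=> gU hU.
have e i : invmx (g i *m h i) = invmx (h i) *m invmx (g i).
  have ghU : g i *m h i \in unitmx by rewrite unitmx_mul gU hU.
  rewrite -[RHS]mulmx1 -(mulmxV ghU) !mulmxA.
  by rewrite mulmxKV // mulVmx // mul1mx.
by apply: cm_repP => i /=; rewrite ?e !mulmxA.
Qed.

Lemma gl_actK g r : gl_elt g -> gl_act (fun i => invmx (g i)) (gl_act g r) = r.
Proof.
move=> gU; rewrite gl_actM // => [|i]; last by rewrite unitmx_inv gU.
rewrite -[RHS]gl_act1; congr gl_act.
by apply: functional_extensionality_dep => i; rewrite mulVmx.
Qed.

Fact same_orbit_refl : reflexive same_orbit.
Proof.
move=> x; apply/asboolP; exists (fun=> 1%:M); rewrite gl_act1.
by split=> // i; exact: unitmx1.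
Qed.
Fact same_orbit_sym : symmetric same_orbit.
Proof.
suff s x y : same_orbit x y -> same_orbit y x.
  by move=> x y; apply/idP/idP; exact: s.
move=> /asboolP[g [gU e]]; apply/asboolP; exists (fun i => invmx (g i)).
by split=> [i|]; [rewrite unitmx_inv gU | rewrite e gl_actK].
Qed.
Fact same_orbit_trans : transitive same_orbit.
Proof.
move=> y x z /asboolP[g [gU eg]] /asboolP[h [hU eh]]; apply/asboolP.
exists (fun i => h i *m g i); split=> [i|]; first by rewrite unitmx_mul hU gU.
by rewrite eh eg gl_actM.
Qed.
Canonical same_orbit_equiv :=
  EquivRel same_orbit same_orbit_refl same_orbit_sym same_orbit_trans.

Definition cm_space := {eq_quot same_orbit}.
Definition cm_orbit (x : cm_fiber) : cm_space := \pi_cm_space x.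
Definition cm_lift (p : cm_space) : cm_fiber := repr p.

(* The Hamiltonian flow on the quotient is the one induced by the flow on
   [cm_rep]: locally in time, the curve lifts to an integral curve. *)
Definition cm_integral_curve (H : cm_rep -> K) (U : set K) (c : K -> cm_space)
    : Prop :=
  open U /\ forall t, U t -> exists x : K -> cm_fiber,
    \forall s \near t, c s = cm_orbit (x s) /\ ham_flow_at H (fun u => sval (x u)) s.
End CalogeroMoser.

Section LaxMap.
Variables (K : numFieldType) (n : nat) (mu : K).
Hypothesis mu_prim : n.+1.-primitive_root mu.
Variables (tau : K) (kappa : 'I_n.+1 -> K) (alpha : 'I_n.+1 -> nat).
Local Notation F := {fraction {poly K}}.
Local Notation P := (Pring mu_prim tau kappa).
Local Notation N := (\sum_i alpha i)%N.
Implicit Type r : cm_rep K alpha.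

Definition yP : P := monom _ 1 1.
Definition PF (f : F) : P := monom _ (crossedF mu_prim f) 0.
Definition PC (c : K) : P := PF (constF c).
Definition epsP (i : 'I_n.+1) : P := monom _ (eps mu_prim i) 0.

(* [(X - x 1_V)^-1] and [(Y - y 1_V)^-1 = - sum_k Y^k y^(-k-1)]; the tensor
   product of [P] with [End V] is the ring of matrices with entries in [P]. *)
Definition resX r : 'M[F]_N := invmx (map_mx (@constF K) (totX r) - (xF K)%:M).
Definition resY r : 'M[P]_N :=
  \matrix_(a, b) neg_series _ (fun k => - crossedC mu_prim ((totY r ^+ k) a b)).

Definition cm_M r : P :=
  1 - \sum_i \sum_j epsP i
      * (map_mx PC (extw r i) *m map_mx PF (resX r) *m resY r
           *m map_mx PC (extv r j)) 0 0 * epsP j.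

Definition cm_L r : P := cm_M r * yP * (cm_M r)^-1.

Local Notation lam := (cm_lambda tau kappa).

Definition cm_lax (p : cm_space alpha lam) : P := cm_L (sval (cm_lift p)).

End LaxMap.

(* Main.v *)
(* Write xh = X - x, yh = Y - y, e = sum_i E_i eps_i with E_i the projector onto
   V_i, W = w e and V = e v.  Multiplied by e, the moment map equation becomes
   [xh, yh] e = - V W, because the levels lambda cancel against xy - yx.  Hence
   M = 1 - W xh^-1 yh^-1 V has the inverse N = 1 + W yh^-1 xh^-1 V, and, with
   u = xh^-1 yh^-1 V, one gets W u = 1 - M and yh u = xh^-1 V M.
   Put T = Y y^-1.  Along the flow of H_k the derivatives are W' = y^k W T^k,
   V' = - T^k V y^k and e' X' = - sum_(p+q=k-1) y^-1 T^p V y^k W T^q, where e' is e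
   with the indices of E shifted by one.  As T^q u - u = y^-1 (1 + ... + T^(q-1)) yh u
   is a right multiple of M, it follows that M' + M y^k = B M for an explicit B
   without negative powers of y.  Since M' N has only negative powers of y,
   B = (L^k)_+ and M' N = B - L^k; differentiating L = M y N gives the Lax
   equation. *)
Require Import Defs.
From HB Require Import structures.
From mathcomp Require Import all_boot all_order all_algebra.
From mathcomp Require Import generic_quotient fraction complex.
From mathcomp Require Import boolp classical_sets.
From mathcomp Require Import reals topology normedtype derive.
From mathcomp Require Import ring zify.
Set Implicit Arguments.
Unset Strict Implicit.
Unset Printing Implicit Defensive.
Import Order.TTheory GRing.Theory Num.Theory.
Import numFieldNormedType.Exports.
Local Open Scope ring_scope.

(** * Differentiable curves of rational functions *)

Section PolynomialCurves.
Variable K : numFieldType.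

(** Moving x or y across [eps_i] shifts the index i cyclically, just as X and Y shift the index of
    V_i. Coupling the two indices in e turns the double sum of [cm_M] into one product W xh^-1 yh^-1
    V, and e commutes with xh yh and yh xh although with neither factor. T is used in place of Y for
    the same reason: the shifts of Y and y^-1 cancel, so T commutes with e. B is written with y^-1
    and T, yet its negative powers of y occur only inside y^a W y^-a and y^-a V y^a with a at most
    k, and conjugation by y merely permutes the [eps_i] in W and V. On the analytic side,
    derivatives are taken coefficientwise, while a coefficient of a product is a sum whose length
    depends on the degrees of the factors; curves of series therefore carry a degree bound uniform
    in time. Inverses are differentiated in two steps: a derivative is shown to exist, by explicit
    formulas, and its value is then read off from the differentiated identity. The second step rests
    on uniqueness of derivatives. *)

Definition poly_is_derive (p : K -> {poly K}) (t : K) (p' : {poly K}) :=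
  forall i : nat, is_derive t 1 (fun s => (p s)`_i) p'`_i.

Lemma is_derive_fctM (f g : K -> K) (t f' g' : K) : is_derive t 1 f f' -> is_derive t 1 g g' ->
  is_derive t 1 (fun s => f s * g s) (f' * g t + f t * g').
Proof.
move=> df dg; apply: is_derive_eq (is_deriveM df dg) _.
by rewrite /GRing.scale /= addrC mulrC.
Qed.

Lemma is_derive_fctD (f g : K -> K) (t f' g' : K) : is_derive t 1 f f' -> is_derive t 1 g g' ->
  is_derive t 1 (fun s => f s + g s) (f' + g').
Proof. exact: is_deriveD. Qed.

Lemma is_derive_fct_cst (c t : K) : is_derive t 1 (fun _ : K => c) 0.
Proof. exact: is_derive_cst. Qed.

Lemma is_derive_fct_sum (J : Type) (r : seq J) (P : pred J) (h : J -> K -> K)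
    (h' : J -> K) (t : K) : (forall j, is_derive t 1 (h j) (h' j)) ->
  is_derive t 1 (fun s => \sum_(j <- r | P j) h j s) (\sum_(j <- r | P j) h' j).
Proof.
move=> dh; elim: r => [|j r IHr].
  by under eq_fun do rewrite big_nil; rewrite big_nil; exact: is_derive_fct_cst.
under eq_fun do rewrite big_cons; rewrite big_cons.
by case: (P j) => //; apply: is_derive_fctD.
Qed.

Lemma poly_is_derive_cst (c : {poly K}) (t : K) : poly_is_derive (fun=> c) t 0.
Proof. by move=> i; rewrite coef0; exact: is_derive_fct_cst. Qed.

Lemma poly_is_deriveD (p q : K -> {poly K}) (t : K) (p' q' : {poly K}) :
  poly_is_derive p t p' -> poly_is_derive q t q' ->
  poly_is_derive (fun s => p s + q s) t (p' + q').
Proof.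
move=> dp dq i; rewrite coefD; under eq_fun do rewrite coefD.
exact: is_derive_fctD.
Qed.

Lemma poly_is_deriveM (p q : K -> {poly K}) (t : K) (p' q' : {poly K}) :
  poly_is_derive p t p' -> poly_is_derive q t q' ->
  poly_is_derive (fun s => p s * q s) t (p' * q t + p t * q').
Proof.
move=> dp dq i; rewrite coefD !coefM -big_split /=.
under eq_fun do rewrite coefM.
by apply: is_derive_fct_sum => j; exact: is_derive_fctM.
Qed.

Lemma poly_is_deriveN (p : K -> {poly K}) (t : K) (p' : {poly K}) :
  poly_is_derive p t p' -> poly_is_derive (fun s => - p s) t (- p').
Proof.
move=> dp i; rewrite coefN; under eq_fun do rewrite coefN.
exact: is_deriveN.
Qed.

Lemma poly_is_derive_deriv (p : K -> {poly K}) (t : K) (p' : {poly K}) :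
  poly_is_derive p t p' -> poly_is_derive (fun s => (p s)^`()) t p'^`().
Proof.
move=> dp i; rewrite coef_deriv -mulr_natl; under eq_fun do rewrite coef_deriv -mulr_natl.
apply: is_derive_eq (is_derive_fctM (is_derive_fct_cst _ _) (dp i.+1)) _.
by rewrite mul0r add0r.
Qed.

(** The substitution is diagonal on coefficients, with factors independent of time; hence the action
    of the group commutes with time derivatives. *)
Lemma coef_comp_scaleX (a : K) (r : {poly K}) i :
  (r \Po (a *: 'X))`_i = r`_i * a ^+ i.
Proof.
rewrite comp_polyE coef_sum.
under eq_bigr => j _ do rewrite exprZn !coefZ coefXn.
have [lt_i|le_i] := ltnP i (size r); last first.
  rewrite nth_default // mul0r big1 // => j _.
  by rewrite (gtn_eqF (leq_trans (ltn_ord j) le_i)) !mulr0.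
rewrite (bigD1 (Ordinal lt_i)) //= eqxx mulr1 big1 ?addr0 // => j nj.
by rewrite eq_sym (_ : (j == i :> nat) = false) ?mulr0 //; apply: contraNF nj.
Qed.

Lemma poly_is_derive_scaleX (p : K -> {poly K}) (t : K) (p' : {poly K}) (a : K) :
  poly_is_derive p t p' ->
  poly_is_derive (fun s => p s \Po (a *: 'X)) t (p' \Po (a *: 'X)).
Proof.
move=> dp i; rewrite coef_comp_scaleX; under eq_fun do rewrite coef_comp_scaleX.
apply: is_derive_eq (is_derive_fctM (dp i) (is_derive_fct_cst _ _)) _.
by rewrite mulr0 addr0.
Qed.

Lemma is_derive_unique (f : K -> K) (t a b : K) : is_derive t 1 f a -> is_derive t 1 f b -> a = b.
Proof. by move=> da db; rewrite -(@derive_val _ _ _ _ _ _ _ da) (@derive_val _ _ _ _ _ _ _ db). Qed.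

End PolynomialCurves.

Section RationalCurves.
Variable K : numFieldType.
Local Notation polyF := (@FracField.tofrac {poly K}).
Local Notation F := {fraction {poly K}}.

Lemma ratfun_is_derive_near (f g : K -> F) (t : K) (f' : F) : (\forall s \near t, f s = g s) ->
  ratfun_is_derive f t f' -> ratfun_is_derive g t f'.
Proof.
move=> fg [d [p [q [p' [q' [H dp dq ->]]]]]].
exists d, p, q, p', q'; split=> //.
near=> s; have [] : [/\ (size (p s) <= d)%N, (size (q s) <= d)%N,
          q s != 0 & f s = polyF (p s) / polyF (q s)] by near: s.
move=> sp sq q0 fE; split=> //; rewrite -fE; apply/esym; near: s; exact: fg.
Unshelve. all: by end_near. Qed.

Lemma ratfun_is_derive_eq (f : K -> F) (t : K) (f' g' : F) : ratfun_is_derive f t f' -> f' = g' ->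
  ratfun_is_derive f t g'.
Proof. by move=> ? <-. Qed.

Lemma ratfun_is_derive_div (f : K -> F) (p q : K -> {poly K}) (t : K) (p' q' : {poly K}) d :
  (\forall s \near t, [/\ (size (p s) <= d)%N, (size (q s) <= d)%N,
     q s != 0 & f s = polyF (p s) / polyF (q s)]) ->
  poly_is_derive p t p' -> poly_is_derive q t q' ->
  ratfun_is_derive f t (polyF (p' * q t - p t * q') / polyF (q t ^+ 2)).
Proof. by move=> H dp dq; exists d, p, q, p', q'. Qed.

Lemma ratfun_is_derive_poly (p : K -> {poly K}) (t : K) (p' : {poly K}) d :
  (\forall s \near t, (size (p s) <= d)%N) -> poly_is_derive p t p' ->
  ratfun_is_derive (fun s => polyF (p s)) t (polyF p').
Proof.
move=> H dp.
have dq := poly_is_derive_cst (1 : {poly K}) t.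
have -> : polyF p' = polyF (p' * 1 - p t * 0) / polyF (1 ^+ 2).
  by rewrite mulr1 mulr0 subr0 expr1n rmorph1 divr1.
(* The bound [d.+1] also covers the denominator 1, of size 1, in case [d] is 0. *)
apply: (ratfun_is_derive_div (d := d.+1)) dp dq.
near=> s; rewrite oner_eq0 size_poly1 rmorph1 divr1; split=> //.
by apply: leqW; near: s.
Unshelve. all: by end_near. Qed.

Lemma ratfun_is_derive_cst (c : F) (t : K) : ratfun_is_derive (fun=> c) t 0.
Proof.
have -> : 0 = polyF (0 * denF c - numF c * 0) / polyF (denF c ^+ 2).
  by rewrite mul0r mulr0 subr0 rmorph0 mul0r.
apply: (ratfun_is_derive_div (d := maxn (size (numF c)) (size (denF c))))
  (poly_is_derive_cst _ t) (poly_is_derive_cst _ t).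
by near=> s; rewrite leq_maxl leq_maxr denF_neq0 -ratfunE.
Unshelve. all: by end_near. Qed.

Lemma ratfun_is_deriveD (f g : K -> F) (t : K) (f' g' : F) :
  ratfun_is_derive f t f' -> ratfun_is_derive g t g' ->
  ratfun_is_derive (fun s => f s + g s) t (f' + g').
Proof.
move=> [d1 [p1 [q1 [p1' [q1' [H1 dp1 dq1 ->]]]]]].
move=> [d2 [p2 [q2 [p2' [q2' [H2 dp2 dq2 ->]]]]]].
have [_ _ q10 _] := nbhs_singleton H1; have [_ _ q20 _] := nbhs_singleton H2.
have dp := poly_is_deriveD (poly_is_deriveM dp1 dq2) (poly_is_deriveM dp2 dq1).
have dq := poly_is_deriveM dq1 dq2.
(* [d1 + d2] bounds the size of every product of a polynomial of size at most [d1] with one of size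
   at most [d2]. *)
have D h H := @ratfun_is_derive_div h _ _ t _ _ (d1 + d2)%N H dp dq.
apply: ratfun_is_derive_eq (D _ _) _.
- near=> s.
  have [s1 s1' n1 ->] : [/\ (size (p1 s) <= d1)%N, (size (q1 s) <= d1)%N,
      q1 s != 0 & f s = polyF (p1 s) / polyF (q1 s)] by near: s.
  have [s2 s2' n2 ->] : [/\ (size (p2 s) <= d2)%N, (size (q2 s) <= d2)%N,
      q2 s != 0 & g s = polyF (p2 s) / polyF (q2 s)] by near: s.
  have sM (a b : {poly K}) k l : (size a <= k)%N -> (size b <= l)%N ->
      (size (a * b)%R <= k + l)%N.
    by move=> sa sb; apply: leq_trans (size_polyMleq _ _) _; lia.
  split; [|exact: sM|exact: mulf_neq0|by rewrite fracD].
  apply: leq_trans (size_polyD _ _) _; rewrite geq_max sM //=.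
  by rewrite addnC sM.
- rewrite fracD ?expf_neq0 //; apply/eqP.
  rewrite frac_eq ?(mulf_neq0, expf_neq0) //; apply/eqP; ring.
Unshelve. all: by end_near. Qed.

Lemma ratfun_is_deriveM (f g : K -> F) (t : K) (f' g' : F) :
  ratfun_is_derive f t f' -> ratfun_is_derive g t g' ->
  ratfun_is_derive (fun s => f s * g s) t (f' * g t + f t * g').
Proof.
move=> [d1 [p1 [q1 [p1' [q1' [H1 dp1 dq1 ->]]]]]].
move=> [d2 [p2 [q2 [p2' [q2' [H2 dp2 dq2 ->]]]]]].
have [_ _ q10 ->] := nbhs_singleton H1; have [_ _ q20 ->] := nbhs_singleton H2.
have dp := poly_is_deriveM dp1 dp2.
have dq := poly_is_deriveM dq1 dq2.
have D h H := @ratfun_is_derive_div h _ _ t _ _ (d1 + d2)%N H dp dq.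
apply: ratfun_is_derive_eq (D _ _) _.
- near=> s.
  have [s1 s1' n1 ->] : [/\ (size (p1 s) <= d1)%N, (size (q1 s) <= d1)%N,
      q1 s != 0 & f s = polyF (p1 s) / polyF (q1 s)] by near: s.
  have [s2 s2' n2 ->] : [/\ (size (p2 s) <= d2)%N, (size (q2 s) <= d2)%N,
      q2 s != 0 & g s = polyF (p2 s) / polyF (q2 s)] by near: s.
  have sM (a b : {poly K}) k l : (size a <= k)%N -> (size b <= l)%N ->
      (size (a * b)%R <= k + l)%N.
    by move=> sa sb; apply: leq_trans (size_polyMleq _ _) _; lia.
  by split; [exact: sM|exact: sM|exact: mulf_neq0|rewrite fracM].
- rewrite !fracM fracD ?(mulf_neq0, expf_neq0) //; apply/eqP.
  rewrite frac_eq ?(mulf_neq0, expf_neq0) //; apply/eqP; ring.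
Unshelve. all: by end_near. Qed.

Lemma ratfun_is_derive_sum (J : Type) (r : seq J) (P : pred J)
    (h : J -> K -> F) (h' : J -> F) (t : K) :
  (forall j, ratfun_is_derive (h j) t (h' j)) ->
  ratfun_is_derive (fun s => \sum_(j <- r | P j) h j s) t
    (\sum_(j <- r | P j) h' j).
Proof.
move=> dh; elim: r => [|j r IHr].
  by under eq_fun do rewrite big_nil; rewrite big_nil; exact: ratfun_is_derive_cst.
under eq_fun do rewrite big_cons; rewrite big_cons.
by case: (P j) => //; apply: ratfun_is_deriveD.
Qed.

Lemma ratfun_is_deriveZ (c : F) (f : K -> F) (t : K) (f' : F) : ratfun_is_derive f t f' ->
  ratfun_is_derive (fun s => c * f s) t (c * f').
Proof.
move=> df; apply: ratfun_is_derive_eq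
  (ratfun_is_deriveM (ratfun_is_derive_cst c t) df) _.
by rewrite mul0r add0r.
Qed.

Lemma ratfun_is_derive_scaleF a (f : K -> F) (t : K) (f' : F) : a != 0 -> ratfun_is_derive f t f' ->
  ratfun_is_derive (fun s => scaleF a (f s)) t (scaleF a f').
Proof.
move=> a0 [d [p [q [p' [q' [H dp dq ->]]]]]].
have [_ _ q0 _] := nbhs_singleton H.
have D h H0 := @ratfun_is_derive_div h _ _ t _ _ d H0
  (poly_is_derive_scaleX a dp) (poly_is_derive_scaleX a dq).
have sC (r : {poly K}) : size (r \Po (a *: 'X)) = size r.
  have szX : size (a *: 'X : {poly K}) = 2 by rewrite size_scale ?size_polyX.
  by rewrite size_comp_poly2.
apply: ratfun_is_derive_eq (D _ _) _.
- near=> s.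
  have [s1 s1' n1 ->] : [/\ (size (p s) <= d)%N, (size (q s) <= d)%N,
      q s != 0 & f s = polyF (p s) / polyF (q s)] by near: s.
  by rewrite !sC comp_scale_neq0 // scaleFE.
- by rewrite scaleFE ?expf_neq0 // !expr2 comp_polyB !comp_polyM.
Unshelve. all: by end_near. Qed.

Lemma ratfun_is_derive_derivF (f : K -> F) (t : K) (f' : F) : ratfun_is_derive f t f' ->
  ratfun_is_derive (fun s => derivF (f s)) t (derivF f').
Proof.
move=> [d [p [q [p' [q' [H dp dq ->]]]]]].
have [_ _ q0 _] := nbhs_singleton H.
have dpd := poly_is_derive_deriv dp; have dqd := poly_is_derive_deriv dq.
have dn := poly_is_deriveD (poly_is_deriveM dpd dq)
  (poly_is_deriveN (poly_is_deriveM dp dqd)).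
have dd := poly_is_deriveM dq dq.
have D h H := @ratfun_is_derive_div h _ _ t _ _ (d + d)%N H dn dd.
apply: ratfun_is_derive_eq (D _ _) _.
- near=> s.
  have [s1 s1' n1 ->] : [/\ (size (p s) <= d)%N, (size (q s) <= d)%N,
      q s != 0 & f s = polyF (p s) / polyF (q s)] by near: s.
  have sM (a b : {poly K}) : (size a <= d)%N -> (size b <= d)%N ->
      (size (a * b)%R <= d + d)%N.
    by move=> sa sb; apply: leq_trans (size_polyMleq _ _) _; lia.
  have sD (a : {poly K}) : (size a <= d)%N -> (size a^`() <= d)%N.
    move=> sa; apply/leq_sizeP => i le_i.
    by rewrite coef_deriv nth_default ?mul0rn //; exact: leq_trans sa (leqW le_i).
  split; [|by rewrite sM|exact: mulf_neq0|by rewrite derivFE].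
  apply: leq_trans (size_polyD _ _) _; rewrite size_polyN geq_max.
  by rewrite !sM ?sD.
- rewrite derivFE ?expf_neq0 //; apply/eqP.
  rewrite frac_eq ?(mulf_neq0, expf_neq0) //; apply/eqP.
  by rewrite expr2 !derivD derivN !derivM; ring.
Unshelve. all: by end_near. Qed.

(** A derivative is computed from some presentation as a quotient, so independence of that choice
    must be proved. The difference of two derivatives is a derivative of the zero curve; any
    numerator presenting zero vanishes near [t], and so does its derivative at [t]. *)
Lemma ratfun_is_derive_unique (f : K -> F) (t : K) (a b : F) :
  ratfun_is_derive f t a -> ratfun_is_derive f t b -> a = b.
Proof.
move=> da db; apply/eqP; rewrite -subr_eq0; apply/eqP.
have := ratfun_is_deriveD da (ratfun_is_deriveZ (-1) db).
rewrite mulN1r; under eq_fun do rewrite mulN1r subrr.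
move: (a - b) => c [d [p [q [p' [q' [H dp dq ->]]]]]].
suff p0 : \forall s \near t, p s = 0.
  have -> : p' = 0.
    apply/polyP => i; rewrite coef0; apply: is_derive_unique (dp i) _.
    apply: near_eq_is_derive (is_derive_fct_cst 0 t).
    by near=> s; rewrite (_ : p s = 0) ?coef0 //; near: s.
  by rewrite (nbhs_singleton p0) !mul0r subrr rmorph0 mul0r.
near=> s; have [_ _ n1 /esym/eqP] : [/\ (size (p s) <= d)%N, (size (q s) <= d)%N,
      q s != 0 & 0 = polyF (p s) / polyF (q s)] by near: s.
by rewrite mulf_eq0 invr_eq0 !tofrac_eq0 (negPf n1) orbF => /eqP.
Unshelve. all: by end_near. Qed.

End RationalCurves.

(** * Differentiable curves of series *)

Section CrossedCurves.
Variables (K : numFieldType) (n : nat) (mu : K).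
Hypothesis mu_prim : n.+1.-primitive_root mu.
Variables (tau : K) (kappa : 'I_n.+1 -> K).
Local Notation A := (crossed mu_prim).
Local Notation F := {fraction {poly K}}.
Local Notation P := (Pring mu_prim tau kappa).
Local Notation od := (P_data mu_prim tau kappa).

Definition crossed_is_derive (a : K -> A) (t : K) (a' : A) :=
  forall r, ratfun_is_derive (fun s => a s r) t (a' r).

Lemma crossed_is_derive_eq (a : K -> A) (t : K) (a' b' : A) :
  crossed_is_derive a t a' -> a' = b' -> crossed_is_derive a t b'.
Proof. by move=> ? <-. Qed.

Lemma crossed_is_derive_cst (c : A) (t : K) : crossed_is_derive (fun=> c) t 0.
Proof. by move=> r; rewrite ffunE; exact: ratfun_is_derive_cst. Qed.

Lemma crossed_is_deriveD (a b : K -> A) (t : K) (a' b' : A) :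
  crossed_is_derive a t a' -> crossed_is_derive b t b' ->
  crossed_is_derive (fun s => a s + b s) t (a' + b').
Proof.
move=> da db r; rewrite ffunE; under eq_fun do rewrite ffunE.
exact: ratfun_is_deriveD.
Qed.

Lemma crossed_is_derive_sum (J : Type) (s : seq J) (Q : pred J)
    (h : J -> K -> A) (h' : J -> A) (t : K) :
  (forall j, crossed_is_derive (h j) t (h' j)) ->
  crossed_is_derive (fun u => \sum_(j <- s | Q j) h j u) t
    (\sum_(j <- s | Q j) h' j).
Proof.
move=> dh; elim: s => [|j s IHs].
  under eq_fun do rewrite big_nil; rewrite big_nil.
  exact: crossed_is_derive_cst.
under eq_fun do rewrite big_cons; rewrite big_cons.
by case: (Q j) => //; apply: crossed_is_deriveD.
Qed.

(** The product involves the group action, which is a substitution with a constant factor and so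
    passes through the time derivative. *)
Lemma crossed_is_deriveM (a b : K -> A) (t : K) (a' b' : A) :
  crossed_is_derive a t a' -> crossed_is_derive b t b' ->
  crossed_is_derive (fun s => a s * b s) t (a' * b t + a t * b').
Proof.
move=> da db r; rewrite !ffunE -big_split /=; under eq_fun do rewrite ffunE.
apply: ratfun_is_derive_sum => p; apply: ratfun_is_deriveM; first exact: da.
by apply: ratfun_is_derive_scaleF; [exact: (muV_neq0 mu_prim)|exact: db].
Qed.

Lemma crossed_is_deriveZ (c : A) (a : K -> A) (t : K) (a' : A) :
  crossed_is_derive a t a' -> crossed_is_derive (fun s => c * a s) t (c * a').
Proof.
move=> da; apply: crossed_is_derive_eq
  (crossed_is_deriveM (crossed_is_derive_cst c t) da) _.
by rewrite mul0r add0r.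
Qed.

Lemma crossed_is_deriveZr (c : A) (a : K -> A) (t : K) (a' : A) :
  crossed_is_derive a t a' -> crossed_is_derive (fun s => a s * c) t (a' * c).
Proof.
move=> da; apply: crossed_is_derive_eq
  (crossed_is_deriveM da (crossed_is_derive_cst c t)) _.
by rewrite mulr0 addr0.
Qed.

Lemma crossed_is_deriveN (a : K -> A) (t : K) (a' : A) :
  crossed_is_derive a t a' -> crossed_is_derive (fun s => - a s) t (- a').
Proof.
move=> da; rewrite -mulN1r; under eq_fun do rewrite -mulN1r.
exact: crossed_is_deriveZ.
Qed.

Lemma crossed_is_derive_twist (k : K) (a : K -> A) (t : K) (a' : A) :
  crossed_is_derive a t a' ->
  crossed_is_derive (fun s => twist k (a s)) t (twist k a').
Proof.
move=> da r; rewrite ffunE; under eq_fun do rewrite ffunE.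
exact: ratfun_is_deriveZ.
Qed.

(** The operator is additive with coefficients independent of time, and its derivation in x commutes
    with the time derivative. *)
Lemma crossed_is_derive_dunkl (a : K -> A) (t : K) (a' : A) :
  crossed_is_derive a t a' ->
  crossed_is_derive (fun s => dunkl_D tau kappa (a s)) t (dunkl_D tau kappa a').
Proof.
move=> da; apply: crossed_is_deriveD.
  apply: crossed_is_deriveZ => r; rewrite ffunE; under eq_fun do rewrite ffunE.
  exact: ratfun_is_derive_derivF.
apply: crossed_is_deriveN; apply: crossed_is_derive_sum => r.
apply: crossed_is_deriveZ; apply: crossed_is_deriveD.
  exact: crossed_is_deriveZ.
by apply: crossed_is_deriveN; exact: crossed_is_deriveZr.
Qed.

Lemma crossed_is_derive_crossedF (f : K -> F) (t : K) (f' : F) :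
  ratfun_is_derive f t f' ->
  crossed_is_derive (fun s => crossedF mu_prim (f s)) t (crossedF mu_prim f').
Proof.
move=> df r; rewrite ffunE; under eq_fun do rewrite ffunE.
by case: ifP => // _; exact: ratfun_is_derive_cst.
Qed.

Definition coef_is_derive (f : K -> int -> A) (t : K) (f' : int -> A) :=
  forall j, crossed_is_derive (fun s => f s j) t (f' j).

Lemma coef_is_derive_ymul (f : K -> int -> A) (t : K) (f' : int -> A) :
  coef_is_derive f t f' ->
  coef_is_derive (fun s => ymul od (f s)) t (ymul od f').
Proof.
move=> df j; apply: crossed_is_deriveD; first exact: crossed_is_derive_twist.
exact: crossed_is_derive_dunkl.
Qed.

(** The bound [N], common to all times, fixes the number of terms of the sum behind [yinv] before it
    is differentiated. *)
Lemma coef_is_derive_yinv N (f : K -> int -> A) (t : K) (f' : int -> A) :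
  (forall s, bnd N (f s)) -> bnd N f' -> coef_is_derive f t f' ->
  coef_is_derive (fun s => yinv od (f s)) t (yinv od f').
Proof.
move=> fN fN' df j; rewrite (yinvE od _ fN').
under eq_fun => s do rewrite (yinvE od _ (fN s)).
apply: crossed_is_derive_sum => p; apply: crossed_is_deriveZ.
elim: (nat_of_ord p) (j + 1 + _) => [|q IHq] l /=.
  exact: crossed_is_derive_twist.
by apply: crossed_is_derive_twist; apply: crossed_is_derive_dunkl; exact: IHq.
Qed.

Lemma coef_is_derive_ypow N j (f : K -> int -> A) (t : K) (f' : int -> A) :
  (forall s, bnd N (f s)) -> bnd N f' -> coef_is_derive f t f' ->
  coef_is_derive (fun s => ypow od j (f s)) t (ypow od j f').
Proof.
move=> fN fN' df; case: j => k; rewrite /ypow.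
  by elim: k => [//|k IHk]; exact: coef_is_derive_ymul.
have bn (g : int -> A) p : bnd N g -> bnd N (iter p (yinv od) g).
  by move=> gN; elim: p => //= p; exact: bnd_yinv.
elim: k.+1 => [//|p IHp]; apply: (@coef_is_derive_yinv N) => // [s|]; exact: bn.
Qed.

Lemma coef_is_derive_mul M N (f g : K -> int -> A) (t : K) (f' g' : int -> A) :
  (forall s, bnd M (f s)) -> bnd M f' -> (forall s, bnd N (g s)) -> bnd N g' ->
  coef_is_derive f t f' -> coef_is_derive g t g' ->
  coef_is_derive (fun s => mul_coef od (f s) (g s)) t
    (fun j => mul_coef od f' (g t) j + mul_coef od (f t) g' j).
Proof.
move=> fM fM' gN gN' df dg j.
rewrite (mul_coefE od fM' (gN t) (leqnn _)) (mul_coefE od (fM t) gN' (leqnn _)).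
(* One window serves all times, because the bounds do not depend on [s]. *)
under eq_fun => s do rewrite (mul_coefE od (fM s) (gN s) (leqnn _)).
rewrite -big_split /=; apply: crossed_is_derive_sum => k.
by apply: crossed_is_deriveM => //; exact: (coef_is_derive_ypow (N := N)).
Qed.

(* [series_is_derive] together with a degree bound that is uniform in time,
   without which products could not be differentiated term by term. *)
Definition curve_is_derive (S : K -> P) (t : K) (S' : P) :=
  (exists N : nat, forall s, bnd N (S s)) /\ series_is_derive S t S'.

Lemma curve_is_derive_eq (S : K -> P) (t : K) (S' T' : P) :
  curve_is_derive S t S' -> S' = T' -> curve_is_derive S t T'.
Proof. by move=> ? <-. Qed.

Lemma curve_is_derive_cst (c : P) (t : K) : curve_is_derive (fun=> c) t 0.
Proof.
split; first by have [N cN] := coef_bounded c; exists N.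
by move=> j r; apply: crossed_is_derive_cst.
Qed.

Lemma curve_is_deriveD (S T : K -> P) (t : K) (S' T' : P) :
  curve_is_derive S t S' -> curve_is_derive T t T' ->
  curve_is_derive (fun s => S s + T s) t (S' + T').
Proof.
move=> [[M SM] dS] [[N TN] dT]; split.
  exists (M + N)%N => s j lt_j; rewrite Defs.coefD SM ?TN ?addr0 //; lia.
by move=> j; apply: crossed_is_deriveD; [exact: dS|exact: dT].
Qed.

Lemma curve_is_derive_sum (J : Type) (r : seq J) (Q : pred J)
    (h : J -> K -> P) (h' : J -> P) (t : K) :
  (forall j, curve_is_derive (h j) t (h' j)) ->
  curve_is_derive (fun u => \sum_(j <- r | Q j) h j u) t
    (\sum_(j <- r | Q j) h' j).
Proof.
move=> dh; elim: r => [|j r IHr].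
  under eq_fun do rewrite big_nil; rewrite big_nil.
  exact: curve_is_derive_cst.
under eq_fun do rewrite big_cons; rewrite big_cons.
by case: (Q j) => //; apply: curve_is_deriveD.
Qed.

Lemma curve_is_deriveM (S T : K -> P) (t : K) (S' T' : P) :
  curve_is_derive S t S' -> curve_is_derive T t T' ->
  curve_is_derive (fun s => S s * T s) t (S' * T t + S t * T').
Proof.
move=> [[M SM] dS] [[N TN] dT]; split.
  by exists (M + N)%N => s; exact: bnd_mul.
have [M' SM'] := coef_bounded S'; have [N' TN'] := coef_bounded T'.
move=> j; apply: (@coef_is_derive_mul (M + M') (N + N')) => // [s||s|].
- by apply: bndW (SM s); lia.
- by apply: bndW SM'; lia.
- by apply: bndW (TN s); lia.
- by apply: bndW TN'; lia.
Qed.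

Lemma curve_is_derive_PF (f : K -> F) (t : K) (f' : F) :
  ratfun_is_derive f t f' ->
  curve_is_derive (fun s => PF mu_prim tau kappa (f s)) t (PF mu_prim tau kappa f').
Proof.
move=> df; split; first by exists 0%N => s; exact: (@bnd_delta _ _ 0).
move=> j; rewrite -[forall r, _]/(crossed_is_derive
  (fun s => if j == 0 then crossedF mu_prim (f s) else 0) t
  (if j == 0 then crossedF mu_prim f' else 0)).
case: ifP => _; last exact: crossed_is_derive_cst.
exact: crossed_is_derive_crossedF.
Qed.

Lemma curve_is_derive_neg (a : nat -> K -> A) (t : K) (a' : nat -> A) :
  (forall k, crossed_is_derive (a k) t (a' k)) ->
  curve_is_derive (fun s => neg_series od (fun k => a k s)) t (neg_series od a').
Proof.
move=> da; split; first by exists 0%N => s [].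
by case=> k; [exact: crossed_is_derive_cst|exact: da].
Qed.

Lemma curve_is_derive_unique (S : K -> P) (t : K) (S' T' : P) :
  curve_is_derive S t S' -> curve_is_derive S t T' -> S' = T'.
Proof.
move=> [_ dS] [_ dT]; apply: seriesP; apply: funext => j; apply/ffunP => r.
exact: ratfun_is_derive_unique (dS j r) (dT j r).
Qed.

(** The conclusion is only [series_is_derive]: away from [t] nothing bounds the degrees of [T]. *)
Lemma curve_is_derive_near (S T : K -> P) (t : K) (S' : P) :
  (\forall s \near t, S s = T s) -> curve_is_derive S t S' ->
  series_is_derive T t S'.
Proof.
move=> ST [_ dS] j r; apply: ratfun_is_derive_near (dS j r).
by near=> s; rewrite (_ : S s = T s) //; near: s.
Unshelve. all: by end_near. Qed.

End CrossedCurves.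

(** * Differentiable curves of matrices of series *)

Section MatrixCurves.
Variables (K : numFieldType) (n : nat) (mu : K).
Hypothesis mu_prim : n.+1.-primitive_root mu.
Variables (tau : K) (kappa : 'I_n.+1 -> K).
Local Notation P := (Pring mu_prim tau kappa).

Definition mx_is_derive a b (S : K -> 'M[P]_(a, b)) (t : K) (S' : 'M[P]_(a, b)) :=
  forall i j, curve_is_derive (fun s => S s i j) t (S' i j).

Lemma mx_is_derive_eq a b (S : K -> 'M[P]_(a, b)) (t : K) (S' T' : 'M[P]_(a, b)) :
  mx_is_derive S t S' -> S' = T' -> mx_is_derive S t T'.
Proof. by move=> ? <-. Qed.

Lemma mx_is_derive_cst a b (c : 'M[P]_(a, b)) (t : K) : mx_is_derive (fun=> c) t 0.
Proof. by move=> i j; rewrite mxE; exact: curve_is_derive_cst. Qed.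

Lemma mx_is_deriveD a b (S T : K -> 'M[P]_(a, b)) (t : K) (S' T' : 'M[P]_(a, b)) :
  mx_is_derive S t S' -> mx_is_derive T t T' ->
  mx_is_derive (fun s => S s + T s) t (S' + T').
Proof.
move=> dS dT i j; rewrite mxE; under eq_fun do rewrite mxE.
exact: curve_is_deriveD.
Qed.

Lemma mx_is_deriveM a b c (S : K -> 'M[P]_(a, b)) (T : K -> 'M[P]_(b, c)) (t : K)
    (S' : 'M[P]_(a, b)) (T' : 'M[P]_(b, c)) :
  mx_is_derive S t S' -> mx_is_derive T t T' ->
  mx_is_derive (fun s => S s *m T s) t (S' *m T t + S t *m T').
Proof.
move=> dS dT i j; rewrite !mxE -big_split /=; under eq_fun do rewrite mxE.
by apply: curve_is_derive_sum => k; exact: curve_is_deriveM.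
Qed.

Lemma mx_is_derive_unique a b (S : K -> 'M[P]_(a, b)) (t : K)
    (S' T' : 'M[P]_(a, b)) :
  mx_is_derive S t S' -> mx_is_derive S t T' -> S' = T'.
Proof.
by move=> dS dT; apply/matrixP => i j; exact: curve_is_derive_unique (dS i j) (dT i j).
Qed.

(** Applied to a matrix and its inverse, this determines the derivative of the inverse once that
    derivative is known to exist. *)
Lemma mx_is_derive_mul_cst a b c (S : K -> 'M[P]_(a, b)) (T : K -> 'M[P]_(b, c))
    (C : 'M[P]_(a, c)) (t : K) (S' : 'M[P]_(a, b)) (T' : 'M[P]_(b, c)) :
  (forall s, S s *m T s = C) -> mx_is_derive S t S' -> mx_is_derive T t T' ->
  S' *m T t + S t *m T' = 0.
Proof.
move=> ST dS dT; apply: mx_is_derive_unique (mx_is_deriveM dS dT) _.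
by under eq_fun do rewrite ST; exact: mx_is_derive_cst.
Qed.

End MatrixCurves.

(** * The dressing matrix and its inverse *)

Section Dressing.
Variables (A : nzRingType) (N : nat) (x y xi yi e : 'M[A]_N).
Variables (W : 'rV[A]_N) (V : 'cV[A]_N).
Hypotheses (xK : x *m xi = 1%:M) (xVK : xi *m x = 1%:M).
Hypotheses (yK : y *m yi = 1%:M) (yVK : yi *m y = 1%:M).
Hypothesis comm_xy : (x *m y - y *m x) *m e = - (V *m W).
Hypotheses (We : W *m e = W) (eV : e *m V = V).
Hypothesis exy : e *m (xi *m yi) = (xi *m yi) *m e.
Hypothesis eyx : e *m (yi *m xi) = (yi *m xi) *m e.

(** Kept as a 1 by 1 matrix so that the whole argument is associative matrix algebra over an
    arbitrary ring; [cm_ME] identifies its entry with [cm_M]. *)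
Definition dressing : 'M[A]_1 := 1%:M - W *m (xi *m yi) *m V.
Definition dressing_inv : 'M[A]_1 := 1%:M + W *m (yi *m xi) *m V.

(** The commutator is known only after multiplication by [e]. Since [e] passes through [Z] and is
    absorbed by [V], it disappears from the result. *)
Lemma moment_sandwich Z : e *m Z = Z *m e ->
  V *m W *m Z *m V = (y *m x - x *m y) *m Z *m V.
Proof.
move=> eZ; have -> : V *m W = (y *m x - x *m y) *m e.
  by rewrite -[LHS]opprK -comm_xy -mulNmx opprB.
by rewrite -!mulmxA (mulmxA e) eZ -(mulmxA Z) eV.
Qed.

(** In the product of the two correction terms, the inner [V *m W] becomes [y *m x - x *m y].
    Between [xi *m yi] and [yi *m xi] this telescopes to the difference of these two, which cancels
    the linear terms. *)
Lemma dressing_mulr : dressing *m dressing_inv = 1%:M.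
Proof.
have E : W *m (xi *m yi) *m V *m (W *m (yi *m xi) *m V)
       = W *m (yi *m xi) *m V - W *m (xi *m yi) *m V.
  have -> : W *m (xi *m yi) *m V *m (W *m (yi *m xi) *m V)
     = W *m (xi *m yi) *m (V *m W *m (yi *m xi) *m V) by rewrite !mulmxA.
  rewrite moment_sandwich // !mulmxA -mulmxBl; congr (_ *m V).
  rewrite mulmxBr !mulmxBl -!mulmxA; congr (_ - _); congr (W *m _).
    by rewrite (mulmxA yi y) yVK mul1mx (mulmxA xi x) xVK mul1mx.
  by rewrite (mulmxA y yi) yK mul1mx xK mulmx1.
rewrite /dressing /dressing_inv mulmxBl mul1mx mulmxDr mulmx1 E.
by rewrite [X in _ - X]addrC subrK addrK.
Qed.

Lemma dressing_mull : dressing_inv *m dressing = 1%:M.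
Proof.
have E : W *m (yi *m xi) *m V *m (W *m (xi *m yi) *m V)
       = W *m (yi *m xi) *m V - W *m (xi *m yi) *m V.
  have -> : W *m (yi *m xi) *m V *m (W *m (xi *m yi) *m V)
     = W *m (yi *m xi) *m (V *m W *m (xi *m yi) *m V) by rewrite !mulmxA.
  rewrite moment_sandwich // !mulmxA -mulmxBl; congr (_ *m V).
  rewrite mulmxBr !mulmxBl -!mulmxA; congr (_ - _); congr (W *m _).
    by rewrite (mulmxA x xi) xK mul1mx yK mulmx1.
  by rewrite (mulmxA xi x) xVK mul1mx (mulmxA yi y) yVK mul1mx.
rewrite /dressing /dressing_inv mulmxBr mulmx1 mulmxDl mul1mx E.
by rewrite addrCA subrr addr0 addrK.
Qed.

Variables (ys ysi T : 'M[A]_N).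
Hypotheses (ysK : ys *m ysi = 1%:M) (ysVK : ysi *m ys = 1%:M).
Hypotheses (yT : y = ys *m (T - 1%:M)) (Tys : T *m ys = ys *m T).

(** In the application [ys] and [ysi] are the scalar matrices of y and y^-1, [T] is Y y^-1, and the
    matrix [y] of this section is Y - y. *)
Definition geom_sum (k : nat) : 'M[A]_N := \sum_(a < k) T ^+ a.

Lemma geom_sumP k : T ^+ k - 1%:M = (T - 1%:M) *m geom_sum k.
Proof. exact: subrX1. Qed.

Lemma Tysi : T *m ysi = ysi *m T.
Proof. by rewrite -[LHS]mul1mx -ysVK -!mulmxA (mulmxA ys) -Tys -mulmxA ysK mulmx1. Qed.

Lemma powT_ysi k : T ^+ k *m ysi = ysi *m T ^+ k.
Proof. 
elim: k => [|k IHk]; first by rewrite expr0 mulmx1 mul1mx.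
by rewrite exprSr -mulmxE -mulmxA Tysi mulmxA IHk mulmxA.
Qed.

Lemma geom_sum_ysi k : geom_sum k *m ysi = ysi *m geom_sum k.
Proof.
by rewrite mulmx_suml mulmx_sumr; apply: eq_bigr => a _; exact: powT_ysi.
Qed.

(** [T - 1] is [y] up to [ysi], so [y] divides [T ^+ k - 1] on either side. The left division
    cancels against [yi] in the term with the derivative of [V]; the right division of [powTr] lets
    [y] meet [u]. *)
Lemma powTl k : T ^+ k = 1%:M + y *m (ysi *m geom_sum k).
Proof.
rewrite -geom_sum_ysi yT -mulmxA [X in ys *m X]mulmxA -geom_sumP.
by rewrite mulmxBl mul1mx powT_ysi mulmxBr !mulmxA ysK mul1mx addrC subrK.
Qed.

Lemma geom_sumT k : geom_sum k *m T = T *m geom_sum k.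
Proof.
rewrite mulmx_suml mulmx_sumr; apply: eq_bigr => a _.
by rewrite mulmxE -exprSr exprS.
Qed.

Lemma powTr k : T ^+ k = 1%:M + ysi *m geom_sum k *m y.
Proof.
rewrite -geom_sum_ysi yT -(mulmxA _ ysi) (mulmxA ysi) ysVK mul1mx.
by rewrite mulmxBr mulmx1 geom_sumT -[X in _ - X]mul1mx -mulmxBl -geom_sumP addrC subrK.
Qed.

Local Notation u := (xi *m yi *m V).

Lemma dressing_u : W *m u = 1%:M - dressing.
Proof. by rewrite /dressing opprB addrCA subrr addr0 !mulmxA. Qed.

(** The sandwich relation turns [xi *m V *m (W *m u)] into [xi *m V - y *m u], and [W *m u] is
    [1%:M - dressing]. This is what produces factors [dressing] on the right. *)
Lemma y_u : y *m u = xi *m V *m dressing.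
Proof.
have E : xi *m V *m (W *m (xi *m yi) *m V) = xi *m V - y *m u.
  have -> : xi *m V *m (W *m (xi *m yi) *m V)
     = xi *m (V *m W *m (xi *m yi) *m V) by rewrite !mulmxA.
  rewrite moment_sandwich // !mulmxA -mulmxBl; congr (_ *m V).
  rewrite mulmxBr !mulmxBl -!mulmxA; congr (_ - _).
    by rewrite (mulmxA x xi) xK mul1mx yK mulmx1.
  by rewrite (mulmxA xi x) xVK mul1mx.
by rewrite /dressing mulmxBr mulmx1 E opprB addrCA subrr addr0.
Qed.

Definition geom (q : nat) : 'M[A]_N := ysi *m geom_sum q.

Lemma powT_u q : T ^+ q *m u = u + geom q *m (xi *m V) *m dressing.
Proof. by rewrite powTr mulmxDl mul1mx -(mulmxA _ y) y_u !mulmxA. Qed.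

(** The expanded form agrees term by term with the derivative of [x], and its degrees in y are
    estimated summand by summand in [nonneg_lax_mx]. *)
Lemma mulmx_geom p (B : 'M[A]_(p, N)) (z : 'M[A]_1) k :
  B *m geom k *m V *m z = B *m \sum_(q < k) (ysi *m T ^+ q *m V *m z).
Proof. by rewrite -!mulmx_suml -mulmx_sumr !mulmxA. Qed.

Variables (e' X' : 'M[A]_N) (z : 'M[A]_1) (k : nat).
Hypothesis e'xi : xi *m e' = e *m xi.
Hypothesis e'X' : e' *m X' =
  - \sum_(p < k) ysi *m T ^+ p *m V *m z *m W *m T ^+ (k - p.+1).

(* The derivative of [dressing] along the flow: that of [x] is [X'], and [y] is constant. *)
Definition ddressing : 'M[A]_1 :=
  - (z *m W *m T ^+ k *m u - W *m (xi *m X') *m u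
     - W *m (xi *m yi) *m (T ^+ k *m V *m z)).

(** The first two summands arise from the derivative of [W], the last two from that of [x]; the
    first and the third come from replacing [W *m u] by [1%:M - dressing]. *)
Definition lax_part : 'M[A]_1 :=
  z - z *m W *m geom k *m (xi *m V) + W *m xi *m geom k *m V *m z
  - \sum_(p < k) W *m xi *m (ysi *m T ^+ p *m V *m z) *m
      (W *m geom (k - p.+1) *m (xi *m V)).

Lemma ddressingE : ddressing + dressing *m z = lax_part *m dressing.
Proof.
have EW : z *m W *m T ^+ k *m u
    = z - z *m dressing + z *m W *m geom k *m (xi *m V) *m dressing.
  rewrite -(mulmxA _ _ u) powT_u mulmxDr -(mulmxA z W u) dressing_u.
  by rewrite mulmxBr mulmx1 !mulmxA.
have EV : W *m (xi *m yi) *m (T ^+ k *m V *m z)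
    = z - dressing *m z + W *m xi *m geom k *m V *m z.
  have -> : T ^+ k *m V *m z = V *m z + y *m geom k *m V *m z.
    by rewrite powTl mulmxDl mul1mx mulmxDl.
  rewrite mulmxDr; congr (_ + _).
    by rewrite /dressing mulmxBl mul1mx opprB addrCA subrr addr0 !mulmxA.
  by rewrite -!mulmxA (mulmxA yi y) yVK mul1mx.
pose a (p : nat) := W *m xi *m (ysi *m T ^+ p *m V *m z).
pose b (p : nat) := W *m geom (k - p.+1) *m (xi *m V).
have Ea : \sum_(p < k) a p = W *m xi *m geom k *m V *m z.
  by rewrite mulmx_geom mulmx_sumr.
have EX : W *m (xi *m X') *m u
    = - (W *m xi *m geom k *m V *m z - W *m xi *m geom k *m V *m z *m dressing
         + (\sum_(p < k) a p *m b p) *m dressing).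
  (* [X'] is known only through [e' *m X'], so an [e] is split off from [W] and moved through [xi],
     where it becomes [e']. *)
  rewrite -{1}We -(mulmxA W e) (mulmxA e) -e'xi -(mulmxA xi e') e'X'.
  rewrite !mulmxN mulNmx; congr (- _).
  rewrite -Ea !mulmx_suml !mulmx_sumr mulmx_suml -sumrB -big_split /=.
  apply: eq_bigr => p _.
  have -> : W *m (xi *m (ysi *m T ^+ p *m V *m z *m W *m T ^+ (k - p.+1))) *m u
      = a p *m (W *m (T ^+ (k - p.+1) *m u)) by rewrite /a !mulmxA.
  rewrite powT_u mulmxDr dressing_u mulmxDr mulmxBr mulmx1; congr (_ + _).
  by rewrite /b !mulmxA.
have -> : lax_part *m dressing = z *m dressing
    - z *m W *m geom k *m (xi *m V) *m dressing
    + W *m xi *m geom k *m V *m z *m dressing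
    - (\sum_(p < k) a p *m b p) *m dressing.
  by rewrite [LHS]mulmxBl [X in X - _ = _]mulmxDl [X in X + _ - _ = _]mulmxBl.
(* The terms that are not right multiples of [dressing] cancel: [z] between [EW] and [EV],
   [W *m xi *m geom k *m V *m z] between [EX] and [EV], and [dressing *m z] against the term added
   on the left. *)
rewrite /ddressing EW EV EX opprK opprB.
move: (\sum_(p < k) _) => d; move: (W *m xi *m _ *m _ *m z) => c.
apply/eqP; rewrite addrAC subr_eq eq_sym; apply/eqP.
rewrite [LHS](AC (4*(3*3)) ((5*8)*(1*6)*(7*2)*(3*9)*(10*4)))%AC /=.
by rewrite !subrr !addr0 addrAC subrK.
Qed.

End Dressing.

(** * Degrees in y *)

Section SeriesDegrees.
Variables (A : nzRingType) (o : ore_data A).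
Local Notation P := (series o).
Implicit Types S T : P.

Definition nonneg_series S := forall j : int, j < 0 -> S j = 0.
Definition negative_series S := forall j : int, 0 <= j -> S j = 0.

Lemma nonneg_seriesD S T :
  nonneg_series S -> nonneg_series T -> nonneg_series (S + T).
Proof. by move=> S0 T0 j j0; rewrite Defs.coefD S0 ?T0 ?addr0. Qed.

Lemma nonneg_seriesN S : nonneg_series S -> nonneg_series (- S).
Proof. by move=> S0 j j0; rewrite Defs.coefN S0 ?oppr0. Qed.

Lemma nonneg_series_monom a k : nonneg_series (monom o a (Posz k)).
Proof. by move=> j j0; rewrite coef_monom; case: eqP => // e; lia. Qed.

Lemma nonneg_series_sum (J : Type) (r : seq J) (Q : pred J) (h : J -> P) :
  (forall i, nonneg_series (h i)) -> nonneg_series (\sum_(i <- r | Q i) h i).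
Proof.
by move=> h0; elim/big_ind: _ => // S T; exact: nonneg_seriesD.
Qed.

(** Multiplying a coefficient by y on the left gives terms of degrees 1 and 0 only, so non-negative
    powers of y create no negative ones. *)
Lemma nonneg_seriesM S T :
  nonneg_series S -> nonneg_series T -> nonneg_series (S * T).
Proof.
have [[M SM] [N TN]] := (coef_bounded S, coef_bounded T).
move=> S0 T0 j j0; rewrite Defs.coefM (mul_coefE o SM TN (leqnn _)) big1 // => k _.
have [k0|k0] := ltP k 0; first by rewrite S0 ?mul0r.
case: k k0 => // k _; suff -> : ypow o k T j = 0 by rewrite mulr0.
elim: k j j0 => [|k IHk] j j0 /=; first exact: T0.
by rewrite /ymul -!/(ypow o k T _) !IHk ?raddf0 ?addr0 //; lia.
Qed.

(** Left multiplication by y^k raises the top degree by at most k, and only negative k occur in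
    [S]. *)
Lemma negative_seriesM S T :
  negative_series S -> bnd 0 T -> negative_series (S * T).
Proof.
have [M SM] := coef_bounded S.
move=> S0 T0 j j0; rewrite Defs.coefM (mul_coefE o SM T0 (leqnn _)) big1 // => k _.
have [k0|k0] := leP 0 k; first by rewrite S0 ?mul0r.
by rewrite (ypow_deg o T0) ?mulr0 //; lia.
Qed.

Lemma negative_series_bnd S : negative_series S -> bnd 0 S.
Proof. by move=> S0 j j0; rewrite S0 //; lia. Qed.

Lemma bnd0M S T : bnd 0 S -> bnd 0 T -> bnd 0 (S * T).
Proof. by move=> S0 T0; exact: (bnd_mul o S0 T0). Qed.

Lemma nonneg_partE S T U : S = T + U -> nonneg_series T -> negative_series U ->
  nonneg_part S = T.
Proof.
move=> -> T0 U0; apply: seriesP; apply: funext => j /=; case: leP => j0.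
  by rewrite U0 ?addr0.
by rewrite T0.
Qed.

Lemma ypow_delta1l j k : ypow o j (delta 1 k) = delta 1 (k + j).
Proof.
case: j => j; rewrite /ypow.
  elim: j => [|j IHj] /=; first by rewrite addr0.
  by rewrite IHj ymul_delta1; congr delta; lia.
rewrite NegzE; elim: j.+1 => [|p IHp] /=; first by rewrite subr0.
by rewrite IHp yinv_delta1; congr delta; lia.
Qed.

(** With coefficients on the left, multiplying by a power of y on the right is a pure shift; no
    commutation is involved. *)
Lemma coef_mul_monom1 S k j : (S * monom o 1 k) j = S (j - k).
Proof.
rewrite Defs.coefM /mul_coef (sumZE (B := `|j - k|)) => [|i lt_i].
  rewrite (bigD1_seq (j - k)) ?window_uniq ?mem_window //= big1 => [|i ni].
    by rewrite ypow_delta1l /delta addr0 ifT ?mulr1 //; apply/eqP; lia.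
  rewrite ypow_delta1l /delta; case: eqP => [e|_]; rewrite ?mulr0 //.
  by case/eqP: ni; lia.
rewrite ypow_delta1l /delta; case: eqP => [e|_]; rewrite ?mulr0 //.
by exfalso; lia.
Qed.

Lemma monom1M (j k : int) : monom o 1 j * monom o 1 k = monom o 1 (j + k).
Proof.
apply: seriesP; apply: funext => i.
by rewrite coef_mul_monom1 !coef_monom subr_eq.
Qed.

(* A constant of the Ore derivation fixed by [theta] commutes with [y], hence
   with every power of [y], on which products are computed. *)
Lemma monom0_central (c : A) : (forall a, c * a = a * c) -> thetaV o c = c ->
  oreD o c = 0 -> forall S, monom o c 0 * S = S * monom o c 0.
Proof.
move=> cC cth cD S.
have yc j : ymul o (delta c j) = delta c (j + 1).
  apply: funext => i; rewrite /ymul /delta subr_eq.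
  have -> : oreD o (if i == j then c else 0) = 0 by case: ifP; rewrite ?cD ?raddf0.
  by rewrite addr0; case: ifP; rewrite ?cth ?raddf0.
have yVc j : yinv o (delta c j) = delta c (j - 1).
  by rewrite -{1}(subrK 1 j) -yc (yinv_ymul o (@bnd_delta _ c _)).
have yjc j : ypow o j (delta c 0) = delta c j.
  case: j => k; rewrite /ypow.
    by elim: k => //= k ->; rewrite yc -PoszD addn1.
  by rewrite NegzE; elim: k.+1 => //= p ->; rewrite yVc; congr delta; lia.
apply: seriesP; apply: funext => j; rewrite coef_monomM Defs.coefM.
rewrite /mul_coef (sumZE (B := `|j|)) => [|k lt_k].
  rewrite (bigD1_seq j) ?window_uniq ?mem_window //= big1 => [|k /negPf nk].
    by rewrite addr0 yjc /delta eqxx cC.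
  by rewrite yjc /delta eq_sym nk mulr0.
rewrite yjc /delta.
by case: eqP => [e|_]; rewrite ?mulr0 //; lia.
Qed.

End SeriesDegrees.

(** * Commutation relations in the ring of series *)

Section DunklRelations.
Variables (K : numFieldType) (n : nat) (mu : K).
Hypothesis mu_prim : n.+1.-primitive_root mu.
Variables (tau : K) (kappa : 'I_n.+1 -> K).
Local Notation I := 'I_n.+1.
Local Notation P := (Pring mu_prim tau kappa).
Local Notation od := (P_data mu_prim tau kappa).
Local Notation y := (yP mu_prim tau kappa).
Local Notation PC := (PC mu_prim tau kappa).
Local Notation PF := (PF mu_prim tau kappa).
Local Notation epsP := (epsP mu_prim tau kappa).
Local Notation eps := (eps mu_prim).
Implicit Types (i j p q r : I).

Lemma muV_exp_mulD j p q : mu ^- (j * (p + q)%R) = mu ^- (j * p) * mu ^- (j * q).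
Proof. by rewrite ![(j * _)%N]mulnC !exprM (mu_expD mu_prim) exprMn invfM. Qed.

Lemma muV_exp_ordS i r : mu ^- (ordS i * r) = mu ^- (i * r) * mu ^- r.
Proof.
by rewrite exprM /= (prim_expr_mod mu_prim) exprS exprMn -exprM mulrC invfM.
Qed.

(** Orthogonality of characters: a geometric sum with ratio [z], where [z] is an [n.+1]-th root of
    unity, equal to 1 exactly when [i = j]. *)
Lemma sum_mu_exp i j :
  \sum_(p : I) mu ^- (i * p) * mu ^+ (j * p) = if i == j then n.+1%:R else 0.
Proof.
have mu0 := mu_neq0 mu_prim.
pose z := mu ^- i * mu ^+ j.
have zE (p : I) : mu ^- (i * p) * mu ^+ (j * p) = z ^+ p.
  by rewrite exprMn exprVn -!exprM.
under eq_bigr do rewrite zE.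
have [eij|nij] := eqVneq i j.
  have -> : z = 1 by rewrite /z eij mulVf // expf_neq0.
  by under eq_bigr do rewrite expr1n; rewrite sumr_const card_ord.
have z1 : z - 1 != 0.
  apply: contraNneq nij => /eqP; rewrite subr_eq0 => /eqP z1.
  have : mu ^+ j == mu ^+ i.
    by apply/eqP; rewrite -[LHS]mul1r -(mulfV (expf_neq0 i mu0)) -mulrA -/z z1 mulr1.
  by rewrite (eq_prim_root_expr mu_prim) !modn_small // eq_sym.
apply: (mulfI z1); rewrite mulr0 -subrX1 /z exprMn exprVn -!exprM ![(_ * n.+1)%N]mulnC.
by rewrite !exprM (prim_expr_order mu_prim) !expr1n invr1 mulr1 subrr.
Qed.

Lemma epsE i r : eps i r = constF (n.+1%:R^-1 * mu ^- (i * r)).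
Proof.
rewrite crossedF_mull rmorphM sum_ffunE; congr (_ * _).
rewrite (bigD1 r) //= big1 ?addr0 => [|p np].
  by rewrite crossedF_mull ffunE eqxx mulr1.
by rewrite crossedF_mull ffunE eq_sym (negPf np) mulr0.
Qed.

(** The coefficients are constants, on which the group acts trivially, so the product is the
    convolution of two characters. *)
Lemma epsM i j : eps i * eps j = if i == j then eps i else 0.
Proof.
have mu0 := mu_neq0 mu_prim.
apply/ffunP => r; rewrite ffunE.
transitivity (constF (n.+1%:R^-1 * n.+1%:R^-1 * mu ^- (j * r) *
   \sum_(p : I) mu ^- (i * p) * mu ^+ (j * p)) : {fraction {poly K}}).
  rewrite mulr_sumr rmorph_sum; apply: eq_bigr => p _.
  rewrite !epsE act_const // -rmorphM; congr constF.
  have -> : mu ^- (j * r) = mu ^- (j * (r - p)%R) * mu ^- (j * p).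
    by rewrite -muV_exp_mulD subrK.
  have m0 : mu ^+ (j * p) != 0 by exact: expf_neq0.
  have field_eq (k a b c : K) : b != 0 -> k * c * (k * a) = k * k * (a * b^-1) * (c * b).
    by move=> b0; field.
  exact: field_eq.
rewrite sum_mu_exp; case: eqP => [->|_]; last by rewrite mulr0 rmorph0 ffunE.
have field_eq (k a : K) : k != 0 -> k^-1 * k^-1 * a * k = k^-1 * a by move=> k0; field.
by rewrite epsE field_eq ?pnatr_eq0.
Qed.

(** Moving x across s^r costs the factor mu^-r, which turns the character of index i into that of
    index i + 1. *)
Lemma eps_x i :
  eps i * crossedF mu_prim (xF K) = crossedF mu_prim (xF K) * eps (ordS i).
Proof.
apply/ffunP => r; rewrite crossedF_mull crossedF_mulr !epsE muV_exp_ordS.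
rewrite /act scaleF_x ?(muV_neq0 mu_prim) // [LHS]mulrA -rmorphM [LHS]mulrC.
by rewrite -!mulrA.
Qed.

Lemma thetaVC_eps i : thetaVC (eps i) = eps (ordS i).
Proof.
apply/ffunP => r; rewrite ffunE !epsE muV_exp_ordS -rmorphM; congr constF.
by rewrite exprVn mulrC mulrA.
Qed.

(** Constants are fixed by the action and the group is abelian. *)
Lemma gam_comm r (f : crossed mu_prim) : (forall q, exists c, f q = constF c) ->
  gam mu_prim r * f = f * gam mu_prim r.
Proof.
move=> fC; apply/ffunP => q; rewrite !ffunE (bigD1 r) //= big1 => [|p np].
  rewrite (bigD1 (q - r)) //= big1 => [|p np].
    have [c ->] := fC (q - r).
    rewrite !ffunE subKr !eqxx act_const // mul1r !addr0.
    by rewrite (_ : 1 = constF 1) ?rmorph1 // act_const // rmorph1 mulr1.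
  rewrite ffunE (_ : _ == r = false) ?act00 ?mulr0 //.
  by apply: contraNF np => /eqP <-; rewrite subKr.
by rewrite ffunE (negPf np) mul0r.
Qed.

Lemma dunkl_D_const (f : crossed mu_prim) : (forall q, exists c, f q = constF c) ->
  dunkl_D tau kappa f = 0.
Proof.
move=> fC; rewrite /dunkl_D big1 => [|r _]; last first.
  by rewrite gam_comm // subrr mulr0.
rewrite subr0 (_ : Defs.derivC f = 0) ?mulr0 //; apply/ffunP => q; rewrite !ffunE.
by have [c ->] := fC q; rewrite derivF_const.
Qed.

Lemma crossedC_const c q : exists c', crossedC mu_prim c q = constF c'.
Proof.
by rewrite ffunE; case: ifP => _; [exists c|exists 0; rewrite rmorph0].
Qed.

Lemma thetaVC_crossedF f : thetaVC (crossedF mu_prim f) = crossedF mu_prim f.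
Proof.
apply/ffunP => q; rewrite !ffunE; case: eqP => [->|]; last by rewrite mulr0.
by rewrite expr0 rmorph1 mul1r.
Qed.

(** The commutator of s^r with x is (mu^-r - 1) x s^r, whose x cancels the x^-1 of the operator.
    Both sides are then compared at each group element; on the right this is a Fourier transform of
    the levels. *)
Lemma dunkl_D_x : dunkl_D tau kappa (crossedF mu_prim (xF K)) =
  - \sum_i crossedC mu_prim (cm_lambda tau kappa i) * eps i.
Proof.
have x0 : xF K != 0 by rewrite tofrac_neq0 polyX_eq0.
have dx : derivF (xF K) = 1.
  rewrite /xF tofrac_div1 derivFE ?oner_eq0 // derivX -polyC1 derivC.
  by rewrite mulr0 subr0 mulr1 expr1n polyC1 rmorph1 divr1.
have comm_x r q : (gam mu_prim r * crossedF mu_prim (xF K)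
    - crossedF mu_prim (xF K) * gam mu_prim r) q
    = (q == r)%:R * (constF (mu ^- r - 1) * xF K).
  rewrite ffunE [X in _ + X]ffunE crossedF_mulr crossedF_mull !ffunE.
  case: eqP => [->|_]; last by rewrite mulr0 mul0r subrr mul0r.
  by rewrite /act scaleF_x ?(muV_neq0 mu_prim) // !mul1r mulr1 rmorphB rmorph1 mulrBl mul1r.
apply/ffunP => q.
have -> : dunkl_D tau kappa (crossedF mu_prim (xF K)) q =
    constF (tau * (q == 0)%:R - cgam mu kappa q * (mu ^- q - 1)).
  rewrite /dunkl_D ffunE [X in _ + X]ffunE rmorphB rmorphM; congr (_ - _).
    rewrite crossedF_mull !ffunE; congr (_ * _).
    by case: eqP => _; rewrite ?dx ?derivF0 ?rmorph1 ?rmorph0.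
  have term r : (crossedC mu_prim (cgam mu kappa r) * crossedF mu_prim (xF K)^-1
       * (gam mu_prim r * crossedF mu_prim (xF K)
          - crossedF mu_prim (xF K) * gam mu_prim r)) q
      = (q == r)%:R * constF (cgam mu kappa r * (mu ^- r - 1)).
    rewrite -mulrA !crossedF_mull comm_x rmorphM.
    have fieldE (E : fieldType) (X a b c : E) : X != 0 ->
        a * (X^-1 * (c * (b * X))) = c * (a * b) by move=> X0; field.
    exact: fieldE.
  rewrite sum_ffunE; under eq_bigr => r _ do rewrite term.
  have [->|q0] := eqVneq q 0.
    rewrite expr0 invr1 subrr mulr0 rmorph0 big1 // => r /negPf r0.
    by rewrite eq_sym r0 mul0r.
  rewrite (bigD1 q) //= eqxx mul1r big1 ?addr0 // => r /andP[_ /negPf rq].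
  by rewrite eq_sym rq mul0r.
rewrite ffunE sum_ffunE.
under eq_bigr => i _ do rewrite crossedF_mull epsE -rmorphM.
rewrite -rmorph_sum -rmorphN; congr constF.
have m0 : n.+1%:R != 0 :> K by rewrite pnatr_eq0.
have s0 : \sum_(i : I) mu ^- (i * q) = n.+1%:R * (q == 0)%:R.
  have := sum_mu_exp q 0; under eq_bigr do rewrite mul0n expr0 mulr1 mulnC.
  by move=> ->; case: eqP => _; rewrite ?mulr1 ?mulr0.
(* Shifting the index by one multiplies the Fourier coefficient at q by mu^-q. *)
have s1 : \sum_(i : I) kappa (ord_pred i) * mu ^- (i * q) = mu ^- q * cgam mu kappa q.
  rewrite (reindex_inj (can_inj (@ordSK n.+1))) mulr_sumr; apply: eq_bigr => i _.
  by rewrite ordSK muV_exp_ordS mulrA mulrC.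
have -> : \sum_i cm_lambda tau kappa i * (n.+1%:R^-1 * mu ^- (i * q))
  = \sum_(i : I) kappa (ord_pred i) * mu ^- (i * q) - cgam mu kappa q
    - tau * n.+1%:R^-1 * \sum_(i : I) mu ^- (i * q).
  rewrite mulr_sumr -!sumrB; apply: eq_bigr => i _; rewrite /cm_lambda.
  move: (n.+1%:R) m0 => m m0; move: (mu ^- _) (kappa _) (kappa i) => a b c.
  by field.
rewrite s0 s1; move: (n.+1%:R) m0 => m m0.
by move: (cgam mu kappa q) (mu ^- q) (q == 0)%:R => a b c; field.
Qed.

Fact PF_is_zmod : zmod_morphism PF.
Proof.
move=> f g; apply: seriesP; apply: funext => j.
rewrite Defs.coefD Defs.coefN !coef_monom; case: ifP => _; last by rewrite subr0.
by rewrite rmorphB.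
Qed.
Fact PF_is_monoid : monoid_morphism PF.
Proof. by split=> [|f g]; rewrite /PF ?rmorph1 // monomM0 rmorphM. Qed.
HB.instance Definition _ := GRing.isZmodMorphism.Build _ P PF PF_is_zmod.
HB.instance Definition _ := GRing.isMonoidMorphism.Build _ P PF PF_is_monoid.
HB.instance Definition _ := GRing.RMorphism.copy PC (PF \o @constF K).

Lemma PC_central c (S : P) : PC c * S = S * PC c.
Proof.
apply: (@monom0_central _ od) => [a||]; first exact: crossedC_central.
- exact: thetaVC_crossedF.
- by apply: dunkl_D_const; exact: crossedC_const.
Qed.

Lemma epsPM i j : epsP i * epsP j = if i == j then epsP i else 0.
Proof.
rewrite /epsP monomM0 epsM; case: eqP => // _.
by apply: seriesP; apply: funext => k; rewrite coef_monom if_same.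
Qed.

Lemma epsP_x i : epsP i * PF (xF K) = PF (xF K) * epsP (ordS i).
Proof. by rewrite /epsP /PF !monomM0 eps_x. Qed.

Lemma y_epsP i : y * epsP i = epsP (ordS i) * y.
Proof.
rewrite /yP /epsP y_mul [thetaV _ _]thetaVC_eps [oreD _ _]dunkl_D_const.
  rewrite monom_ypow; apply: seriesP; apply: funext => k.
  by rewrite Defs.coefD !coef_monom if_same addr0.
by move=> q; rewrite epsE; eexists.
Qed.

Lemma commutator_xy :
  PF (xF K) * y - y * PF (xF K) = \sum_i PC (cm_lambda tau kappa i) * epsP i.
Proof.
rewrite /yP y_mul [thetaV _ _]thetaVC_crossedF [oreD _ _]dunkl_D_x monom_ypow.
rewrite opprD addrA subrr sub0r; 
have PCeps c i : PC c * epsP i = monom od (crossedC mu_prim c * eps i) 0.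
  exact: monomM0.
under [RHS]eq_bigr do rewrite PCeps.
apply: seriesP; apply: funext => k; rewrite Defs.coefN coef_monom.
rewrite (big_morph (fun S : P => S k) (fun S T => Defs.coefD S T k) erefl).
case: eqP => [->|/eqP/negPf k0]; first by rewrite opprK.
by rewrite oppr0 big1 // => i _; rewrite coef_monom k0.
Qed.

End DunklRelations.

(** * Matrices of a quiver representation *)

Section QuiverMatrices.
Variables (K : numFieldType) (n : nat) (alpha : 'I_n.+1 -> nat).
Local Notation I := 'I_n.+1.
Local Notation N := (\sum_i alpha i)%N.
Local Notation incl := (inclV K alpha).
Local Notation proj := (projV K alpha).
Implicit Types (i j : I) (r : cm_rep K alpha).

(** The transport reconciles [alpha i] with [alpha j], which are equal only through [eij]. *)
Lemma projV_inclV i j (eij : i = j) :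
  proj i *m incl j = castmx (erefl, congr1 alpha eij) 1%:M.
Proof.
case: j / eij; rewrite castmx_id; apply/matrixP => a b; rewrite !mxE.
rewrite (bigD1 (tagnat.Rank i a)) //= [X in _ + X]big1 ?addr0 => [|s sa].
  by rewrite !mxE eqxx mul1r -val_eqE /= tagnat.eq_Rank eqxx.
by rewrite !mxE (negPf sa) mul0r.
Qed.

Lemma projV_inclV1 i : proj i *m incl i = 1%:M.
Proof. by rewrite (projV_inclV (erefl i)) castmx_id. Qed.

Lemma projV_inclV0 i j : i != j -> proj i *m incl j = 0.
Proof.
move=> nij; apply/matrixP => a b; rewrite !mxE big1 // => s _; rewrite !mxE.
case: eqP => [->|]; rewrite ?mul0r // mul1r -val_eqE /= tagnat.eq_Rank.
by rewrite (negPf nij).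
Qed.

Lemma sum_inclV_projV : \sum_i incl i *m proj i = 1%:M.
Proof.
apply/matrixP => s t; rewrite summxE.
(* A basis index of V is a vertex together with an index in its block, recovered by [tagnat.sig1]
   and [tagnat.sig2]. *)
have E i b : incl i s b = ((i == tagnat.sig1 s) && (b == tagnat.sig2 s :> nat))%:R.
  by rewrite !mxE -{1}[s]tagnat.sig2K -val_eqE /= tagnat.eq_Rank eq_sym [X in _ && X]eq_sym.
rewrite (bigD1 (tagnat.sig1 s)) //= [X in _ + X]big1 ?addr0 => [|i ni]; last first.
  by rewrite !mxE big1 // => b _; rewrite E (negPf ni) mul0r.
rewrite mxE (bigD1 (tagnat.sig2 s)) //= [X in _ + X]big1 ?addr0 => [|b nb]; last first.
  by rewrite E eqxx /= val_eqE (negPf nb) mul0r.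
by rewrite E !eqxx mul1r !mxE tagnat.sig2K eq_sym.
Qed.

(* Locked, lest unification with a product of matrices unfold it. *)
Definition vertexE i : 'M[K]_N := locked (incl i *m proj i).
Local Notation E := vertexE.

Lemma vertexE_def i : E i = incl i *m proj i.
Proof. by rewrite /vertexE -lock. Qed.

Lemma vertexEM i j : E i *m E j = if i == j then E i else 0.
Proof.
rewrite !vertexE_def -mulmxA (mulmxA (proj i)).
case: eqVneq => [<-|ij]; first by rewrite projV_inclV1 mul1mx.
by rewrite projV_inclV0 // mul0mx mulmx0.
Qed.

Lemma sum_mul_inclV p i (F : forall j, 'M[K]_(p, alpha j)) :
  (\sum_j F j *m proj j) *m incl i = F i.
Proof.
rewrite mulmx_suml (bigD1 i) //= [X in _ + X]big1 ?addr0 => [|j ji]; rewrite -mulmxA.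
  by rewrite projV_inclV1 mulmx1.
by rewrite projV_inclV0 // mulmx0.
Qed.

Lemma projV_mul_sum p i (F : forall j, 'M[K]_(alpha j, p)) :
  proj i *m (\sum_j incl j *m F j) = F i.
Proof.
rewrite mulmx_sumr (bigD1 i) //= [X in _ + X]big1 ?addr0 => [|j ji]; rewrite mulmxA.
  by rewrite projV_inclV1 mul1mx.
by rewrite projV_inclV0 1?eq_sym // mul0mx.
Qed.

Lemma totX_inclV r i : totX r *m incl i = incl (ordS i) *m repX r i.
Proof. exact: (sum_mul_inclV _ (fun j => incl (ordS j) *m repX r j)). Qed.

Lemma projV_totY r i : proj i *m totY r = repY r i *m proj (ordS i).
Proof.
rewrite -[RHS](projV_mul_sum i (fun j => repY r j *m proj (ordS j))).
by congr (_ *m _); apply: eq_bigr => j _; rewrite mulmxA.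
Qed.

Lemma sum_ordS (V : zmodType) (f : I -> V) : \sum_i f (ordS i) = \sum_i f i.
Proof.
by rewrite [RHS](reindex_inj (can_inj (@ordSK n.+1))).
Qed.

Lemma projV_totX r i : proj (ordS i) *m totX r = repX r i *m proj i.
Proof.
rewrite /totX mulmx_sumr [LHS](bigD1 i) //= [X in _ + X]big1 ?addr0 => [|j ji]; rewrite !mulmxA.
  by rewrite projV_inclV1 mul1mx.
by rewrite projV_inclV0 ?mul0mx // (inj_eq (can_inj (@ordSK n.+1))) eq_sym.
Qed.

Lemma totY_inclV r i : totY r *m incl (ordS i) = incl i *m repY r i.
Proof.
rewrite /totY mulmx_suml [LHS](bigD1 i) //= [X in _ + X]big1 ?addr0 => [|j ji]; rewrite -mulmxA.
  by rewrite projV_inclV1 mulmx1.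
by rewrite projV_inclV0 ?mulmx0 // (inj_eq (can_inj (@ordSK n.+1))).
Qed.

Lemma totX_vertexE r i : totX r *m E i = E (ordS i) *m totX r.
Proof. by rewrite !vertexE_def mulmxA totX_inclV -mulmxA -projV_totX mulmxA. Qed.

Lemma totY_vertexE r i : totY r *m E (ordS i) = E i *m totY r.
Proof. by rewrite !vertexE_def mulmxA totY_inclV -mulmxA -projV_totY mulmxA. Qed.

Lemma totw_inclV r i : totw r *m incl i = repw r i.
Proof. exact: (sum_mul_inclV _ (repw r)). Qed.

Lemma projV_totv r i : proj i *m totv r = repv r i.
Proof. exact: (projV_mul_sum _ (repv r)). Qed.

Lemma totw_vertexE r i : totw r *m E i = extw r i.
Proof. by rewrite !vertexE_def mulmxA totw_inclV. Qed.

Lemma vertexE_totv r i : E i *m totv r = extv r i.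
Proof. by rewrite !vertexE_def -mulmxA projV_totv. Qed.

(** The commutator is block diagonal while [totv r *m totw r] is not, so only the diagonal blocks of
    the latter occur. The mixed blocks are removed later by the orthogonality of the idempotents. *)
Lemma moment_tot (lam : I -> K) r : cm_moment lam r ->
  totX r *m totY r - totY r *m totX r
  = - \sum_i (E i *m (totv r *m totw r) *m E i + lam i *: E i).
Proof.
move=> mom.
have YX : totY r *m totX r = \sum_j incl j *m (repY r j *m repX r j) *m proj j.
  rewrite -[LHS]mulmx1 -sum_inclV_projV mulmx_sumr; apply: eq_bigr => j _.
  rewrite (mulmxA _ (incl j)) -(mulmxA _ _ (incl j)) totX_inclV mulmxA.
  by rewrite totY_inclV !mulmxA.
have XY : totX r *m totY r
    = \sum_j incl (ordS j) *m (repX r j *m repY r j) *m proj (ordS j).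
  rewrite -[LHS]mulmx1 -sum_inclV_projV mulmx_sumr.
  rewrite -(sum_ordS (fun j => totX r *m totY r *m (incl j *m proj j))).
  apply: eq_bigr => j _.
  rewrite (mulmxA _ (incl _)) -(mulmxA _ _ (incl _)) totY_inclV mulmxA.
  by rewrite totX_inclV !mulmxA.
apply: (canRL (@opprK _)); rewrite opprB YX XY.
(* The moment equation is stated at [ordS j], where the j-th block of XY already lives; the other
   two sums are shifted to match. *)
rewrite -(sum_ordS (fun j => incl j *m _ *m proj j)).
rewrite -(sum_ordS (fun i => _ + lam i *: E i)) -sumrB; apply: eq_bigr => j _.
rewrite -mulmxBl -mulmxBr.
have := mom j => /(canRL (subrK _)) ->.
rewrite mulmxDr mulmxDl addrC; congr (_ + _).
  by rewrite -projV_totv -totw_inclV vertexE_def !mulmxA.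
by rewrite mul_mx_scalar -scalemxAl vertexE_def.
Qed.

Definition gauge (g : forall i : I, 'M[K]_(alpha i)) : 'M[K]_N :=
  \sum_i incl i *m g i *m proj i.

Lemma gaugeM g h : gauge g *m gauge h = gauge (fun i => g i *m h i).
Proof.
rewrite /gauge mulmx_sumr; apply: eq_bigr => i _; rewrite -(mulmxA (incl i)) mulmxA.
by rewrite (sum_mul_inclV _ (fun i => incl i *m g i)) !mulmxA.
Qed.

Lemma gauge1 : gauge (fun=> 1%:M) = 1%:M.
Proof. by rewrite -sum_inclV_projV; apply: eq_bigr => i _; rewrite mulmx1. Qed.

Lemma gauge_inclV g i : gauge g *m incl i = incl i *m g i.
Proof. exact: (sum_mul_inclV _ (fun i => incl i *m g i)). Qed.

Lemma projV_gauge g i : proj i *m gauge g = g i *m proj i.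
Proof.
rewrite -[RHS](projV_mul_sum i (fun j => g j *m proj j)).
by congr (_ *m _); apply: eq_bigr => j _; rewrite mulmxA.
Qed.

Lemma gauge_vertexE g i : gauge g *m E i = E i *m gauge g.
Proof. by rewrite !vertexE_def mulmxA gauge_inclV -mulmxA -projV_gauge mulmxA. Qed.

Lemma totX_gl_act g r :
  totX (gl_act g r) = gauge g *m totX r *m gauge (fun i => invmx (g i)).
Proof.
rewrite /totX mulmx_sumr mulmx_suml; apply: eq_bigr => i _ /=.
by rewrite !mulmxA gauge_inclV -(mulmxA _ (proj i)) projV_gauge !mulmxA.
Qed.

Lemma totY_gl_act g r :
  totY (gl_act g r) = gauge g *m totY r *m gauge (fun i => invmx (g i)).
Proof.
rewrite /totY mulmx_sumr mulmx_suml; apply: eq_bigr => i _ /=.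
by rewrite !mulmxA gauge_inclV -(mulmxA _ (proj (ordS i))) projV_gauge !mulmxA.
Qed.

Lemma totv_gl_act g r : totv (gl_act g r) = gauge g *m totv r.
Proof.
rewrite /totv mulmx_sumr; apply: eq_bigr => i _ /=.
by rewrite /extv [RHS]mulmxA gauge_inclV mulmxA.
Qed.

Lemma totw_gl_act g r : totw (gl_act g r) = totw r *m gauge (fun i => invmx (g i)).
Proof.
rewrite /totw mulmx_suml; apply: eq_bigr => i _ /=.
by rewrite /extw -[RHS]mulmxA projV_gauge mulmxA.
Qed.

End QuiverMatrices.

(** * The dressing matrix of a quiver representation *)

Section SeriesMatrices.
Variables (K : numFieldType) (n : nat) (mu : K).
Hypothesis mu_prim : n.+1.-primitive_root mu.
Variables (tau : K) (kappa : 'I_n.+1 -> K) (alpha : 'I_n.+1 -> nat).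
Local Notation I := 'I_n.+1.
Local Notation P := (Pring mu_prim tau kappa).
Local Notation N := (\sum_i alpha i)%N.
Local Notation y := (yP mu_prim tau kappa).
Local Notation yV := (monom (P_data mu_prim tau kappa) 1 (- 1)).
Local Notation PC := (PC mu_prim tau kappa).
Local Notation PF := (PF mu_prim tau kappa).
Local Notation epsP := (epsP mu_prim tau kappa).
Local Notation E := (vertexE K alpha).
Local Notation lam := (cm_lambda tau kappa).
Local Notation mc := (map_mx PC).
Implicit Types (i j : I) (r : cm_rep K alpha).

Lemma yVK : y * yV = 1. Proof. exact: monom1M. Qed.
Lemma yKV : yV * y = 1. Proof. exact: monom1M. Qed.

Lemma mc_scale p q s (B : 'M[K]_(p, q)) (a : P) (C : 'M[P]_(q, s)) :
  mc B *m (a *: C) = a *: (mc B *m C).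
Proof.
apply/matrixP => k l; rewrite !mxE mulr_sumr; apply: eq_bigr => j _.
by rewrite !mxE !mulrA PC_central.
Qed.

Lemma mc_scalar p q (B : 'M[K]_(p, q)) (a : P) : mc B *m a%:M = a *: mc B.
Proof. by rewrite -[a%:M]mulmx1 mul_scalar_mx mc_scale mulmx1. Qed.

Definition Xh r : 'M[P]_N := mc (totX r) - (PF (xF K))%:M.
Definition Yh r : 'M[P]_N := mc (totY r) - y%:M.
Definition Xi r : 'M[P]_N := map_mx PF (resX r).
Local Notation Yi r := (resY mu_prim tau kappa r).

(** Up to sign this is the characteristic matrix, whose determinant is monic and hence a nonzero
    rational function. *)
Lemma charX_unit r : map_mx (@constF K) (totX r) - (xF K)%:M \in unitmx.
Proof.
set A := totX r.
have -> : map_mx (@constF K) A - (xF K)%:M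
   = - map_mx (@FracField.tofrac {poly K}) (char_poly_mx A).
  apply/matrixP => a b; rewrite !mxE rmorphB rmorphMn /= opprB /constF.
  by [].
rewrite unitmxE -scaleN1r detZ det_map_mx.
rewrite unitrM unitrX ?unitrN ?unitr1 //= unitfE tofrac_neq0.
exact: monic_neq0 (char_poly_monic A).
Qed.

Lemma Xh_map r : Xh r = map_mx PF (map_mx (@constF K) (totX r) - (xF K)%:M).
Proof. by rewrite map_mxB map_scalar_mx -map_mx_comp. Qed.

Lemma XhXi r : Xh r *m Xi r = 1%:M.
Proof. by rewrite Xh_map -map_mxM mulmxV ?charX_unit // map_mx1. Qed.

Lemma XiXh r : Xi r *m Xh r = 1%:M.
Proof. by rewrite Xh_map -map_mxM mulVmx ?charX_unit // map_mx1. Qed.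

Lemma coef_PCM c (S : P) (j : int) : (PC c * S) j = crossedC mu_prim c * S j.
Proof. exact: coef_monomM. Qed.

Lemma coef_series_sum J (s : seq J) (Q : pred J) (S : J -> P) (j : int) :
  (\sum_(i <- s | Q i) S i) j = \sum_(i <- s | Q i) S i j.
Proof. exact: (big_morph (fun S : P => S j) (fun S T => Defs.coefD S T j) erefl). Qed.

Lemma coef_yM (S : P) (j : int) : (y * S) j = ymul (P_data mu_prim tau kappa) S j.
Proof. by rewrite coef_monomM mul1r. Qed.

Lemma coefYi r a b (j : int) : Yi r a b j =
  if j is Negz k then - crossedC mu_prim ((totY r ^+ k) a b) else 0.
Proof. by rewrite mxE. Qed.

(** The coefficients are constants, fixed by theta and killed by the derivation, so left
    multiplication by y is a pure shift here. *)
Lemma coef_yYi r a b (j : int) : (y * Yi r a b) j = Yi r a b (j - 1).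
Proof.
rewrite coef_yM /ymul.
have constYi k : exists c, Yi r a b k = crossedC mu_prim c.
  rewrite coefYi; case: k => k; first by exists 0; rewrite rmorph0.
  by exists (- (totY r ^+ k) a b); rewrite rmorphN.
have [c ->] := constYi j; have [d ->] := constYi (j - 1).
rewrite [thetaV _ _]thetaVC_crossedF [oreD _ _]dunkl_D_const ?addr0 //.
exact: crossedC_const.
Qed.

Lemma coef_scalar1 (a b : 'I_N) (j : int) :
  (1%:M : 'M[P]_N) a b j = if j == 0 then (a == b)%:R else 0.
Proof.
rewrite mxE; case: (a == b); first exact: coef_monom.
by rewrite if_same.
Qed.

(** A telescoping geometric series: in each negative degree, multiplication by Y and the shift by y
    contribute the same power of Y with opposite signs, and degree 0 leaves the identity. *)
Lemma YhYi r : Yh r *m Yi r = 1%:M.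
Proof.
apply/matrixP => a b; rewrite mulmxBl mul_scalar_mx mxE [X in _ + X]mxE.
rewrite [X in - X]mxE; apply: seriesP; apply: funext => j.
rewrite Defs.coefD Defs.coefN coef_yYi coef_scalar1 mxE coef_series_sum.
under [X in X - _]eq_bigr => c _ do rewrite mxE coef_PCM coefYi.
rewrite coefYi; case: j => [[|j]|j].
- rewrite [X in X - _]big1 ?add0r => [|c _]; last by rewrite mulr0.
  rewrite opprK expr0 mxE /=; case: (a == b); last by rewrite rmorph0.
  by rewrite rmorph1.
- rewrite [X in X - _]big1 => [|c _]; last by rewrite mulr0.
  by rewrite subr0.
- have -> : Negz j - 1 = Negz j.+1 by lia.
  rewrite opprK exprS mxE rmorph_sum -big_split /=.
  by rewrite big1 // => c _; rewrite rmorphM mulrN addNr.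
Qed.

Lemma YiYh r : Yi r *m Yh r = 1%:M.
Proof.
apply/matrixP => a b; rewrite mulmxBr mxE [X in _ + X]mxE.
have -> : (Yi r *m y%:M) a b = Yi r a b * y.
  rewrite mxE (bigD1 b) //= [X in _ + X]big1 ?addr0 => [|c cb].
    by rewrite !mxE eqxx mulr1n.
  by rewrite [X in _ * X]mxE (negPf cb) mulr0n mulr0.
apply: seriesP; apply: funext => j.
rewrite Defs.coefD Defs.coefN coef_mul_monom1 coef_scalar1 mxE coef_series_sum.
under [X in X - _]eq_bigr => c _ do rewrite [X in _ * X]mxE -PC_central coef_PCM coefYi.
rewrite coefYi; case: j => [[|j]|j].
- rewrite [X in X - _]big1 ?add0r => [|c _]; last by rewrite mulr0.
  rewrite opprK expr0 mxE /=; case: (a == b); last by rewrite rmorph0.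
  by rewrite rmorph1.
- rewrite [X in X - _]big1 => [|c _]; last by rewrite mulr0.
  by rewrite subr0.
- have -> : Negz j - 1 = Negz j.+1 by lia.
  rewrite opprK exprSr mxE rmorph_sum -big_split /=.
  by rewrite big1 // => c _; rewrite rmorphM mulrN crossedC_central addNr.
Qed.

(* The sums [sum_i E_(i + d) eps_i] for [d = 0, 1, -1]; [Xh] raises [d] when moved
   across them and [Yh] lowers it. *)
Definition e0 : 'M[P]_N := \sum_i epsP i *: mc (E i).
Definition e1 : 'M[P]_N := \sum_i epsP i *: mc (E (ordS i)).
Definition em1 : 'M[P]_N := \sum_i epsP (ordS i) *: mc (E i).

Lemma eps_sum_mulr (f g : I -> I) (A : 'M[K]_N) :
  (\sum_i epsP (f i) *: mc (E (g i))) *m mc A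
  = \sum_i epsP (f i) *: mc (E (g i) *m A).
Proof.
by rewrite mulmx_suml; apply: eq_bigr => i _; rewrite -scalemxAl -map_mxM.
Qed.

Lemma eps_sum_mull (f g : I -> I) (A : 'M[K]_N) :
  mc A *m (\sum_i epsP (f i) *: mc (E (g i)))
  = \sum_i epsP (f i) *: mc (A *m E (g i)).
Proof.
by rewrite mulmx_sumr; apply: eq_bigr => i _; rewrite mc_scale -map_mxM.
Qed.

Lemma eps_sum_scalar (f g : I -> I) (a : P) :
  (\sum_i epsP (f i) *: mc (E (g i))) *m a%:M
  = \sum_i (epsP (f i) * a) *: mc (E (g i)).
Proof.
rewrite mulmx_suml; apply: eq_bigr => i _.
by rewrite -scalemxAl mc_scalar scalerA.
Qed.

Lemma scalar_eps_sum (f g : I -> I) (a : P) :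
  a%:M *m (\sum_i epsP (f i) *: mc (E (g i)))
  = \sum_i (a * epsP (f i)) *: mc (E (g i)).
Proof.
rewrite mul_scalar_mx scaler_sumr; apply: eq_bigr => i _.
by rewrite scalerA.
Qed.

Lemma y_e1 : y%:M *m e1 = e0 *m y%:M.
Proof.
rewrite /e1 (scalar_eps_sum id (@ordS n.+1)) (eps_sum_scalar id id).
rewrite -[RHS]sum_ordS.
by apply: eq_bigr => i _; rewrite y_epsP.
Qed.

Lemma y_e0 : y%:M *m e0 = em1 *m y%:M.
Proof.
rewrite (scalar_eps_sum id id) (eps_sum_scalar (@ordS n.+1) id).
by apply: eq_bigr => i _; rewrite y_epsP.
Qed.

Lemma Y_e1 r : mc (totY r) *m e1 = e0 *m mc (totY r).
Proof.
rewrite (eps_sum_mull id (@ordS n.+1)) (eps_sum_mulr id id).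
by apply: eq_bigr => i _; rewrite totY_vertexE.
Qed.

Lemma Y_e0 r : mc (totY r) *m e0 = em1 *m mc (totY r).
Proof.
rewrite (eps_sum_mull id id) (eps_sum_mulr (@ordS n.+1) id).
rewrite -[LHS]sum_ordS.
by apply: eq_bigr => i _; rewrite totY_vertexE.
Qed.

Lemma Xh_e0 r : Xh r *m e0 = e1 *m Xh r.
Proof.
rewrite /Xh mulmxBl mulmxBr (eps_sum_mull id id) (eps_sum_mulr id (@ordS n.+1)).
rewrite (scalar_eps_sum id id) (eps_sum_scalar id (@ordS n.+1)); congr (_ - _).
  by apply: eq_bigr => i _; rewrite totX_vertexE.
rewrite -[LHS]sum_ordS.
by apply: eq_bigr => i _; rewrite epsP_x.
Qed.

Lemma Xh_em1 r : Xh r *m em1 = e0 *m Xh r.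
Proof.
rewrite /Xh mulmxBl mulmxBr (eps_sum_mull (@ordS n.+1) id) (eps_sum_mulr id id).
rewrite (scalar_eps_sum (@ordS n.+1) id) (eps_sum_scalar id id); congr (_ - _).
  rewrite -[RHS]sum_ordS.
  by apply: eq_bigr => i _; rewrite totX_vertexE.
by apply: eq_bigr => i _; rewrite epsP_x.
Qed.

Lemma Yh_e1 r : Yh r *m e1 = e0 *m Yh r.
Proof. by rewrite mulmxBl mulmxBr y_e1 Y_e1. Qed.

Lemma Yh_e0 r : Yh r *m e0 = em1 *m Yh r.
Proof. by rewrite mulmxBl mulmxBr y_e0 Y_e0. Qed.

(** Orthogonality of the idempotents leaves only the terms in which both indices agree. *)
Lemma e0_sandwich (f : I -> I) (A : 'M[K]_N) :
  (\sum_i epsP i *: mc (E (f i))) *m mc A *m e0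
  = \sum_i epsP i *: mc (E (f i) *m A *m E i).
Proof.
rewrite (eps_sum_mulr id f) mulmx_suml; apply: eq_bigr => i _.
rewrite -scalemxAl (eps_sum_mull id id) scaler_sumr [LHS](bigD1 i) //=.
rewrite [X in _ + X]big1 ?addr0 => [|j ji]; rewrite scalerA epsPM.
  by rewrite eqxx.
by rewrite eq_sym (negPf ji) scale0r.
Qed.

Lemma e0_idem : e0 *m e0 = e0.
Proof.
rewrite -{1}[e0]mulmx1 -(map_mx1 PC) (e0_sandwich id).
by apply: eq_bigr => i _; rewrite mulmx1 vertexEM eqxx.
Qed.

(** Between [e1] and [e0] only the blocks from V_i to V_(i+1) survive. The graded derivative of X
    can thus be traded for an ungraded sum of products, which factors. *)
Lemma e1_homog (A : 'M[K]_N) :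
  e1 *m mc (\sum_i E (ordS i) *m A *m E i) = e1 *m mc A *m e0.
Proof.
rewrite (eps_sum_mulr id (@ordS n.+1)) (e0_sandwich (@ordS n.+1)).
apply: eq_bigr => i _; congr (_ *: mc _).
rewrite mulmx_sumr [LHS](bigD1 i) //= [X in _ + X]big1 ?addr0 => [|j ji].
  by rewrite !mulmxA vertexEM eqxx.
rewrite !mulmxA vertexEM (inj_eq (can_inj (@ordSK n.+1))) eq_sym (negPf ji).
by rewrite !mul0mx.
Qed.

Definition We r : 'rV[P]_N := mc (totw r) *m e0.
Definition Ve r : 'cV[P]_N := e0 *m mc (totv r).

Lemma We_e0 r : We r *m e0 = We r.
Proof. by rewrite /We -mulmxA e0_idem. Qed.
Lemma e0_Ve r : e0 *m Ve r = Ve r.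
Proof. by rewrite /Ve mulmxA e0_idem. Qed.

Lemma WeE r : We r = \sum_i epsP i *: mc (extw r i).
Proof.
rewrite /We mulmx_sumr; apply: eq_bigr => i _.
by rewrite mc_scale -map_mxM totw_vertexE.
Qed.

Lemma VeE r : Ve r = \sum_i mc (extv r i) *m (epsP i)%:M.
Proof.
rewrite /Ve mulmx_suml; apply: eq_bigr => i _.
by rewrite -scalemxAl -map_mxM vertexE_totv mc_scalar.
Qed.

(** On the block of [E i], right multiplication by [e0] selects [epsP i]. There xy - yx contributes
    [lam i], opposite to the scalar of the moment equation, and what remains are the diagonal blocks
    kept by [e0_sandwich]. *)
Lemma commXhYh r : cm_moment lam r ->
  (Xh r *m Yh r - Yh r *m Xh r) *m e0 = - (Ve r *m We r).
Proof.
move=> mom.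
have -> : Xh r *m Yh r - Yh r *m Xh r
    = mc (totX r *m totY r - totY r *m totX r)
      + (\sum_i PC (lam i) * epsP i)%:M.
  rewrite /Xh /Yh !mulmxBl !mulmxBr !mc_scalar -!scalar_mxM !mul_scalar_mx.
  rewrite -commutator_xy (raddfB (@scalar_mx P N)) map_mxB !map_mxM !opprB.
  by rewrite [LHS](AC ((2*2)*(2*2)) ((1*8)*(3*6)*(5*2)*(7*4)))%AC /= !subrr !addr0.
rewrite (moment_tot mom) map_mxN mulmxDl mulNmx.
have VW : Ve r *m We r = \sum_i epsP i *: mc (E i *m (totv r *m totw r) *m E i).
  by rewrite -(e0_sandwich id) map_mxM /Ve /We !mulmxA.
have lam_eps j : (\sum_i PC (lam i) * epsP i) * epsP j = epsP j * PC (lam j).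
  rewrite mulr_suml (bigD1 j) //= big1 ?addr0 => [|i ij]; rewrite -mulrA epsPM.
    by rewrite eqxx PC_central.
  by rewrite (negPf ij) mulr0.
have L : (\sum_i PC (lam i) * epsP i)%:M *m e0 = \sum_i epsP i *: mc (lam i *: E i).
  rewrite mul_scalar_mx scaler_sumr; apply: eq_bigr => j _.
  by rewrite scalerA lam_eps map_mxZ scalerA.
have diagE i : (\sum_j (E j *m (totv r *m totw r) *m E j + lam j *: E j)) *m E i
    = E i *m (totv r *m totw r) *m E i + lam i *: E i.
  rewrite mulmx_suml [LHS](bigD1 i) //= [X in _ + X]big1 ?addr0 => [|j ji].
    by rewrite mulmxDl -[_ *m E i *m E i]mulmxA -scalemxAl vertexEM eqxx.
  by rewrite mulmxDl -mulmxA -scalemxAl vertexEM (negPf ji) mulmx0 scaler0 addr0.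
rewrite L VW (eps_sum_mull id id) -sumrN -sumrN -big_split; apply: eq_bigr => i _ /=.
by rewrite diagE map_mxD scalerDr opprD subrK.
Qed.

Lemma comm_inverse (A B e : 'M[P]_N) : A *m B = 1%:M -> B *m A = 1%:M ->
  A *m e = e *m A -> e *m B = B *m e.
Proof.
by move=> AB BA Ae; rewrite -[LHS]mul1mx -BA -mulmxA (mulmxA A) Ae -mulmxA AB mulmx1.
Qed.

(** [Xh] raises the offset between the indices and [Yh] lowers it, so their product commutes with
    [e0]; the inverse of the product inherits this. *)
Lemma e0_XiYi r : e0 *m (Xi r *m Yi r) = Xi r *m Yi r *m e0.
Proof.
apply: (comm_inverse (A := Yh r *m Xh r)).
- by rewrite -mulmxA (mulmxA (Xh r)) XhXi mul1mx YhYi.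
- by rewrite -mulmxA (mulmxA (Yi r)) YiYh mul1mx XiXh.
- by rewrite -mulmxA Xh_e0 mulmxA Yh_e1 mulmxA.
Qed.

Lemma e0_YiXi r : e0 *m (Yi r *m Xi r) = Yi r *m Xi r *m e0.
Proof.
apply: (comm_inverse (A := Xh r *m Yh r)).
- by rewrite -mulmxA (mulmxA (Yh r)) YhYi mul1mx XhXi.
- by rewrite -mulmxA (mulmxA (Xi r)) XiXh mul1mx YiYh.
- by rewrite -mulmxA Yh_e0 mulmxA Xh_em1 mulmxA.
Qed.

Lemma Xi_e1 r : Xi r *m e1 = e0 *m Xi r.
Proof.
by rewrite -[LHS]mulmx1 -(XhXi r) !mulmxA -(mulmxA (Xi r)) -Xh_e0 mulmxA XiXh mul1mx.
Qed.

Definition Mmx r : 'M[P]_1 := dressing (Xi r) (Yi r) (We r) (Ve r).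
Definition Nmx r : 'M[P]_1 := dressing_inv (Xi r) (Yi r) (We r) (Ve r).

Lemma mul_mx11 (A B : 'M[P]_1) : (A *m B) 0 0 = A 0 0 * B 0 0.
Proof. by rewrite mxE big_ord1. Qed.

(** The double sum over i and j is the expansion of a single product, because [We] and [Ve] already
    carry the idempotents next to the maps w_i and v_j. *)
Lemma cm_ME r : cm_M mu_prim tau kappa r = Mmx r 0 0.
Proof.
rewrite /cm_M /Mmx /dressing [RHS]mxE [X in _ = _ + X]mxE [X in _ = X + _]mxE eqxx mulr1n.
congr (1 - _).
have sandwich (a b : P) (A : 'M[P]_1) : (a *: (A *m b%:M)) 0 0 = a * A 0 0 * b.
  by rewrite mxE mul_mx11 mulrA [X in _ * X]mxE eqxx mulr1n.
rewrite WeE VeE !mulmx_suml summxE; apply: eq_bigr => i _.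
rewrite mulmx_sumr summxE; apply: eq_bigr => j _.
by rewrite !mulmxA -!scalemxAl sandwich.
Qed.

Lemma Mmx_mulr r : cm_moment lam r -> Mmx r *m Nmx r = 1%:M.
Proof.
move=> mom; apply: dressing_mulr (XhXi r) (XiXh r) (YhYi r) (YiYh r)
  (commXhYh mom) (e0_Ve r) (e0_YiXi r).
Qed.

Lemma Mmx_mull r : cm_moment lam r -> Nmx r *m Mmx r = 1%:M.
Proof.
move=> mom; apply: dressing_mull (XhXi r) (XiXh r) (YhYi r) (YiYh r)
  (commXhYh mom) (e0_Ve r) (e0_XiYi r).
Qed.

Lemma cm_M_inv r : cm_moment lam r ->
  cm_M mu_prim tau kappa r \is a GRing.unit /\
  (cm_M mu_prim tau kappa r)^-1 = Nmx r 0 0.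
Proof.
move=> mom; rewrite cm_ME.
have MN : Mmx r 0 0 * Nmx r 0 0 = 1 by rewrite -mul_mx11 Mmx_mulr // mxE.
have NM : Nmx r 0 0 * Mmx r 0 0 = 1 by rewrite -mul_mx11 Mmx_mull // mxE.
have U : Mmx r 0 0 \is a GRing.unit by apply/unitrP; exists (Nmx r 0 0).
by split=> //; rewrite -[RHS]mulr1 -(mulrV U) mulrA NM mul1r.
Qed.

End SeriesMatrices.

(** * Gauge invariance and degrees *)

Section GaugeInvariance.
Variables (K : numFieldType) (n : nat) (mu : K).
Hypothesis mu_prim : n.+1.-primitive_root mu.
Variables (tau : K) (kappa : 'I_n.+1 -> K) (alpha : 'I_n.+1 -> nat).
Local Notation P := (Pring mu_prim tau kappa).
Local Notation N := (\sum_i alpha i)%N.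
Local Notation PC := (PC mu_prim tau kappa).
Local Notation mc := (map_mx PC).
Local Notation e0 := (e0 mu_prim tau kappa alpha).
Local Notation Xh := (Xh mu_prim tau kappa).
Local Notation Yh := (Yh mu_prim tau kappa).
Local Notation Xi := (Xi mu_prim tau kappa).
Local Notation Yi := (resY mu_prim tau kappa).
Local Notation We := (We mu_prim tau kappa).
Local Notation Ve := (Ve mu_prim tau kappa).
Implicit Types (r : cm_rep K alpha).

Lemma mc_comm p q (B : 'M[K]_(p, q)) (a : P) : mc B *m a%:M = a%:M *m mc B.
Proof. by rewrite mc_scalar mul_scalar_mx. Qed.

Lemma mulmx_inv_unique q (A B C : 'M[P]_q) : A *m B = 1%:M -> C *m A = 1%:M -> B = C.
Proof. by move=> AB CA; rewrite -[B]mul1mx -CA -mulmxA AB mulmx1. Qed.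

(** The block diagonal matrix [G] has central entries and commutes with [e0], so [Xh] and [Yh] are
    conjugated by it. The resolvents follow by uniqueness of inverses, and all copies of [G]
    cancel. *)
Lemma cm_M_gl_act g r : gl_elt g ->
  cm_M mu_prim tau kappa (gl_act g r) = cm_M mu_prim tau kappa r.
Proof.
move=> gU; rewrite !cm_ME; congr ((_ : 'M[P]_1) 0 0).
pose gV i := invmx (g i).
pose G := mc (gauge g); pose H := mc (gauge gV).
have GH : G *m H = 1%:M.
  rewrite -map_mxM gaugeM -(map_mx1 PC) -gauge1; congr (mc _).
  by apply: eq_bigr => i _; rewrite mulmxV.
have HG : H *m G = 1%:M.
  rewrite -map_mxM gaugeM -(map_mx1 PC) -gauge1; congr (mc _).
  by apply: eq_bigr => i _; rewrite mulVmx.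
have e0G f : mc (gauge f) *m e0 = e0 *m mc (gauge f).
  rewrite (eps_sum_mull _ _ _ id id) (eps_sum_mulr _ _ _ id id).
  by apply: eq_bigr => i _; rewrite gauge_vertexE.
have conj_scalar (a : P) : a%:M = G *m a%:M *m H.
  by rewrite mc_comm -mulmxA GH mulmx1.
have XhG : Xh (gl_act g r) = G *m Xh r *m H.
  rewrite /Xh totX_gl_act mulmxBr mulmxBl -(conj_scalar (PF mu_prim tau kappa (xF K))).
  by rewrite !map_mxM.
have YhG : Yh (gl_act g r) = G *m Yh r *m H.
  rewrite /Yh totY_gl_act mulmxBr mulmxBl -(conj_scalar (yP mu_prim tau kappa)).
  by rewrite !map_mxM.
have XiG : Xi (gl_act g r) = G *m Xi r *m H.
  apply/esym/mulmx_inv_unique; last exact: XiXh.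
  rewrite XhG -!mulmxA (mulmxA H G) HG mul1mx (mulmxA (Xh r)) XhXi mul1mx.
  exact: GH.
have YiG : Yi (gl_act g r) = G *m Yi r *m H.
  apply/esym/mulmx_inv_unique; last exact: YiYh.
  rewrite YhG -!mulmxA (mulmxA H G) HG mul1mx (mulmxA (Yh r)) YhYi mul1mx.
  exact: GH.
have WG : We (gl_act g r) = We r *m H.
  by rewrite /We totw_gl_act map_mxM -mulmxA e0G mulmxA.
have VG : Ve (gl_act g r) = G *m Ve r.
  by rewrite /Ve totv_gl_act map_mxM mulmxA -e0G mulmxA.
rewrite /Mmx /dressing XiG YiG WG VG; congr (1%:M - _).
by rewrite -!mulmxA !(mulmxA H G) HG !mul1mx.
Qed.

End GaugeInvariance.

(** * Degrees in y of matrices of series, and powers of Y y^-1 *)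

Section Degrees.
Variables (K : numFieldType) (n : nat) (mu : K).
Hypothesis mu_prim : n.+1.-primitive_root mu.
Variables (tau : K) (kappa : 'I_n.+1 -> K) (alpha : 'I_n.+1 -> nat).
Local Notation P := (Pring mu_prim tau kappa).
Local Notation N := (\sum_i alpha i)%N.
Local Notation y := (yP mu_prim tau kappa).
Local Notation yV := (monom (P_data mu_prim tau kappa) 1 (- 1)).
Local Notation PC := (PC mu_prim tau kappa).
Local Notation PF := (PF mu_prim tau kappa).
Local Notation epsP := (epsP mu_prim tau kappa).
Local Notation mc := (map_mx PC).
Local Notation e0 := (e0 mu_prim tau kappa alpha).
Local Notation e1 := (e1 mu_prim tau kappa alpha).
Local Notation Yi := (resY mu_prim tau kappa).
Local Notation We := (We mu_prim tau kappa).
Local Notation Ve := (Ve mu_prim tau kappa).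
Implicit Types (r : cm_rep K alpha).

(** Inserting y^-1 y moves one degree from the right factor to the left one, which reduces this to
    [negative_seriesM]. *)
Lemma bnd0M_negative (S T : P) : bnd 0 S -> negative_series T -> negative_series (S * T).
Proof.
move=> S0 T0; have -> : S * T = S * yV * (y * T).
  by rewrite -mulrA (mulrA yV) yKV mul1r.
apply: negative_seriesM.
  by move=> j j0; rewrite coef_mul_monom1 S0 //; lia.
by move=> j j0; rewrite coef_yM /ymul !T0 ?raddf0 ?addr0 //; lia.
Qed.

Definition nonneg_mx p q (A : 'M[P]_(p, q)) := forall i j, nonneg_series (A i j).
Definition bnd0_mx p q (A : 'M[P]_(p, q)) := forall i j, bnd 0 (A i j).
Definition negative_mx p q (A : 'M[P]_(p, q)) := forall i j, negative_series (A i j).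

Lemma nonneg_mxM p q s (A : 'M[P]_(p, q)) (B : 'M[P]_(q, s)) :
  nonneg_mx A -> nonneg_mx B -> nonneg_mx (A *m B).
Proof.
move=> A0 B0 i j; rewrite mxE; apply: nonneg_series_sum => k.
exact: nonneg_seriesM.
Qed.

Lemma nonneg_mxD p q (A B : 'M[P]_(p, q)) :
  nonneg_mx A -> nonneg_mx B -> nonneg_mx (A + B).
Proof. by move=> A0 B0 i j; rewrite mxE; apply: nonneg_seriesD. Qed.

Lemma nonneg_mxN p q (A : 'M[P]_(p, q)) : nonneg_mx A -> nonneg_mx (- A).
Proof. by move=> A0 i j; rewrite mxE; apply: nonneg_seriesN. Qed.

Lemma nonneg_mx_sum p q (J : Type) (s : seq J) (Q : pred J) (h : J -> 'M[P]_(p, q)) :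
  (forall i, Q i -> nonneg_mx (h i)) -> nonneg_mx (\sum_(i <- s | Q i) h i).
Proof.
move=> h0; elim/big_ind: _ => // [i j|A B]; last exact: nonneg_mxD.
by rewrite mxE.
Qed.

Lemma nonneg_series1 : nonneg_series (1 : P).
Proof. exact: nonneg_series_monom. Qed.

Lemma nonneg_series_exp k : nonneg_series (y ^+ k).
Proof.
elim: k => [|k IHk]; first exact: nonneg_series1.
by rewrite exprS; apply: nonneg_seriesM => //; exact: nonneg_series_monom.
Qed.

Lemma nonneg_scalar_mx q (a : P) : nonneg_series a -> nonneg_mx (a%:M : 'M_q).
Proof. by move=> a0 i j; rewrite mxE; case: (i == j); rewrite ?mulr1n ?mulr0n. Qed.

Lemma nonneg_mx_mapPF p q (A : 'M_(p, q)) : nonneg_mx (map_mx PF A).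
Proof. by move=> i j; rewrite mxE; exact: nonneg_series_monom. Qed.

Lemma nonneg_mx_mc p q (A : 'M_(p, q)) : nonneg_mx (mc A).
Proof. by move=> i j; rewrite mxE; exact: nonneg_series_monom. Qed.

Lemma bnd0D (S T : P) : bnd 0 S -> bnd 0 T -> bnd 0 (S + T).
Proof. by move=> S0 T0 j j0; rewrite Defs.coefD S0 ?T0 ?addr0. Qed.

Lemma bnd0_mxM p q s (A : 'M[P]_(p, q)) (B : 'M[P]_(q, s)) :
  bnd0_mx A -> bnd0_mx B -> bnd0_mx (A *m B).
Proof.
move=> A0 B0 i j; rewrite mxE; elim/big_ind: _ => // [S T|k _]; first exact: bnd0D.
exact: bnd0M.
Qed.

Lemma negative_mxMl p q s (A : 'M[P]_(p, q)) (B : 'M[P]_(q, s)) :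
  negative_mx A -> bnd0_mx B -> negative_mx (A *m B).
Proof.
move=> A0 B0 i j k k0; rewrite mxE coef_series_sum big1 // => l _.
by apply: negative_seriesM => //.
Qed.

Lemma negative_mxMr p q s (A : 'M[P]_(p, q)) (B : 'M[P]_(q, s)) :
  bnd0_mx A -> negative_mx B -> negative_mx (A *m B).
Proof.
move=> A0 B0 i j k k0; rewrite mxE coef_series_sum big1 // => l _.
by apply: bnd0M_negative => //.
Qed.

Lemma negative_mxB p q (A B : 'M[P]_(p, q)) :
  negative_mx A -> negative_mx B -> negative_mx (A - B).
Proof. by move=> A0 B0 i j k k0; rewrite !mxE Defs.coefD Defs.coefN A0 ?B0 ?subr0. Qed.

Lemma negative_mxN p q (A : 'M[P]_(p, q)) : negative_mx A -> negative_mx (- A).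
Proof. by move=> A0 i j k k0; rewrite !mxE Defs.coefN A0 ?oppr0. Qed.

Lemma bnd0_monom a : bnd 0 (monom (P_data mu_prim tau kappa) a 0).
Proof. exact: (@bnd_delta _ _ 0). Qed.

Lemma bnd0_mx_mapPF p q (A : 'M_(p, q)) : bnd0_mx (map_mx PF A).
Proof. by move=> i j; rewrite mxE; exact: bnd0_monom. Qed.

Lemma bnd0_mx_mc p q (A : 'M_(p, q)) : bnd0_mx (mc A).
Proof. by move=> i j; rewrite mxE; exact: bnd0_monom. Qed.

Lemma negative_Yi r : negative_mx (Yi r).
Proof. by move=> a b [] // k _; rewrite mxE. Qed.

Lemma bnd0_e0 : bnd0_mx e0.
Proof.
move=> a b; rewrite summxE; apply: (big_ind (fun S : P => bnd 0 S)) => // [S T|k _].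
  exact: bnd0D.
by rewrite !mxE; apply: bnd0M; exact: bnd0_monom.
Qed.

Lemma nonneg_e0 : nonneg_mx e0.
Proof.
move=> a b; rewrite summxE; apply: nonneg_series_sum => k.
by rewrite !mxE; apply: nonneg_seriesM; exact: nonneg_series_monom.
Qed.

Lemma y_exp_epsP k i : y ^+ k * epsP i = epsP (iter k (@ordS n.+1) i) * y ^+ k.
Proof.
elim: k i => [|k IHk] i; first by rewrite mul1r mulr1.
by rewrite exprSr -mulrA y_epsP mulrA IHk -mulrA iterSr.
Qed.

Lemma yV_exp_epsP k i : yV ^+ k * epsP i = epsP (iter k (@ord_pred n.+1) i) * yV ^+ k.
Proof.
elim: k i => [|k IHk] i; first by rewrite mul1r mulr1.
have yVe : yV * epsP i = epsP (ord_pred i) * yV.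
  have := y_epsP mu_prim tau kappa (ord_pred i); rewrite ord_predK => ye.
  by rewrite -[LHS]mulr1 -yVK -mulrA (mulrA (epsP i)) -ye !mulrA yKV mul1r.
by rewrite exprSr -mulrA yVe mulrA IHk -mulrA iterSr.
Qed.

Lemma yVK_exp k : y ^+ k * yV ^+ k = 1.
Proof.
elim: k => [|k IHk]; first by rewrite mulr1.
by rewrite exprSr exprS -mulrA (mulrA y) yVK mul1r.
Qed.

Lemma yKV_exp k : yV ^+ k * y ^+ k = 1.
Proof.
elim: k => [|k IHk]; first by rewrite mulr1.
by rewrite exprSr exprS -mulrA (mulrA yV) yKV mul1r.
Qed.

(** Powers of y pass through the idempotents by permuting them and commute with constants, so the
    outer powers cancel exactly. *)
Lemma nonneg_conj_We k r :
  nonneg_mx ((y ^+ k)%:M *m We r *m (yV ^+ k)%:M).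
Proof.
rewrite WeE mulmx_sumr mulmx_suml; apply: nonneg_mx_sum => i _.
rewrite mul_scalar_mx scalerA y_exp_epsP -scalemxAl mc_scalar scalerA.
rewrite -mulrA yVK_exp mulr1 => a b; rewrite !mxE.
by apply: nonneg_seriesM; exact: nonneg_series_monom.
Qed.

Lemma nonneg_conj_Ve k r :
  nonneg_mx ((yV ^+ k)%:M *m Ve r *m (y ^+ k)%:M).
Proof.
rewrite VeE mulmx_sumr mulmx_suml; apply: nonneg_mx_sum => i _.
rewrite mc_scalar mul_scalar_mx scalerA yV_exp_epsP -scalemxAl mc_scalar scalerA.
rewrite -mulrA yKV_exp mulr1 => a b; rewrite !mxE.
by apply: nonneg_seriesM; exact: nonneg_series_monom.
Qed.

(** Y turns [e1] into [e0] and y^-1 turns [e0] into [e1]; the combination commutes with [e0] and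
    with y, which Y and y^-1 separately do not both do. *)
Definition Tmx r : 'M[P]_N := mc (totY r) *m yV%:M.

Lemma Tmx_exp r k : Tmx r ^+ k = mc (totY r ^+ k) *m (yV ^+ k)%:M.
Proof.
elim: k => [|k IHk]; first by rewrite !expr0 mulmx1 -[1]/(1%:M) map_mx1.
rewrite !exprSr -mulmxE IHk map_mxM scalar_mxM -!mulmxA; congr (_ *m _).
have yVkY : (yV ^+ k)%:M *m mc (totY r) = mc (totY r) *m (yV ^+ k)%:M.
  by rewrite mc_comm.
by rewrite /Tmx [LHS]mulmxA yVkY -mulmxA.
Qed.

Lemma mcY_exp r k : mc (totY r ^+ k) = Tmx r ^+ k *m (y ^+ k)%:M.
Proof. by rewrite Tmx_exp -mulmxA -scalar_mxM yKV_exp mulmx1. Qed.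

Lemma Tmx_scalar r k : Tmx r *m (y ^+ k)%:M = (y ^+ k)%:M *m Tmx r.
Proof.
rewrite /Tmx -mulmxA -scalar_mxM [RHS]mulmxA -mc_comm -[RHS]mulmxA -scalar_mxM.
have -> // : yV * y ^+ k = y ^+ k * yV.
case: k => [|k]; first by rewrite mulr1 mul1r.
by rewrite [in LHS]exprS mulrA yKV mul1r exprSr -mulrA yVK mulr1.
Qed.

Lemma Yh_Tmx r : Yh mu_prim tau kappa r = y%:M *m (Tmx r - 1%:M).
Proof.
rewrite mulmxBr mulmx1 /Tmx [y%:M *m _]mulmxA -mc_comm -mulmxA -scalar_mxM yVK.
by rewrite mulmx1.
Qed.

Lemma Tmx_e0 r k : Tmx r ^+ k *m e0 = e0 *m Tmx r ^+ k.
Proof.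
have Te : Tmx r *m e0 = e0 *m Tmx r.
  have -> : Tmx r *m e0 = mc (totY r) *m e1 *m yV%:M.
    have -> : e0 = y%:M *m e1 *m yV%:M.
      by rewrite y_e1 -mulmxA -scalar_mxM yVK mulmx1.
    rewrite /Tmx -!mulmxA [yV%:M *m _]mulmxA -scalar_mxM yKV mul1mx.
    by [].
  by rewrite Y_e1 -mulmxA.
elim: k => [|k IHk]; first by rewrite expr0 mulmx1 mul1mx.
by rewrite exprS -mulmxE -mulmxA IHk mulmxA Te -mulmxA.
Qed.

End Degrees.

(** * The polynomial part along the flow *)

Section Flow.
Variables (K : numFieldType) (n : nat) (mu : K).
Hypothesis mu_prim : n.+1.-primitive_root mu.
Variables (tau : K) (kappa : 'I_n.+1 -> K) (alpha : 'I_n.+1 -> nat).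
Local Notation P := (Pring mu_prim tau kappa).
Local Notation N := (\sum_i alpha i)%N.
Local Notation y := (yP mu_prim tau kappa).
Local Notation yV := (monom (P_data mu_prim tau kappa) 1 (- 1)).
Local Notation PC := (PC mu_prim tau kappa).
Local Notation mc := (map_mx PC).
Local Notation E := (vertexE K alpha).
Local Notation e0 := (e0 mu_prim tau kappa alpha).
Local Notation e1 := (e1 mu_prim tau kappa alpha).
Local Notation Xh := (Xh mu_prim tau kappa).
Local Notation Yh := (Yh mu_prim tau kappa).
Local Notation Xi := (Xi mu_prim tau kappa).
Local Notation Yi := (resY mu_prim tau kappa).
Local Notation We := (We mu_prim tau kappa).
Local Notation Ve := (Ve mu_prim tau kappa).
Local Notation T := (Tmx mu_prim tau kappa).
Local Notation yk k := ((y ^+ k)%:M).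
Implicit Types (r : cm_rep K alpha).

Lemma yk_split q m k : (m <= k)%N -> yk k = yk m *m yk (k - m) :> 'M[P]_q.
Proof. by move=> mk; rewrite -scalar_mxM -exprD subnKC. Qed.

Lemma yk_splitr q m k : (m <= k)%N -> yk k = yk (k - m) *m yk m :> 'M[P]_q.
Proof. by move=> mk; rewrite -scalar_mxM -exprD subnK. Qed.

Lemma Tmx_exp_scalar r k l : T r ^+ k *m yk l = yk l *m T r ^+ k.
Proof.
elim: k => [|k IHk]; first by rewrite expr0 mulmx1 mul1mx.
by rewrite exprSr -mulmxE -mulmxA Tmx_scalar mulmxA IHk -mulmxA.
Qed.

Lemma flow_We r k : mc (totw r *m totY r ^+ k) *m e0 = yk k *m We r *m T r ^+ k.
Proof.
rewrite map_mxM -mulmxA mcY_exp Tmx_exp_scalar -mulmxA Tmx_e0 !mulmxA mc_comm.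
by rewrite /We -!mulmxA.
Qed.

Lemma flow_Ve r k : e0 *m mc (totY r ^+ k *m totv r) = T r ^+ k *m Ve r *m yk k.
Proof.
rewrite map_mxM mulmxA mcY_exp mulmxA -Tmx_e0 -[LHS]mulmxA -mc_comm.
by rewrite /Ve !mulmxA.
Qed.

(** The projectors select from [totv r *m totw r] exactly the products v_l w_(l-k): Y lowers the
    index by one, and the remaining map must go from V_i to V_(i+1). *)
Definition flowX r k : 'M[K]_N := \sum_i E (ordS i)
  *m (- \sum_(p < k) totY r ^+ p *m totv r *m totw r *m totY r ^+ (k - p.+1))
  *m E i.

(** Writing [e1] as y^-1 [e0] y, the side of V yields y^(p+1) and the side of W yields y^(k-p-1);
    they join to the single y^k in the middle. *)
Lemma flow_Xe r k : e1 *m mc (flowX r k) =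
  - \sum_(p < k) yV%:M *m T r ^+ p *m Ve r *m yk k *m We r *m T r ^+ (k - p.+1).
Proof.
rewrite e1_homog map_mxN mulmxN mulNmx; congr (- _).
have mc_sum (F : 'I_k -> 'M[K]_N) : mc (\sum_p F p) = \sum_p mc (F p).
  exact: raddf_sum.
rewrite mc_sum [e1 *m \sum_p _]mulmx_sumr [LHS]mulmx_suml; apply: eq_bigr => p _.
have e1Y : e1 *m mc (totY r ^+ p *m totv r)
    = yV%:M *m T r ^+ p *m Ve r *m yk p.+1.
  have -> : e1 = yV%:M *m e0 *m y%:M.
    by rewrite -mulmxA -y_e1 mulmxA -scalar_mxM yKV mul1mx.
  rewrite -mulmxA -mc_comm mulmxA -(mulmxA _ e0) flow_Ve exprSr scalar_mxM.
  by rewrite !mulmxA.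
rewrite -(mulmxA _ (totw r)) map_mxM mulmxA e1Y -[LHS]mulmxA flow_We.
by rewrite (yk_split 1 (ltn_ord p)) !mulmxA.
Qed.

(** The a-th term is y^(k-a-1) (y^(a+1) W y^-(a+1)) Y^a; its first exponent is non-negative because
    a < q and q is at most k. *)
Lemma nonneg_W_geom r k q : (q <= k)%N ->
  nonneg_mx (yk k *m We r *m geom yV%:M (T r) q).
Proof.
move=> qk; have -> : yk k *m We r *m geom yV%:M (T r) q
    = \sum_(a < q) yk k *m We r *m (yV%:M *m T r ^+ a).
  by rewrite -[RHS]mulmx_sumr -mulmx_sumr.
apply: nonneg_mx_sum => a _.
have ak : (a < k)%N by exact: leq_trans (ltn_ord a) qk.
have -> : yk k *m We r *m (yV%:M *m T r ^+ a)
    = yk (k - a.+1) *m (yk a.+1 *m We r *m (yV ^+ a.+1)%:M) *m mc (totY r ^+ a).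
  have -> : yV%:M *m T r ^+ a = (yV ^+ a.+1)%:M *m mc (totY r ^+ a).
    by rewrite Tmx_exp mc_comm mulmxA -scalar_mxM -exprS.
  by rewrite (yk_splitr 1 ak) !mulmxA.
apply: nonneg_mxM; last exact: nonneg_mx_mc.
apply: nonneg_mxM; last exact: nonneg_conj_We.
by apply: nonneg_scalar_mx; exact: nonneg_series_exp.
Qed.

(** Mirror image of the estimate for W: the expression is Y^p (y^-(p+1) V y^(p+1)) y^(k-p-1). *)
Lemma nonneg_T_V r k p : (p < k)%N ->
  nonneg_mx (yV%:M *m T r ^+ p *m Ve r *m yk k).
Proof.
move=> pk.
have -> : yV%:M *m T r ^+ p *m Ve r *m yk k
    = mc (totY r ^+ p) *m ((yV ^+ p.+1)%:M *m Ve r *m yk p.+1) *m yk (k - p.+1).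
  have -> : yV%:M *m T r ^+ p = mc (totY r ^+ p) *m (yV ^+ p.+1)%:M.
    by rewrite Tmx_exp mulmxA -mc_comm -mulmxA -scalar_mxM -exprS.
  by rewrite (yk_split 1 pk) !mulmxA.
apply: nonneg_mxM; last by apply: nonneg_scalar_mx; exact: nonneg_series_exp.
by apply: nonneg_mxM; [exact: nonneg_mx_mc|exact: nonneg_conj_Ve].
Qed.

Definition lax_mx r k : 'M[P]_1 := lax_part (Xi r) (We r) (Ve r) yV%:M (T r) (yk k) k.

Lemma nonneg_We r : nonneg_mx (We r).
Proof. by apply: nonneg_mxM; [exact: nonneg_mx_mc|exact: nonneg_e0]. Qed.

Lemma nonneg_XiVe r : nonneg_mx (Xi r *m Ve r).
Proof.
apply: nonneg_mxM; first exact: nonneg_mx_mapPF.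
by apply: nonneg_mxM; [exact: nonneg_e0|exact: nonneg_mx_mc].
Qed.

Lemma nonneg_WeXi r : nonneg_mx (We r *m Xi r).
Proof. by apply: nonneg_mxM; [exact: nonneg_We|exact: nonneg_mx_mapPF]. Qed.

Lemma nonneg_lax_mx r k : nonneg_mx (lax_mx r k).
Proof.
rewrite /lax_mx /lax_part.
apply: nonneg_mxD; [apply: nonneg_mxD; [apply: nonneg_mxD|]|].
- by apply: nonneg_scalar_mx; exact: nonneg_series_exp.
- by apply/nonneg_mxN/nonneg_mxM; [exact: nonneg_W_geom|exact: nonneg_XiVe].
- rewrite mulmx_geom.
  apply: nonneg_mxM; [exact: nonneg_WeXi|apply: nonneg_mx_sum => p _].
  exact: nonneg_T_V.
- apply/nonneg_mxN/nonneg_mx_sum => p _.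
  (* The middle y^k has to serve both sides: p + 1 of its factors make the part with V non-negative,
     and the other k - p - 1 the part with W. *)
  have -> : We r *m Xi r *m (yV%:M *m T r ^+ p *m Ve r *m yk k) *m
        (We r *m geom yV%:M (T r) (k - p.+1) *m (Xi r *m Ve r))
    = We r *m Xi r *m (yV%:M *m T r ^+ p *m Ve r *m yk p.+1) *m
       (yk (k - p.+1) *m We r *m geom yV%:M (T r) (k - p.+1) *m (Xi r *m Ve r)).
    by rewrite (yk_split 1 (ltn_ord p)) !mulmxA.
  apply: nonneg_mxM; apply: nonneg_mxM.
  - exact: nonneg_WeXi.
  - exact: nonneg_T_V.
  - exact: nonneg_W_geom.
  - exact: nonneg_XiVe.
Qed.

Definition dMmx r k : 'M[P]_1 := ddressing (Xi r) (Yi r) (We r) (Ve r) (T r)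
  (mc (flowX r k)) (yk k) k.

(** Here y^k has been absorbed again into w Y^k and Y^k v, so the factors besides [Yi r] have degree
    at most 0. This is also the form that differentiation produces. *)
Lemma dMmxE r k : dMmx r k =
  - (mc (totw r *m totY r ^+ k) *m e0 *m (Xi r *m Yi r *m Ve r)
     - We r *m (Xi r *m mc (flowX r k)) *m (Xi r *m Yi r *m Ve r)
     - We r *m (Xi r *m Yi r) *m (e0 *m mc (totY r ^+ k *m totv r))).
Proof. by rewrite flow_We flow_Ve. Qed.

Lemma dMmx_lax_mx r k : cm_moment (cm_lambda tau kappa) r ->
  dMmx r k + Mmx mu_prim tau kappa r *m yk k = lax_mx r k *m Mmx mu_prim tau kappa r.
Proof.
move=> mom; apply: (@ddressingE P N (Xh r) (Yh r) (Xi r) (Yi r) e0 (We r) (Ve r)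
  _ _ _ _ _ _ _ _ y%:M yV%:M (T r) _ _ _ _ e1).
- exact: XhXi.
- exact: XiXh.
- exact: YhYi.
- exact: YiYh.
- exact: commXhYh.
- exact: We_e0.
- exact: e0_Ve.
- exact: e0_XiYi.
- by rewrite -scalar_mxM yVK.
- by rewrite -scalar_mxM yKV.
- exact: Yh_Tmx.
- exact: (Tmx_scalar _ _ _ r 1).
- exact: Xi_e1.
- exact: flow_Xe.
Qed.

Lemma bnd0_We r : bnd0_mx (We r).
Proof. by apply: bnd0_mxM; [exact: bnd0_mx_mc|exact: bnd0_e0]. Qed.

Lemma bnd0_Ve r : bnd0_mx (Ve r).
Proof. by apply: bnd0_mxM; [exact: bnd0_e0|exact: bnd0_mx_mc]. Qed.

Lemma negative_XiYi r : negative_mx (Xi r *m Yi r).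
Proof. by apply: negative_mxMr; [exact: bnd0_mx_mapPF|exact: negative_Yi]. Qed.

(** Each summand contains [Yi r], of negative degree, among factors of degree at most 0. *)
Lemma negative_dMmx r k : negative_mx (dMmx r k).
Proof.
have negu : negative_mx (Xi r *m Yi r *m Ve r).
  by apply: negative_mxMl; [exact: negative_XiYi|exact: bnd0_Ve].
rewrite dMmxE; apply/negative_mxN/negative_mxB; first apply/negative_mxB.
- apply: negative_mxMr; last exact: negu.
  by apply: bnd0_mxM; [exact: bnd0_mx_mc|exact: bnd0_e0].
- apply: negative_mxMr; last exact: negu.
  apply: bnd0_mxM; first exact: bnd0_We.
  by apply: bnd0_mxM; [exact: bnd0_mx_mapPF|exact: bnd0_mx_mc].
- apply: negative_mxMl.
    by apply: negative_mxMr; [exact: bnd0_We|exact: negative_XiYi].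
  by apply: bnd0_mxM; [exact: bnd0_e0|exact: bnd0_mx_mc].
Qed.

Lemma bnd0_Nmx r : bnd0_mx (Nmx mu_prim tau kappa r).
Proof.
have negYX : negative_mx (Yi r *m Xi r).
  by apply: negative_mxMl; [exact: negative_Yi|exact: bnd0_mx_mapPF].
have neg : negative_mx (We r *m (Yi r *m Xi r) *m Ve r).
  apply: negative_mxMl; last exact: bnd0_Ve.
  by apply: negative_mxMr; [exact: bnd0_We|exact: negYX].
move=> i j; rewrite mxE; apply: bnd0D; last exact: negative_series_bnd.
by rewrite mxE; case: (i == j); [exact: bnd0_monom|].
Qed.

End Flow.

(** * Poisson brackets *)

Section ScalarMatrixCurves.
Variable K : numFieldType.

Definition kmx_is_derive p q (S : K -> 'M[K]_(p, q)) (t : K) (S' : 'M[K]_(p, q)) :=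
  forall i j, is_derive t 1 (fun s => S s i j) (S' i j).

Lemma kmx_is_derive_eq p q (S : K -> 'M[K]_(p, q)) (t : K) (S' T' : 'M[K]_(p, q)) :
  kmx_is_derive S t S' -> S' = T' -> kmx_is_derive S t T'.
Proof. by move=> ? <-. Qed.

Lemma kmx_is_derive_cst p q (C : 'M[K]_(p, q)) (t : K) : kmx_is_derive (fun=> C) t 0.
Proof. by move=> i j; rewrite mxE; exact: is_derive_fct_cst. Qed.

Lemma kmx_is_deriveM p q s (S : K -> 'M[K]_(p, q)) (T : K -> 'M[K]_(q, s)) (t : K)
    (S' : 'M[K]_(p, q)) (T' : 'M[K]_(q, s)) :
  kmx_is_derive S t S' -> kmx_is_derive T t T' ->
  kmx_is_derive (fun u => S u *m T u) t (S' *m T t + S t *m T').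
Proof.
move=> dS dT i j; rewrite !mxE -big_split /=; under eq_fun do rewrite mxE.
by apply: is_derive_fct_sum => l; exact: is_derive_fctM.
Qed.

Lemma kmx_is_derive_sum p q (J : Type) (r : seq J) (Q : pred J)
    (h : J -> K -> 'M[K]_(p, q)) (h' : J -> 'M[K]_(p, q)) (t : K) :
  (forall j, kmx_is_derive (h j) t (h' j)) ->
  kmx_is_derive (fun u => \sum_(j <- r | Q j) h j u) t (\sum_(j <- r | Q j) h' j).
Proof.
move=> dh a b; rewrite summxE; under eq_fun do rewrite summxE.
by apply: is_derive_fct_sum => j; exact: dh.
Qed.

Lemma kmx_is_derive_mull p q s (C : 'M[K]_(p, q)) (T : K -> 'M[K]_(q, s)) (t : K)
    (T' : 'M[K]_(q, s)) :
  kmx_is_derive T t T' -> kmx_is_derive (fun u => C *m T u) t (C *m T').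
Proof.
move=> dT; apply: kmx_is_derive_eq (kmx_is_deriveM (kmx_is_derive_cst C t) dT) _.
by rewrite mul0mx add0r.
Qed.

Lemma kmx_is_derive_mulr p q s (S : K -> 'M[K]_(p, q)) (C : 'M[K]_(q, s)) (t : K)
    (S' : 'M[K]_(p, q)) :
  kmx_is_derive S t S' -> kmx_is_derive (fun u => S u *m C) t (S' *m C).
Proof.
move=> dS; apply: kmx_is_derive_eq (kmx_is_deriveM dS (kmx_is_derive_cst C t)) _.
by rewrite mulmx0 addr0.
Qed.

Lemma kmx_is_deriveX p (S : K -> 'M[K]_p) (t : K) (S' : 'M[K]_p) k :
  kmx_is_derive S t S' ->
  kmx_is_derive (fun u => S u ^+ k) t
    (\sum_(a < k) S t ^+ a *m S' *m S t ^+ (k - a.+1)).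
Proof.
move=> dS; elim: k => [|k IHk].
  by rewrite big_ord0; under eq_fun do rewrite expr0; exact: kmx_is_derive_cst.
under eq_fun do rewrite exprSr -mulmxE.
apply: kmx_is_derive_eq (kmx_is_deriveM IHk dS) _.
rewrite big_ord_recr /= subnn expr0 mulmx1; congr (_ + _).
rewrite mulmx_suml; apply: eq_bigr => a _.
by rewrite subSn // exprSr -mulmxE !mulmxA.
Qed.

Lemma kmx_is_derive_line p q (A B : 'M[K]_(p, q)) :
  kmx_is_derive (fun h => A + h *: B) 0 B.
Proof.
move=> i j; under eq_fun do rewrite !mxE.
apply: is_derive_eq (is_derive_fctD (is_derive_fct_cst _ _)
  (is_derive_fctM (is_derive_id _ _) (is_derive_fct_cst _ _))) _.
by rewrite mul1r mulr0 addr0 add0r.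
Qed.

Lemma derive1_is_derive (f : K -> K) (t f' : K) : is_derive t 1 f f' -> derive1 f t = f'.
Proof. by move=> df; rewrite derive1E; exact: derive_val. Qed.

End ScalarMatrixCurves.

(** * Partial derivatives and brackets of the Hamiltonians *)

Section Partials.
Variables (K : numFieldType) (n : nat) (alpha : 'I_n.+1 -> nat).
Local Notation I := 'I_n.+1.
Local Notation N := (\sum_i alpha i)%N.
Local Notation incl := (inclV K alpha).
Local Notation proj := (projV K alpha).
Implicit Types (r : cm_rep K alpha).

(** Perturbing one arrow perturbs the matrix on V by its extension by zero; stated for additive maps
    so as to serve Y, v and w alike. *)
Lemma sum_dfwith (T : I -> zmodType) (V : zmodType) (g : forall i, T i -> V)
    (gD : forall i, {morph g i : x z / x + z}) (f : forall i, T i) i (d : T i) :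
  \sum_j g j (dfwith f (f i + d) j) = \sum_j g j (f j) + g i d.
Proof.
rewrite (bigD1 i) //= [in RHS](bigD1 i) //= dfwith_in gD addrAC; congr (_ + _ + _).
by apply: eq_bigr => j ji; rewrite dfwith_out // eq_sym.
Qed.

Lemma totY_setY r i (D : 'M[K]_(alpha i, alpha (ordS i))) :
  totY (Defs.setY r (repY r i + D)) = totY r + incl i *m D *m proj (ordS i).
Proof.
apply: (@sum_dfwith (fun i => 'M[K]_(alpha i, alpha (ordS i))) _
  (fun j B => incl j *m B *m proj (ordS j))) => j B C.
by rewrite mulmxDr mulmxDl.
Qed.

Lemma totv_setv r i (D : 'cV[K]_(alpha i)) :
  totv (Defs.setv r (repv r i + D)) = totv r + incl i *m D.
Proof.
apply: (@sum_dfwith (fun i => 'cV[K]_(alpha i)) _ (fun j B => incl j *m B)) => j B C.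
by rewrite mulmxDr.
Qed.

Lemma totw_setw r i (D : 'rV[K]_(alpha i)) :
  totw (Defs.setw r (repw r i + D)) = totw r + D *m proj i.
Proof.
apply: (@sum_dfwith (fun i => 'rV[K]_(alpha i)) _ (fun j B => B *m proj j)) => j B C.
by rewrite mulmxDl.
Qed.

Lemma delta_mulmx p q (u : 'rV[K]_p) (a : 'I_p) (b : 'I_q) (v : 'cV[K]_q) :
  (u *m delta_mx a b *m v) 0 0 = u 0 a * v b 0.
Proof.
rewrite mxE (bigD1 b) //= big1 ?addr0 => [|c cb].
  rewrite mxE (bigD1 a) //= big1 ?addr0 => [|c ca].
    by rewrite mxE !eqxx mulr1.
  by rewrite mxE (negPf ca) mulr0.
rewrite mxE big1 ?mul0r // => d _.
by rewrite mxE (negPf cb) andbF mulr0.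
Qed.

Lemma cm_ham_line (w : K -> 'rV[K]_N) (Y : K -> 'M[K]_N) (v : K -> 'cV[K]_N)
    w' Y' v' k :
  kmx_is_derive w 0 w' -> kmx_is_derive Y 0 Y' -> kmx_is_derive v 0 v' ->
  derive1 (fun h => - (w h *m Y h ^+ k *m v h) 0 0) 0
  = - ((w' *m Y 0 ^+ k *m v 0) 0 0
       + (w 0 *m (\sum_(p < k) Y 0 ^+ p *m Y' *m Y 0 ^+ (k - p.+1)) *m v 0) 0 0
       + (w 0 *m Y 0 ^+ k *m v') 0 0).
Proof.
move=> dw dY dv; apply: derive1_is_derive.
have := kmx_is_deriveM (kmx_is_deriveM dw (kmx_is_deriveX k dY)) dv.
move=> /(_ 0 0)/is_deriveN D; apply: is_derive_eq D _.
by rewrite mulmxDl !mxE.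
Qed.

Lemma bilinear_sum (J : Type) (s : seq J) p (u : 'rV[K]_p) (F : J -> 'M[K]_p) (v : 'cV[K]_p) :
  (u *m (\sum_(j <- s) F j) *m v) 0 0 = \sum_(j <- s) (u *m F j *m v) 0 0.
Proof. by rewrite mulmx_sumr mulmx_suml summxE. Qed.

Lemma sum_powers0 (A : 'M[K]_N) k : \sum_(p < k) A ^+ p *m 0 *m A ^+ (k - p.+1) = 0.
Proof. by apply: big1 => p _; rewrite mulmx0 mul0mx. Qed.

Lemma partialX_ham k i a b r : @partialX K n alpha (cm_ham k) i a b r = 0.
Proof. by apply: derive1_is_derive; exact: (is_derive_fct_cst (cm_ham k r)). Qed.

Lemma partialw_ham k i a r :
  @partialw K n alpha (cm_ham k) i a r = - (proj i *m (totY r ^+ k *m totv r)) a 0.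
Proof.
have E h : cm_ham k (Defs.setw r (repw r i + h *: delta_mx 0 a))
    = - ((totw r + h *: (delta_mx 0 a *m proj i)) *m totY r ^+ k *m totv r) 0 0.
  by rewrite /cm_ham totw_setw scalemxAl.
rewrite /partialw; under eq_fun do rewrite E.
rewrite (cm_ham_line _ (kmx_is_derive_line _ _) (kmx_is_derive_cst (totY r) _)
  (kmx_is_derive_cst (totv r) _)).
rewrite sum_powers0 !mulmx0 mul0mx [(0 : 'M_1) 0 0]mxE !addr0 -!mulmxA -rowE.
by rewrite mxE.
Qed.

Lemma partialv_ham k i a r :
  @partialv K n alpha (cm_ham k) i a r = - (totw r *m totY r ^+ k *m incl i) 0 a.
Proof.
have E h : cm_ham k (Defs.setv r (repv r i + h *: delta_mx a 0))
    = - (totw r *m totY r ^+ k *m (totv r + h *: (incl i *m delta_mx a 0))) 0 0.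
  by rewrite /cm_ham totv_setv scalemxAr.
rewrite /partialv; under eq_fun do rewrite E.
rewrite (cm_ham_line _ (kmx_is_derive_cst (totw r) _) (kmx_is_derive_cst (totY r) _)
  (kmx_is_derive_line _ _)).
rewrite sum_powers0 !mul0mx mulmx0 mul0mx [(0 : 'M_1) 0 0]mxE !add0r !mulmxA -colE.
by rewrite mxE.
Qed.

Lemma partialY_ham k i a b r : @partialY K n alpha (cm_ham k) i a b r =
  - \sum_(p < k) (totw r *m totY r ^+ p *m incl i) 0 a
       * (proj (ordS i) *m (totY r ^+ (k - p.+1) *m totv r)) b 0.
Proof.
have E h : cm_ham k (Defs.setY r (repY r i + h *: delta_mx a b))
    = - (totw r *m (totY r + h *: (incl i *m delta_mx a b *m proj (ordS i))) ^+ k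
           *m totv r) 0 0.
  by rewrite /cm_ham totY_setY -scalemxAr -scalemxAl.
rewrite /partialY; under eq_fun do rewrite E.
rewrite (cm_ham_line _ (kmx_is_derive_cst (totw r) _) (kmx_is_derive_line _ _)
  (kmx_is_derive_cst (totv r) _)).
rewrite !mul0mx mulmx0 [(0 : 'M_1) 0 0]mxE add0r !addr0 scale0r addr0.
rewrite bilinear_sum; congr (- _); apply: eq_bigr => p _.
by rewrite -delta_mulmx !mulmxA.
Qed.

(** The Hamiltonians do not involve X, so only the pairs v, w contribute. Summed over the vertices,
    both halves of the bracket equal w Y^(k+l) v. *)
Lemma poisson_ham k l r : poisson (cm_ham k) (cm_ham l) r = 0.
Proof.
have -> : poisson (cm_ham k) (cm_ham l) r =
  \sum_i \sum_(a < alpha i)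
     ((totw r *m totY r ^+ k *m incl i) 0 a * (proj i *m (totY r ^+ l *m totv r)) a 0
     - (totw r *m totY r ^+ l *m incl i) 0 a * (proj i *m (totY r ^+ k *m totv r)) a 0).
  apply: eq_bigr => i _; rewrite big1 ?add0r => [|a _]; last first.
    by apply: big1 => b _; rewrite !partialX_ham mul0r mulr0 subrr.
  apply: eq_bigr => a _; rewrite !partialv_ham !partialw_ham !mulrNN.
  by congr (_ - _); rewrite mulrC.
have pair u v : \sum_i \sum_(a < alpha i) (totw r *m u *m incl i) 0 a
     * (proj i *m (v *m totv r)) a 0 = (totw r *m (u *m v) *m totv r) 0 0.
  transitivity ((totw r *m u *m (\sum_i incl i *m proj i) *m (v *m totv r)) 0 0).
    rewrite bilinear_sum; apply: eq_bigr => i _.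
    by rewrite [_ *m (incl i *m _)]mulmxA -[in RHS](mulmxA _ (proj i)) [RHS]mxE.
  by rewrite sum_inclV_projV mulmx1 !mulmxA.
under [LHS]eq_bigr => i _ do rewrite sumrB; rewrite [LHS]sumrB !pair !mulmxE -!exprD addnC.
by rewrite subrr.
Qed.

Lemma derive1_fct_cst (c : K) (t : K) : derive1 (fun _ : K => c) t = 0.
Proof. by apply: derive1_is_derive; exact: is_derive_fct_cst. Qed.

Lemma derive1_entry p q (A B : 'M[K]_(p, q)) a b :
  derive1 (fun h => (A + h *: B) a b) 0 = B a b.
Proof. by apply: derive1_is_derive; exact: kmx_is_derive_line. Qed.

Local Notation pX f i a b r := (@partialX K n alpha f i a b r).
Local Notation pY f i a b r := (@partialY K n alpha f i a b r).
Local Notation pv f i a r := (@partialv K n alpha f i a r).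
Local Notation pw f i a r := (@partialw K n alpha f i a r).

Lemma poisson_hamE (f : cm_rep K alpha -> K) k r : poisson f (cm_ham k) r =
  \sum_i (\sum_(a < alpha (ordS i)) \sum_(b < alpha i)
      pX f i a b r * pY (cm_ham k) i b a r
    + \sum_(a < alpha i) (pv f i a r * pw (cm_ham k) i a r
                         - pw f i a r * pv (cm_ham k) i a r)).
Proof.
apply: eq_bigr => i _; congr (_ + _); apply: eq_bigr => a _; apply: eq_bigr => b _.
by rewrite partialX_ham mulr0 subr0.
Qed.

Lemma sum_delta2 p q (a : 'I_p) (b : 'I_q) (G : 'I_p -> 'I_q -> K) :
  \sum_c \sum_d delta_mx c d a b * G c d = G a b.
Proof.
rewrite (bigD1 a) //= [X in _ + X]big1 ?addr0 => [|c /negPf ca]; last first.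
  by apply: big1 => d _; rewrite mxE eq_sym ca mul0r.
rewrite (bigD1 b) //= big1 ?addr0 => [|d /negPf db].
  by rewrite mxE !eqxx mul1r.
by rewrite mxE [b == d]eq_sym db andbF mul0r.
Qed.

Lemma sum_only (V : zmodType) (i : I) (G : I -> V) :
  (forall j, j != i -> G j = 0) -> \sum_j G j = G i.
Proof.
by move=> G0; rewrite (bigD1 i) //= big1 ?addr0.
Qed.

Lemma poisson_X r i a b k :
  poisson (fun r => repX r i a b) (cm_ham k) r = pY (cm_ham k) i b a r.
Proof.
pose f (r : cm_rep K alpha) := repX r i a b.
have dX a' b' : pX f i a' b' r = delta_mx a' b' a b.
  by rewrite /partialX /f /=; under eq_fun do rewrite dfwith_in; exact: derive1_entry.
have dX0 j a' b' : j != i -> pX f j a' b' r = 0.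
  move=> ji; rewrite /partialX /f /=; under eq_fun do rewrite dfwith_out //.
  exact: derive1_fct_cst.
have dv j c : pv f j c r = 0 by exact: derive1_fct_cst.
have dw j c : pw f j c r = 0 by exact: derive1_fct_cst.
rewrite -[LHS]/(poisson f _ _) poisson_hamE; move: (f) dX dX0 dv dw => g dX dX0 dv dw.
rewrite (@sum_only _ i) => [|j ji].
  rewrite [X in _ + X]big1 ?addr0 => [|c _]; last by rewrite dv dw !mul0r subrr.
  under eq_bigr => a' _ do under eq_bigr => b' _ do rewrite dX.
  exact: (sum_delta2 a b (fun c d => pY (cm_ham k) i d c r)).
rewrite !big1 ?addr0 // => [c _|a' _]; first by rewrite dv dw !mul0r subrr.
by apply: big1 => b' _; rewrite dX0 ?mul0r.
Qed.

Lemma poisson_Y r i a b k : poisson (fun r => repY r i a b) (cm_ham k) r = 0.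
Proof.
pose f (r : cm_rep K alpha) := repY r i a b.
have dX j a' b' : pX f j a' b' r = 0 by exact: derive1_fct_cst.
have dv j c : pv f j c r = 0 by exact: derive1_fct_cst.
have dw j c : pw f j c r = 0 by exact: derive1_fct_cst.
rewrite -[LHS]/(poisson f _ _) poisson_hamE; move: (f) dX dv dw => g dX dv dw.
apply: big1 => j _; rewrite !big1 ?addr0 // => [c _|a' _].
  by rewrite dv dw !mul0r subrr.
by apply: big1 => b' _; rewrite dX mul0r.
Qed.

Lemma poisson_v r i a k :
  poisson (fun r => repv r i a 0) (cm_ham k) r = pw (cm_ham k) i a r.
Proof.
pose f (r : cm_rep K alpha) := repv r i a 0.
have dv c : pv f i c r = delta_mx c (0 : 'I_1) a 0.
  by rewrite /partialv /f /=; under eq_fun do rewrite dfwith_in; exact: derive1_entry.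
have dv0 j c : j != i -> pv f j c r = 0.
  move=> ji; rewrite /partialv /f /=; under eq_fun do rewrite dfwith_out //.
  exact: derive1_fct_cst.
have dX j a' b' : pX f j a' b' r = 0 by exact: derive1_fct_cst.
have dw j c : pw f j c r = 0 by exact: derive1_fct_cst.
rewrite -[LHS]/(poisson f _ _) poisson_hamE; move: (f) dX dv dv0 dw => g dX dv dv0 dw.
have X0 j : \sum_(c < alpha (ordS j)) \sum_(d < alpha j)
    pX g j c d r * pY (cm_ham k) j d c r = 0.
  by apply: big1 => c _; apply: big1 => d _; rewrite dX mul0r.
rewrite (@sum_only _ i) => [|j ji]; rewrite X0 add0r; last first.
  by apply: big1 => c _; rewrite dv0 // dw !mul0r subrr.
rewrite (bigD1 a) //= big1 ?addr0 => [|c /negPf ca]; rewrite dv dw mxE mul0r subr0.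
  by rewrite !eqxx mul1r.
by rewrite eq_sym ca mul0r.
Qed.

Lemma poisson_w r i a k :
  poisson (fun r => repw r i 0 a) (cm_ham k) r = - pv (cm_ham k) i a r.
Proof.
pose f (r : cm_rep K alpha) := repw r i 0 a.
have dw c : pw f i c r = delta_mx (0 : 'I_1) c 0 a.
  by rewrite /partialw /f /=; under eq_fun do rewrite dfwith_in; exact: derive1_entry.
have dw0 j c : j != i -> pw f j c r = 0.
  move=> ji; rewrite /partialw /f /=; under eq_fun do rewrite dfwith_out //.
  exact: derive1_fct_cst.
have dX j a' b' : pX f j a' b' r = 0 by exact: derive1_fct_cst.
have dv j c : pv f j c r = 0 by exact: derive1_fct_cst.
rewrite -[LHS]/(poisson f _ _) poisson_hamE; move: (f) dX dv dw0 dw => g dX dv dw0 dw.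
have X0 j : \sum_(c < alpha (ordS j)) \sum_(d < alpha j)
    pX g j c d r * pY (cm_ham k) j d c r = 0.
  by apply: big1 => c _; apply: big1 => d _; rewrite dX mul0r.
rewrite (@sum_only _ i) => [|j ji]; rewrite X0 add0r; last first.
  by apply: big1 => c _; rewrite dw0 // dv !mul0r subrr.
rewrite (bigD1 a) //= big1 ?addr0 => [|c /negPf ca]; rewrite dv dw mxE mul0r sub0r.
  by rewrite !eqxx mul1r.
by rewrite [a == c]eq_sym ca mul0r oppr0.
Qed.

End Partials.

(** * The Lax equation *)

Section TotalFlow.
Variables (K : numFieldType) (n : nat) (alpha : 'I_n.+1 -> nat).
Local Notation N := (\sum_i alpha i)%N.
Local Notation incl := (inclV K alpha).
Local Notation proj := (projV K alpha).
Variables (x : K -> cm_rep K alpha) (k : nat) (t : K).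
Hypothesis flow : ham_flow_at (cm_ham k) x t.
Local Notation r := (x t).

Lemma totX_flow : kmx_is_derive (fun s => totX (x s)) t (flowX r k).
Proof.
case: flow => dX _ _ _.
pose A := - \sum_(p < k) totY r ^+ p *m totv r *m totw r *m totY r ^+ (k - p.+1).
have dXi i : kmx_is_derive (fun s => repX (x s) i) t (proj (ordS i) *m A *m incl i).
  move=> a b; apply: is_derive_eq (dX i a b) _; rewrite poisson_X partialY_ham.
  rewrite /A mulmxN mulNmx [RHS]mxE; congr (- _).
  (* The partial derivative counts the powers of Y next to w, whereas [flowX] counts those next to
     v; the summation is reversed. *)
  rewrite mulmx_sumr mulmx_suml summxE (reindex_inj rev_ord_inj) /=.
  apply: eq_bigr => p _.
  have -> : (k - (k - p.+1).+1)%N = p by have := ltn_ord p; lia.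
  have -> : proj (ordS i) *m (totY r ^+ p *m totv r *m totw r *m totY r ^+ (k - p.+1))
      *m incl i = proj (ordS i) *m (totY r ^+ p *m totv r)
                  *m (totw r *m totY r ^+ (k - p.+1) *m incl i) by rewrite !mulmxA.
  by rewrite [RHS]mxE big_ord1 mulrC.
have D := kmx_is_derive_sum (index_enum _) xpredT
  (fun i => kmx_is_derive_mulr (proj i) (kmx_is_derive_mull (incl (ordS i)) (dXi i))).
apply: kmx_is_derive_eq D _; apply: eq_bigr => i _.
by rewrite !vertexE_def !mulmxA.
Qed.

Lemma totY_flow : kmx_is_derive (fun s => totY (x s)) t 0.
Proof.
case: flow => _ dY _ _.
have dYi i : kmx_is_derive (fun s => repY (x s) i) t 0.
  by move=> a b; apply: is_derive_eq (dY i a b) _; rewrite poisson_Y mxE.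
have D := kmx_is_derive_sum (index_enum _) xpredT
  (fun i => kmx_is_derive_mulr (proj (ordS i)) (kmx_is_derive_mull (incl i) (dYi i))).
by apply: kmx_is_derive_eq D _; apply: big1 => i _; rewrite mulmx0 mul0mx.
Qed.

Lemma totv_flow : kmx_is_derive (fun s => totv (x s)) t (- (totY r ^+ k *m totv r)).
Proof.
case: flow => _ _ dv _.
have dvi i : kmx_is_derive (fun s => repv (x s) i) t
    (- (proj i *m (totY r ^+ k *m totv r))).
  move=> a b; rewrite ord1; apply: is_derive_eq (dv i a) _.
  by rewrite poisson_v partialw_ham [RHS]mxE.
have D := kmx_is_derive_sum (index_enum _) xpredT
  (fun i => kmx_is_derive_mull (incl i) (dvi i)).
apply: kmx_is_derive_eq D _.
move: (totY r ^+ k *m totv r) => u.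
rewrite -[in RHS](mul1mx u) -sum_inclV_projV mulmx_suml -sumrN.
by apply: eq_bigr => i _; rewrite mulmxN mulmxA.
Qed.

Lemma totw_flow : kmx_is_derive (fun s => totw (x s)) t (totw r *m totY r ^+ k).
Proof.
case: flow => _ _ _ dw.
have dwi i : kmx_is_derive (fun s => repw (x s) i) t
    (totw r *m totY r ^+ k *m incl i).
  move=> a b; rewrite ord1; apply: is_derive_eq (dw i b) _.
  by rewrite poisson_w partialv_ham opprK.
have D := kmx_is_derive_sum (index_enum _) xpredT
  (fun i => kmx_is_derive_mulr (proj i) (dwi i)).
apply: kmx_is_derive_eq D _.
move: (totw r *m totY r ^+ k) => u.
rewrite -[RHS]mulmx1 -sum_inclV_projV mulmx_sumr.
by apply: eq_bigr => i _; rewrite mulmxA.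
Qed.

End TotalFlow.

(** * Inverses of curves of matrices of rational functions *)

Section RationalInverse.
Variable K : numFieldType.
Local Notation F := {fraction {poly K}}.

(** Only existence is recorded: for an inverse matrix the value is obtained afterwards from the
    differentiated identity, which avoids handling the derivatives of determinants. *)
Definition ratfun_differentiable (f : K -> F) (t : K) : Prop :=
  exists f', ratfun_is_derive f t f'.

(** Numerator and denominator exchange roles; the old numerator is nonzero because the curve is. *)
Lemma ratfun_differentiableV (f : K -> F) (t : K) : (forall s, f s != 0) ->
  ratfun_differentiable f t -> ratfun_differentiable (fun s => (f s)^-1) t.
Proof.
move=> f0 [f' [d [p [q [p' [q' [H dp dq _]]]]]]].
eexists; apply: (ratfun_is_derive_div (d := d)) dq dp.
near=> s.
have [sp sq q0 fE] : [/\ (size (p s) <= d)%N, (size (q s) <= d)%N,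
   q s != 0 & f s = FracField.tofrac (p s) / FracField.tofrac (q s)] by near: s.
split=> //; last by rewrite fE invf_div.
by apply: contraNneq (f0 s) => p0; rewrite fE p0 rmorph0 mul0r.
Unshelve. all: by end_near. Qed.

Lemma ratfun_differentiable_sum (J : Type) (r : seq J) (Q : pred J)
    (h : J -> K -> F) (t : K) : (forall j, ratfun_differentiable (h j) t) ->
  ratfun_differentiable (fun s => \sum_(j <- r | Q j) h j s) t.
Proof.
move=> dh; elim: r => [|j r [d' IHr]].
  by under eq_fun do rewrite big_nil; exists 0; exact: ratfun_is_derive_cst.
under eq_fun do rewrite big_cons; have [h' dj] := dh j.
case: (Q j); first by eexists; exact: ratfun_is_deriveD dj IHr.
by exists d'.
Qed.

Lemma ratfun_differentiable_prod (J : Type) (r : seq J) (Q : pred J)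
    (h : J -> K -> F) (t : K) : (forall j, ratfun_differentiable (h j) t) ->
  ratfun_differentiable (fun s => \prod_(j <- r | Q j) h j s) t.
Proof.
move=> dh; elim: r => [|j r [d' IHr]].
  by under eq_fun do rewrite big_nil; exists 0; exact: ratfun_is_derive_cst.
under eq_fun do rewrite big_cons; have [h' dj] := dh j.
case: (Q j); first by eexists; exact: ratfun_is_deriveM dj IHr.
by exists d'.
Qed.

Lemma ratfun_differentiableZ (c : F) (f : K -> F) (t : K) :
  ratfun_differentiable f t -> ratfun_differentiable (fun s => c * f s) t.
Proof. by move=> [f' df]; exists (c * f'); exact: ratfun_is_deriveZ. Qed.

Lemma ratfun_differentiable_det q (A : K -> 'M[F]_q) (t : K) :
  (forall i j, ratfun_differentiable (fun s => A s i j) t) ->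
  ratfun_differentiable (fun s => \det (A s)) t.
Proof.
move=> dA; apply: ratfun_differentiable_sum => p; apply: ratfun_differentiableZ.
exact: ratfun_differentiable_prod.
Qed.

Lemma ratfun_differentiable_invmx q (A : K -> 'M[F]_q) (t : K) :
  (forall s, A s \in unitmx) ->
  (forall i j, ratfun_differentiable (fun s => A s i j) t) ->
  forall i j, ratfun_differentiable (fun s => invmx (A s) i j) t.
Proof.
move=> uA dA i j; under eq_fun => s do rewrite /invmx uA !mxE.
have [d' dd] : ratfun_differentiable (fun s => (\det (A s))^-1) t.
  apply: ratfun_differentiableV; last exact: ratfun_differentiable_det.
  by move=> s; rewrite -unitfE -unitmxE.
have [c' dc] : ratfun_differentiable (fun s => cofactor (A s) j i) t.
  apply: ratfun_differentiableZ; apply: ratfun_differentiable_det => a b.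
  by under eq_fun do rewrite !mxE; exact: dA.
by eexists; exact: ratfun_is_deriveM dd dc.
Qed.

Lemma ratfun_is_derive_const (f : K -> K) (t f' : K) : is_derive t 1 f f' ->
  ratfun_is_derive (fun s => constF (f s)) t (constF f').
Proof.
move=> df; apply: (ratfun_is_derive_poly (d := 1)).
  by near=> s; exact: size_polyC_leq1.
move=> i; rewrite coefC; under eq_fun do rewrite coefC.
by case: eqP => _ //; exact: is_derive_fct_cst.
Unshelve. all: by end_near. Qed.

End RationalInverse.

(** * Derivatives of the dressing matrix and the Lax equation for lifted curves *)

Section DressingFlow.
Variables (K : numFieldType) (n : nat) (mu : K).
Hypothesis mu_prim : n.+1.-primitive_root mu.
Variables (tau : K) (kappa : 'I_n.+1 -> K) (alpha : 'I_n.+1 -> nat).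
Local Notation P := (Pring mu_prim tau kappa).
Local Notation N := (\sum_i alpha i)%N.
Local Notation y := (yP mu_prim tau kappa).
Local Notation PC := (PC mu_prim tau kappa).
Local Notation PF := (PF mu_prim tau kappa).
Local Notation mc := (map_mx PC).
Local Notation e0 := (e0 mu_prim tau kappa alpha).
Local Notation Xh := (Xh mu_prim tau kappa).
Local Notation Xi := (Xi mu_prim tau kappa).
Local Notation Yi := (resY mu_prim tau kappa).

Lemma mc_is_derive p q (S : K -> 'M[K]_(p, q)) (t : K) (S' : 'M[K]_(p, q)) :
  kmx_is_derive S t S' -> mx_is_derive (fun s => mc (S s)) t (mc S').
Proof.
move=> dS i j; rewrite mxE; under eq_fun do rewrite mxE.
by apply: curve_is_derive_PF; exact: ratfun_is_derive_const.
Qed.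

Lemma mx_is_deriveN p q (S : K -> 'M[P]_(p, q)) (t : K) (S' : 'M[P]_(p, q)) :
  mx_is_derive S t S' -> mx_is_derive (fun s => - S s) t (- S').
Proof.
move=> dS; have := mx_is_deriveM (mx_is_derive_cst (-1)%:M t) dS.
rewrite mul0mx add0r mul_scalar_mx scaleN1r.
by under eq_fun do rewrite mul_scalar_mx scaleN1r.
Qed.

(** The cofactor formula gives a derivative, and differentiating [Xh *m Xi = 1] forces its value. *)
Lemma Xi_is_derive (x : K -> cm_rep K alpha) (t : K) X' :
  kmx_is_derive (fun s => totX (x s)) t X' ->
  mx_is_derive (fun s => Xi (x s)) t (- (Xi (x t) *m mc X' *m Xi (x t))).
Proof.
move=> dX.
have [D dD] : exists D, mx_is_derive (fun s => Xi (x s)) t D.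
  have dR i j : ratfun_differentiable (fun s => resX (x s) i j) t.
    apply: ratfun_differentiable_invmx => [s|a b]; first exact: charX_unit.
    under eq_fun => s do rewrite !mxE.
    exists (constF (X' a b) + 0); apply: ratfun_is_deriveD; last exact: ratfun_is_derive_cst.
    exact: ratfun_is_derive_const.
  exists (\matrix_(i, j) PF (sval (cid (dR i j)))) => i j; rewrite mxE.
  under eq_fun do rewrite mxE.
  by apply: curve_is_derive_PF; exact: (svalP (cid (dR i j))).
apply: (mx_is_derive_eq dD).
have dXh : mx_is_derive (fun s => Xh (x s)) t (mc X').
  apply: mx_is_derive_eq (mx_is_deriveD (mc_is_derive dX) (mx_is_derive_cst _ t)) _.
  by rewrite addr0.
have /eqP := mx_is_derive_mul_cst (fun s => XhXi mu_prim tau kappa (x s)) dXh dD.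
rewrite addrC addr_eq0 => /eqP/(congr1 (mulmx (Xi (x t)))).
by rewrite mulmxA XiXh mul1mx mulmxN mulmxA.
Qed.

Lemma Yi_is_derive (x : K -> cm_rep K alpha) (t : K) :
  kmx_is_derive (fun s => totY (x s)) t 0 ->
  mx_is_derive (fun s => Yi (x s)) t 0.
Proof.
move=> dY a b; under eq_fun do rewrite mxE.
have dYk j : kmx_is_derive (fun s => totY (x s) ^+ j) t 0.
  apply: kmx_is_derive_eq (kmx_is_deriveX j dY) _.
  by apply: big1 => p _; rewrite mulmx0 mul0mx.
apply: (@curve_is_derive_eq _ _ _ _ _ _ _ _ (neg_series _ (fun=> 0))).
  apply: curve_is_derive_neg => j.
  have -> : 0 = - crossedF mu_prim (constF (0 : K)) by rewrite !rmorph0 oppr0.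
  apply: crossed_is_deriveN; apply: crossed_is_derive_crossedF.
  apply: ratfun_is_derive_const; have := dYk j a b; rewrite mxE; exact.
by rewrite mxE; apply: seriesP; apply: funext => -[].
Qed.

Lemma Mmx_is_derive (x : K -> cm_rep K alpha) (k : nat) (t : K) :
  ham_flow_at (cm_ham k) x t ->
  mx_is_derive (fun s => Mmx mu_prim tau kappa (x s)) t
    (dMmx mu_prim tau kappa (x t) k).
Proof.
move=> flow; have dXi := Xi_is_derive (totX_flow flow).
have dYi := Yi_is_derive (totY_flow flow).
have dW := mx_is_deriveM (mc_is_derive (totw_flow flow)) (mx_is_derive_cst e0 t).
have dV := mx_is_deriveM (mx_is_derive_cst e0 t) (mc_is_derive (totv_flow flow)).
have dM := mx_is_deriveD (mx_is_derive_cst 1%:M t)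
  (mx_is_deriveN (mx_is_deriveM (mx_is_deriveM dW (mx_is_deriveM dXi dYi)) dV)).
apply: mx_is_derive_eq dM _; rewrite add0r dMmxE; congr (- _).
rewrite !mulmx0 mul0mx add0r !addr0 map_mxN !mulmxN mulmxDl mulNmx !mulmxN mulNmx.
by rewrite !mulmxA.
Qed.

(** Existence suffices: the value is forced by the relation with [Mmx]. *)
Lemma Nmx_differentiable (x : K -> cm_rep K alpha) (k : nat) (t : K) :
  ham_flow_at (cm_ham k) x t ->
  exists N', mx_is_derive (fun s => Nmx mu_prim tau kappa (x s)) t N'.
Proof.
move=> flow; have dXi := Xi_is_derive (totX_flow flow).
have dYi := Yi_is_derive (totY_flow flow).
have dW := mx_is_deriveM (mc_is_derive (totw_flow flow)) (mx_is_derive_cst e0 t).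
have dV := mx_is_deriveM (mx_is_derive_cst e0 t) (mc_is_derive (totv_flow flow)).
have dN := mx_is_deriveD (mx_is_derive_cst 1%:M t)
  (mx_is_deriveM (mx_is_deriveM dW (mx_is_deriveM dYi dXi)) dV).
by eexists; exact: dN.
Qed.

Lemma conj_exp (M M' L : P) k : M' * M = 1 -> (M * L * M') ^+ k.+1 = M * L ^+ k.+1 * M'.
Proof.
move=> M'M; elim: k => [//|k IHk].
by rewrite exprS IHk !mulrA -[_ * M' * M]mulrA M'M mulr1 -[M * L * _]mulrA -exprS.
Qed.

Lemma cm_L_lax (x : K -> cm_rep K alpha) (k : nat) (t : K) : (0 < k)%N ->
  (forall s, cm_moment (cm_lambda tau kappa) (x s)) ->
  ham_flow_at (cm_ham k) x t ->
  let L s := cm_L mu_prim tau kappa (x s) in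
  curve_is_derive L t
    (nonneg_part (L t ^+ k) * L t - L t * nonneg_part (L t ^+ k)).
Proof.
move=> k0 mom flow L.
pose M s := Mmx mu_prim tau kappa (x s) 0 0; pose M' s := Nmx mu_prim tau kappa (x s) 0 0.
have LE s : L s = M s * y * M' s.
  by rewrite /L /cm_L (cm_M_inv mu_prim (mom s)).2 cm_ME.
have MM' s : M s * M' s = 1 by rewrite -mul_mx11 Mmx_mulr // mxE.
have M'M s : M' s * M s = 1 by rewrite -mul_mx11 Mmx_mull // mxE.
pose dMt := dMmx mu_prim tau kappa (x t) k 0 0; pose B := lax_mx mu_prim tau kappa (x t) k 0 0.
have dM : curve_is_derive M t dMt by exact: Mmx_is_derive.
have [N' dN] := Nmx_differentiable flow; pose N'0 := N' 0 0.
have dM' : curve_is_derive M' t N'0 by exact: dN.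
(* Obtained from the constant product [M s * M' s = 1] and uniqueness of derivatives. *)
have N'E : N'0 = - (M' t * dMt * M' t).
  have := curve_is_deriveM dM dM'; under eq_fun do rewrite MM'.
  move=> /curve_is_derive_unique/(_ (curve_is_derive_cst _ t))/eqP.
  rewrite addrC addr_eq0 => /eqP/(congr1 ( *%R (M' t))).
  by rewrite mulrA M'M mul1r mulrN mulrA.
(* [L t ^+ k] is [M t * y ^+ k * M' t], so this is the identity for the derivative of the dressing
   matrix multiplied by [M' t] on the right. *)
have LkE : L t ^+ k = B - dMt * M' t.
  have e : dMt + M t * y ^+ k = B * M t.
    have := dMmx_lax_mx mu_prim k (mom t) => /(congr1 (fun A : 'M_1 => A 0 0)).
    by rewrite mxE !mul_mx11 [(_%:M : 'M_1) 0 0]mxE eqxx mulr1n.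
  have -> : B = (dMt + M t * y ^+ k) * M' t by rewrite e -mulrA MM' mulr1.
  rewrite mulrDl addrAC subrr add0r LE; case: (k) k0 => // j _.
  exact: conj_exp.
have LkB : nonneg_part (L t ^+ k) = B.
  apply: nonneg_partE LkE _ _; first exact: nonneg_lax_mx.
  have : negative_series (dMt * M' t).
    by apply: negative_seriesM; [exact: negative_dMmx|exact: bnd0_Nmx].
  by move=> neg j j0; rewrite Defs.coefN neg ?oppr0.
have dL := curve_is_deriveM (curve_is_deriveM dM (curve_is_derive_cst y t)) dM'.
(* Since [L t ^+ k] commutes with [L t], the commutator with [B] reduces to the one with
   [dMt * M' t], which is the derivative of a conjugation. *)
rewrite LkB; have -> : B = L t ^+ k + dMt * M' t by rewrite LkE subrK.
have -> : L = fun s => M s * y * M' s by apply: funext => s; rewrite LE.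
apply: curve_is_derive_eq dL _; rewrite /= -LE.
rewrite mulr0 addr0 N'E mulrDl mulrDr -exprS -exprSr opprD addrACA subrr add0r.
rewrite LE mulrN !mulrA; congr (_ - _).
by rewrite -[dMt * M' t * M t]mulrA M'M mulr1.
Qed.

End DressingFlow.

(** * Passage to the quotient *)

Section Hierarchy.
Variables (K : numFieldType) (n : nat) (mu : K).
Hypothesis mu_prim : n.+1.-primitive_root mu.
Variables (tau : K) (kappa : 'I_n.+1 -> K) (alpha : 'I_n.+1 -> nat).

(** The representative chosen by [cm_lift] differs from [x] by a group element, under which [cm_M]
    is invariant. *)
Lemma cm_lax_orbit (x : cm_fiber alpha (cm_lambda tau kappa)) :
  cm_lax mu_prim (cm_orbit x) = cm_L mu_prim tau kappa (sval x).
Proof.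
have : same_orbit x (cm_lift (cm_orbit x)) by apply/eqmodP; rewrite reprK.
by move=> /asboolP[g [gU e]]; rewrite /cm_lax /cm_L e cm_M_gl_act.
Qed.

(** The chosen representatives along [c] need not vary differentiably. Near [t] they are replaced by
    the lifted integral curve, which gives the same L by invariance and satisfies the moment
    equation at every time. *)
Lemma cm_lax_flow k (U : set K) (c : K -> cm_space alpha (cm_lambda tau kappa)) t :
  (0 < k)%N -> cm_integral_curve (cm_ham k) U c -> U t ->
  let L := fun s => cm_lax mu_prim (c s) in
  series_is_derive L t
    (nonneg_part (L t ^+ k) * L t - L t * nonneg_part (L t ^+ k)).
Proof.
move=> k0 [_ curve] Ut L; have [x cx] := curve t Ut.
have [ct flow] := nbhs_singleton cx.
have -> : L t = cm_L mu_prim tau kappa (sval (x t)) by rewrite /L ct cm_lax_orbit.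
have Lx : \forall s \near t, cm_L mu_prim tau kappa (sval (x s)) = L s.
  by move: cx; apply: filterS => s [cs _]; rewrite /L cs cm_lax_orbit.
apply: curve_is_derive_near Lx (cm_L_lax mu_prim k0 _ flow).
by move=> s; exact: svalP.
Qed.

End Hierarchy.

(* m = n.+1 and the ground field is C = R[i]. *)
Theorem theorem4p4 (R : realType) (n : nat) (mu : R[i])
    (mu_prim : n.+1.-primitive_root mu) (tau : R[i])
    (kappa : 'I_n.+1 -> R[i]) (alpha : 'I_n.+1 -> nat)
    (tau_neq0 : tau != 0) (lambda_regular : cm_regular (cm_lambda tau kappa)) :
  [/\ (* the map (X, Y, v, w) |-> M y M^-1 is well defined on the quotient *)
      forall x : cm_fiber alpha (cm_lambda tau kappa),
        cm_M mu_prim tau kappa (sval x) \is a GRing.unit /\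
        cm_lax mu_prim (cm_orbit x) = cm_L mu_prim tau kappa (sval x),
      (* the Hamiltonians pairwise commute *)
      forall (k l : nat) (x : cm_fiber alpha (cm_lambda tau kappa)),
        (0 < k)%N -> (0 < l)%N ->
        poisson (cm_ham k) (cm_ham l) (sval x) = 0
    & (* the flows are mapped to the flows of the hierarchy *)
      forall (k : nat) (U : set R[i])
             (c : R[i] -> cm_space alpha (cm_lambda tau kappa)),
        (0 < k)%N -> cm_integral_curve (cm_ham k) U c ->
        forall t, U t ->
          let L := fun s => cm_lax mu_prim (c s) in
          series_is_derive L t
            (nonneg_part (L t ^+ k) * L t - L t * nonneg_part (L t ^+ k))].
Proof.
split=> [x|k l x _ _|k U c k0 curve t Ut].
- by split; [exact: (cm_M_inv mu_prim (svalP x)).1|exact: cm_lax_orbit].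
- exact: poisson_ham.
- exact: (cm_lax_flow mu_prim k0 curve Ut).
Qed.
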